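(* Let $\alpha\in[1,n)$ and suppose that the system $\dot x=f(t,x)$, evolving on a state space $D\subseteq\mathbb{R}^n$, is $\alpha$ contracting. Then any compact and strongly invariant set $K\subseteq D$ of the system has Hausdorff dimension smaller than $\alpha$.
   Context: **System.** $f$ is $C^1$, $x(t,x_0)$ denotes the solution at time $t$ of $\dot x=f(t,x)$ with $x(0)=x_0$, and $D\subseteq\mathbb{R}^n$ is an invariant set: $x_0\in D$ implies $x(t,x_0)\in D$ for all $t\ge 0$. $J_f(t,x):=\frac{\partial}{\partial x}f(t,x)$. A set $K\subseteq D$ is strongly invariant if $K=x(t,K)$ for all $t\ge 0$, where $x(t,K)=\{x(t,x_0):x_0\in K\}$. **Compounds.** For a matrix $A$, $A^{(k)}$ is the matrix of all $k\times k$ minors of $A$ in lexicographic order. For $A\in\mathbb{R}^{n\times n}$, $A^{[k]}:=\frac{d}{d\varepsilon}(I+\varepsilon A)^{(k)}|_{\varepsilon=0}$. For a non-integer $\alpha=k+s\in(1,n)$, $k\in\{1,\dots,n-1\}$, $s\in(0,1)$, the $\alpha$ multiplicative compound of a non-singular $B$ is $B^{(\alpha)}:=(B^{(k)})^{1-s}\otimes(B^{(k+1)})^s$, where $\otimes$ is the Kronecker product and real powers are principal powers (defined via the Jordan form, with $a^\beta=|a|^\beta e^{j\beta\theta(a)}$, $\theta(a)\in(-\pi,\pi]$ for scalars). The $\alpha$ additive compound is $A^{[\alpha]}:=\frac{d}{d\varepsilon}(I+\varepsilon A)^{(\alpha)}|_{\varepsilon=0}$. For integer $\alpha=k$, $A^{[\alpha]}$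 is the standard $A^{[k]}$. **Matrix measure.** For a vector norm with induced matrix norm $\|\cdot\|$, $\mu(A):=\lim_{\varepsilon\downarrow0}\frac{\|I+\varepsilon A\|-1}{\varepsilon}$ (applied to square matrices of any size, using the $L_p$ norm of the corresponding dimension). **$\alpha$ contraction.** The system is $\alpha$ contracting (w.r.t. the norm $|\cdot|_p$, $p\ge 1$) if, for the matrix measure $\mu$ induced by the $L_p$ norm, there is $\eta>0$ such that $\mu(J_f^{[\alpha]}(t,x))\le-\eta<0$ for all $t\ge0$ and $x\in D$. *)

(* Defs.v *)
From HB Require Import structures.
From mathcomp Require Import all_boot all_order all_algebra.
From mathcomp Require Import all_classical all_reals all_analysis.
From mathcomp.real_closed Require Import complex mxtens.

Set Implicit Arguments.
Unset Strict Implicit.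
Unset Printing Implicit Defensive.

Import Order.TTheory GRing.Theory Num.Theory.
Import numFieldNormedType.Exports.

Local Open Scope classical_set_scope.
Local Open Scope ring_scope.

(* All k-element subsequences of s; when s is strictly increasing they come out
   in lexicographic order: those containing the head of s precede the others. *)
Fixpoint subseqs_of_size (T : Type) (k : nat) (s : seq T) : seq (k.-tuple T) :=
  match k with
  | 0 => [:: [tuple]]
  | k'.+1 =>
      (fix go (s : seq T) : seq (k'.+1.-tuple T) :=
         if s is y :: s' then
           [seq cons_tuple y t | t <- subseqs_of_size k' s'] ++ go s'
         else [::]) s
  end.

Lemma size_subseqs_of_size (T : Type) (k : nat) (s : seq T) :
  size (subseqs_of_size k s) = 'C(size s, k).
Proof.
elim: k s => [|k IHk] s; first by rewrite bin0.
elim: s => [|y s IHs] //=.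
by rewrite size_cat size_map IHk [X in (_ + X)%N]IHs binS addnC.
Qed.

Lemma size_subseqs_enum_ord (n k : nat) :
  size (subseqs_of_size k (enum 'I_n)) == 'C(n, k).
Proof. by rewrite size_subseqs_of_size size_enum_ord. Qed.

Definition lex_subsets (n k : nat) : 'C(n, k).-tuple (k.-tuple 'I_n) :=
  Tuple (size_subseqs_enum_ord n k).

Section Compounds.
Variable R : realType.

Definition mul_compound (k n : nat) (A : 'M[R]_n) : 'M[R]_'C(n, k) :=
  \matrix_(i, j) \det (mxsub (tnth (tnth (lex_subsets n k) i))
                             (tnth (tnth (lex_subsets n k) j)) A).

Definition add_compound (k n : nat) (A : 'M[R]_n) : 'M[R]_'C(n, k) :=
  derive1 (fun e : R => mul_compound k (1%:M + e *: A)) 0.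

(* For z != 0, the argument of z in ]-pi, pi]. *)
Definition principal_arg (z : R[i]) : R :=
  let a := acos (complex.Re z / Normc.normc z) in
  if 0 <= complex.Im z then a else - a.

Definition principal_pow (z : R[i]) (b : R) : R[i] :=
  ((Normc.normc z `^ b)%:C *
   (cos (b * principal_arg z) +i* sin (b * principal_arg z)))%C.

Definition gen_binomial (b : R) (m : nat) : R :=
  (\prod_(l < m) (b - l%:R)) / m`!%:R.

Definition jordan_block (d : nat) (l : R[i]) : 'M[R[i]]_d :=
  \matrix_(i, j) (l *+ (i == j) + (i.+1 == j :> nat)%:R).

(* The principal branch of z ^ b applied to a Jordan block: the (i, j) entry,
   i <= j, is the derivative of order j - i of z ^ b at l over (j - i)!. *)
Definition jordan_block_pow (d : nat) (l : R[i]) (b : R) : 'M[R[i]]_d :=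
  \matrix_(i, j) if (i <= j)%N
    then ((gen_binomial b (j - i))%:C)%C * principal_pow l (b - (j - i)%:R)
    else 0.

Definition is_principal_mxpow (N : nat) (B : 'M[R[i]]_N) (b : R)
    (P : 'M[R[i]]_N) : Prop :=
  exists (m : nat) (d : 'I_m -> nat) (l : 'I_m -> R[i])
         (T : 'M[R[i]]_(N, \sum_i d i)) (T' : 'M[R[i]]_(\sum_i d i, N)),
    [/\ T *m T' = 1%:M, T' *m T = 1%:M,
        B = T *m \mxdiag_(i < m) jordan_block (d i) (l i) *m T' &
        P = T *m \mxdiag_(i < m) jordan_block_pow (d i) (l i) b *m T'].

(* For non-singular B the power exists and does not depend on the choice of the
   Jordan decomposition. *)
Definition principal_mxpow (N : nat) (B : 'M[R[i]]_N) (b : R) : 'M[R[i]]_N :=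
  xget 0 [set P | is_principal_mxpow B b P].

(* The compound of order k + s, 0 < s < 1. *)
Definition frac_mul_compound (k : nat) (s : R) (n : nat) (B : 'M[R]_n) :
    'M[R[i]]_('C(n, k) * 'C(n, k.+1)) :=
  principal_mxpow (map_mx (real_complex R) (mul_compound k B)) (1 - s) *t
  principal_mxpow (map_mx (real_complex R) (mul_compound k.+1 B)) s.

(* The spectra of the compounds of I + e A are close to 1 for small e, so their
   principal powers are real there and taking real parts loses nothing. *)
Definition frac_add_compound (k : nat) (s : R) (n : nat) (A : 'M[R]_n) :
    'M[R]_('C(n, k) * 'C(n, k.+1)) :=
  derive1 (fun e : R =>
    map_mx (@complex.Re R) (frac_mul_compound k s (1%:M + e *: A))) 0.

(* The size of the compound depends on whether alpha is an integer, hence the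
   dependent pair. *)
Definition alpha_add_compound (alpha : R) (n : nat) (A : 'M[R]_n) :
    {N : nat & 'M[R]_N} :=
  let k := Num.truncn alpha in
  let s := alpha - k%:R in
  if s == 0 then existT (fun N => 'M[R]_N) _ (add_compound k A)
  else existT (fun N => 'M[R]_N) _ (frac_add_compound k s A).

End Compounds.

Section MatrixMeasure.
Variables (R : realType) (p : \bar R).

(* Meaningful for 1 <= p <= +oo; the value at -oo is a dummy. *)
Definition lp_norm (m : nat) (v : 'I_m -> R) : R :=
  match p with
  | q%:E => (\sum_i `|v i| `^ q) `^ q^-1
  | +oo%E => \big[Num.max/0]_i `|v i|
  | -oo%E => 0
  end.

Definition lp_opnorm (m : nat) (A : 'M[R]_m) : R :=
  sup [set lp_norm ((A *m v)^~ 0) |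
        v in [set v : 'cV[R]_m | lp_norm (v^~ 0) = 1]].

Definition lp_measure (m : nat) (A : 'M[R]_m) : R :=
  lim ((lp_opnorm (1%:M + e *: A) - 1) / e @[e --> (0 : R)^'+]).

End MatrixMeasure.

Section HausdorffDimension.
Variables (R : realType) (n : nat).
Implicit Types (x y : 'rV[R]_n) (U K : set 'rV[R]_n).

Definition euclidean_dist x y : R := lp_norm 2%:E ((x - y) 0).

Definition diameter U : \bar R :=
  ereal_sup (0%E |` [set (euclidean_dist z.1 z.2)%:E | z in U `*` U]).

Definition hausdorff_content (d delta : R) K : \bar R :=
  ereal_inf [set (\sum_(0 <= i <oo) diameter (U i) `^ d)%E |
    U in [set U : nat -> set 'rV[R]_n |
           (forall i, (diameter (U i) <= delta%:E)%E) /\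
           K `<=` \bigcup_i U i]].

Definition hausdorff_measure (d : R) K : \bar R :=
  ereal_sup [set hausdorff_content d delta K | delta in [set delta | 0 < delta]].

(* Exponent 0 is left out: this does not change the infimum and makes the
   convention for 0 ^ 0 irrelevant. *)
Definition hausdorff_dim K : \bar R :=
  ereal_inf [set d%:E | d in [set d : R | 0 < d /\ hausdorff_measure d K = 0%E]].

End HausdorffDimension.

Section Systems.
Variables (R : realType) (n : nat).
Implicit Types (f x : R -> 'rV[R]_n -> 'rV[R]_n) (D K : set 'rV[R]_n).

Definition C1 (V W : normedModType R) (g : V -> W) : Prop :=
  (forall z, differentiable g z) /\
  (forall v, continuous (fun z => 'd g z v)).

(* C^1 on [0, +oo[ x R^n, i.e. up to the boundary t = 0. *)
Definition C1_system f : Prop :=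
  exists2 g : R * 'rV[R]_n -> 'rV[R]_n,
    C1 g & forall t z, 0 <= t -> f t z = g (t, z).

(* Given the differential equation for t > 0 and the continuity of f,
   continuity of y at 0 amounts to the one-sided equation at t = 0. *)
Definition is_solution f (z : 'rV[R]_n) (y : R -> 'rV[R]_n) : Prop :=
  [/\ y 0 = z,
      {within `[0, +oo[, continuous y} &
      forall t : R, 0 < t -> is_derive t 1 y (f t (y t))].

Definition forward_invariant x D : Prop :=
  forall z, D z -> forall t, 0 <= t -> D (x t z).

Definition strongly_invariant x K : Prop :=
  forall t, 0 <= t -> K = x t @` K.

(* The library's Jacobian acts on row vectors from the right; transposing gives
   the matrix with entries d f_i / d x_j. *)
Definition system_jacobian f (t : R) (z : 'rV[R]_n) : 'M[R]_n :=
  (jacobian (f t) z)^T.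

Definition alpha_contracting (p : \bar R) (alpha : R) f D : Prop :=
  exists2 eta : R, 0 < eta &
    forall t z, 0 <= t -> D z ->
      lp_measure p (projT2 (alpha_add_compound alpha (system_jacobian f t z)))
        <= - eta.

End Systems.

(* Main.v *)
Require Import Defs.
From HB Require Import structures.
From mathcomp Require Import all_boot all_order all_algebra all_fingroup.
From mathcomp.real_closed Require Import complex mxtens.
From mathcomp Require Import all_classical all_reals all_analysis.
From mathcomp Require Import zify ring lra.

Set Implicit Arguments.
Unset Strict Implicit.
Unset Printing Implicit Defensive.

Import Order.TTheory GRing.Theory Num.Theory.
Import numFieldNormedType.Exports.

Local Open Scope classical_set_scope.
Local Open Scope ring_scope.

(** Write alpha = k + s with k < n and 0 < s <= 1 (so k = alpha - 1 when alpha is an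
integer). The additive compound of fractional order is
(1 - s) (A^[k] (x) 1) + s (1 (x) A^[k+1]), and for an L_p norm the measure of this
Kronecker sum dominates (1 - s) mu(A^[k]) + s mu(A^[k+1]). Along a trajectory in K
the derivative of the flow is a limit of products of factors 1 + h J; multiplicativity
of the compounds and weighted AM-GM on each factor then show that
|Y^(k)|^(1-s) |Y^(k+1)|^s decays exponentially for the derivative Y of the time-T map.
Complete pivoting replaces the singular value decomposition of Y: the product of the
first k pivots is a k x k minor of Y. The time-T image of a small set of diameter r is
covered by boxes of side proportional to max(p_k, kappa) r, and for T large, kappa
small and then d slightly below alpha the total d-weight of these boxes is at most half
of r^d. As K is its own time-T image, iterating yields covers of K of arbitrarily small
mesh and d-weight, so the d-dimensional Hausdorff measure of K vanishes. *)

(** The constants are chosen in an order that avoids circularity. The covering constants depend only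
    on k, s and n, so T can be taken large enough for [expR (- eta / 4 * T)] to beat them; T fixes
    the growth constant of the flow over [0, T], which fixes kappa, then b = alpha - d, then the
    accuracy of the linearisation, and last the Euler step. The differential of the flow never
    occurs in the code: one Euler product with finitely many steps serves as linear approximation,
    with an error relative to the distance of the initial points. Taking s in ]0, 1] rather than [0,
    1[ keeps a positive power of pivot number k (counted from 0) in the weight; this is what makes a
    small kappa effective. On the algebraic side the obstacle is that a fractional compound is the
    derivative of a power defined through a chosen Jordan basis, over which there is no control as
    the matrix varies. Every admissible choice is therefore identified, near the identity, with the
    binomial series at B - 1, and the resulting error is quadratic in B - 1 with a constant
    independent of the basis. *)

Section MxNorm.
Variables (R : realType) (m n : nat).
Implicit Types M : 'M[R]_(m, n).

Lemma mxnorm_entry M i j : `|M i j| <= `|M|.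
Proof.
rewrite [leRHS](mx_normrE M).
exact: (le_bigmax 0 (fun ij : 'I_m * 'I_n => `|M ij.1 ij.2|) (i, j)).
Qed.

Lemma mxnorm_le M (c : R) : 0 <= c -> (forall i j, `|M i j| <= c) -> `|M| <= c.
Proof. by move=> c0 h; rewrite [leLHS](mx_normrE M); apply/bigmax_leP; split. Qed.

(** Both additive compounds are defined by [derive1]; an entrywise O(e^2) remainder gives the
    derivative without prior knowledge of differentiability. *)
Lemma derive1_quadratic (f : R -> 'M[R]_(m, n)) (f0 : 'M[R]_(m, n)) D (C e0 : R) :
    0 < e0 -> 0 <= C ->
    (forall e : R, `|e| <= e0 -> forall i j, `|(f e - f0 - e *: D) i j| <= C * e ^+ 2) ->
  derive1 f 0 = D.
Proof.
move=> e00 C0 h.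
have f00 : f 0 = f0.
  apply/subr0_eq/matrixP => i j; have := h 0 _ i j.
  by rewrite normr0 scale0r subr0 expr0n mulr0 normr_le0 => /(_ (ltW e00)) /eqP ->; rewrite mxE.
rewrite /derive1; apply: cvg_lim; first exact: norm_hausdorff.
apply/cvgrPdist_le => e e_gt0; near=> t.
rewrite addr0 f00.
have t0 : t != 0 by near: t; exact: nbhs_dnbhs_neq.
have te : `|t| <= e0.
  near: t; apply: dnbhs0_le => //.
have tC : `|t| <= e / (C + 1).
  by near: t; apply: dnbhs0_le; rewrite divr_gt0 // ltr_pwDr.
apply: mxnorm_le; first exact: ltW.
move=> i j; have := h t te i j; rewrite !mxE => H.
rewrite -(@ler_pM2l _ `|t|) ?normr_gt0 // -normrM.
have -> : t * (D i j - t^-1 * (f t i j - f0 i j)) = - (f t i j - f0 i j - t * D i j) by field.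
rewrite normrN; apply: le_trans H _.
rewrite -real_normK ?num_real // expr2 mulrA [C * _]mulrC -mulrA ler_wpM2l //.
apply: (@le_trans _ _ ((C + 1) * `|t|)); first by rewrite ler_wpM2r // lerDl.
by rewrite mulrC -ler_pdivlMr // ltr_pwDr.
Unshelve. all: by end_near. Qed.

End MxNorm.

(** * Minors and multiplicative compounds *)

Lemma subseqs_of_sizeS (T : Type) (k : nat) (y : T) (s : seq T) :
  subseqs_of_size k.+1 (y :: s) =
  [seq cons_tuple y t | t <- subseqs_of_size k s] ++ subseqs_of_size k.+1 s.
Proof. by []. Qed.

Lemma mem_subseqs_of_size (T : eqType) (k : nat) (s : seq T) (t : k.-tuple T) :
  (t \in subseqs_of_size k s) = subseq t s.
Proof.
elim: k s t => [|k IHk] s t.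
  by rewrite (tuple0 t) /= inE eqxx sub0seq.
elim: s t => [|y s IHs] t.
  by case/tupleP: t => x t.
rewrite subseqs_of_sizeS mem_cat IHs; case/tupleP: t => x t /=.
apply/orP/idP.
  case=> [/mapP[t' ht' /(congr1 val)[-> et]]|].
    by rewrite eqxx et -IHk.
  by case: eqP => // _; apply: subseq_trans; exact: subseq_cons.
case: eqP => [->|_] h; last by right.
by left; apply/mapP; exists t; rewrite ?IHk //; apply: val_inj.
Qed.

Lemma uniq_subseqs_of_size (T : eqType) (k : nat) (s : seq T) :
  uniq s -> uniq (subseqs_of_size k s).
Proof.
elim: k s => [|k IHk] s //; elim: s => [|y s IHs] // /andP[ys us].
rewrite subseqs_of_sizeS cat_uniq IHs // andbT map_inj_uniq ?IHk //=; last first.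
  by move=> t t' /(congr1 val)[e]; apply: val_inj.
apply/hasPn => t; rewrite mem_subseqs_of_size => /mem_subseq h.
apply/mapP => -[t' _ et]; move: ys; rewrite h //.
by rewrite et mem_head.
Qed.

Section Lex.
Variables n k : nat.

Lemma lex_subsets_inj : injective (fun i => tnth (lex_subsets n k) i).
Proof.
apply/tuple_uniqP.
exact: (uniq_subseqs_of_size k (enum_uniq 'I_n)).
Qed.

Lemma lex_subset_mem (t : k.-tuple 'I_n) : subseq t (enum 'I_n) ->
  exists i, t = tnth (lex_subsets n k) i.
Proof.
rewrite -mem_subseqs_of_size => h.
by have /tnthP[i ->] : t \in lex_subsets n k by []; exists i.
Qed.

Lemma lex_subsetP i : subseq (tnth (lex_subsets n k) i) (enum 'I_n).
Proof. by rewrite -mem_subseqs_of_size; exact: (mem_tnth i (lex_subsets n k)). Qed.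

Lemma lex_subset_tnth_inj i : injective (tnth (tnth (lex_subsets n k) i)).
Proof. by apply/tuple_uniqP; apply: subseq_uniq (lex_subsetP i) (enum_uniq _). Qed.

(** Both tuples are strictly increasing, and a sorted list is determined by its elements. *)
Lemma lex_subset_eq i j : tnth (lex_subsets n k) i =i tnth (lex_subsets n k) j -> i = j.
Proof.
move=> h; apply: lex_subsets_inj; apply: val_inj => /=.
pose f := relpre (@nat_of_ord n) ltn.
have tf : transitive f by move=> x y z; exact: ltn_trans.
have so : sorted f (enum 'I_n).
  by rewrite -sorted_map val_enum_ord iota_ltn_sorted.
apply: (@irr_sorted_eq _ f) => //.
- by move=> x; rewrite /f /= ltnn.
- exact: @subseq_sorted _ f tf _ _ (lex_subsetP i) so.
- exact: @subseq_sorted _ f tf _ _ (lex_subsetP j) so.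
Qed.

(** Separates an unordered choice of indices into a subset and a permutation, which is how arbitrary
    minors reach the entries of a compound. *)
Lemma injective_lexP (f : 'I_k -> 'I_n) : injective f ->
  exists (i : 'I_'C(n, k)) (s : 'S_k), forall a, f a = tnth (tnth (lex_subsets n k) i) (s a).
Proof.
move=> fi.
pose im := [seq x <- enum 'I_n | x \in codom f].
have sz : size im == k.
  have -> : size im = size (codom f).
    apply/perm_size/uniq_perm; first exact/filter_uniq/enum_uniq.
      by rewrite map_inj_uniq ?enum_uniq.
    by move=> x; rewrite mem_filter mem_enum inE andbT.
  by rewrite size_codom card_ord.
have [i ei] := @lex_subset_mem (Tuple sz) (filter_subseq _ _).
have fim a : exists b, f a == tnth (tnth (lex_subsets n k) i) b.
  have /tnthP[b ->] : f a \in Tuple sz.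
    by rewrite /= mem_filter mem_enum codom_f.
  by exists b; rewrite -ei.
pose s a := xchoose (fim a).
have hs a : f a = tnth (tnth (lex_subsets n k) i) (s a) by exact/eqP/(xchooseP (fim a)).
have si : injective s by move=> a b e; apply: fi; rewrite !hs e.
by exists i, (perm si) => a; rewrite permE hs.
Qed.

End Lex.

Section CauchyBinet.
Variable R : comNzRingType.

Lemma det_mxsub_perm (k m : nat) (f : 'I_k -> 'I_m) (s : 'S_k) (B : 'M[R]_(m, k)) :
  \det (\matrix_(i, j) B (f (s i)) j) = (-1) ^+ s * \det (\matrix_(i, j) B (f i) j).
Proof.
rewrite -det_perm -det_mulmx; congr (\det _).
by apply/matrixP => i j; rewrite -row_permE !mxE.
Qed.

Lemma det_mulmx_rect (k m : nat) (A : 'M[R]_(k, m)) (B : 'M[R]_(m, k)) :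
  \det (A *m B) = \sum_(f : {ffun 'I_k -> 'I_m})
     (\prod_i A i (f i)) * \det (\matrix_(i, j) B (f i) j).
Proof.
under [RHS]eq_bigr do rewrite /determinant mulr_sumr.
rewrite exchange_big /=; apply: eq_bigr => s _.
under eq_bigr do rewrite mxE.
rewrite bigA_distr_bigA mulr_sumr /=; apply: eq_bigr => f _.
rewrite mulrCA -big_split /=; congr (_ * _).
by apply: eq_bigr => i _; rewrite mxE.
Qed.

(** In the expansion over all maps of indices, a non-injective map gives a repeated row; an
    injective one is a permutation followed by a subset, and summing over the permutations
    reassembles the minor of A. *)
Lemma Cauchy_Binet (k n : nat) (A : 'M[R]_(k, n)) (B : 'M[R]_(n, k)) :
  \det (A *m B) = \sum_(l < 'C(n, k))
    \det (\matrix_(i, j) A i (tnth (tnth (lex_subsets n k) l) j)) *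
    \det (\matrix_(i, j) B (tnth (tnth (lex_subsets n k) l) i) j).
Proof.
rewrite det_mulmx_rect.
pose L l := tnth (tnth (lex_subsets n k) l).
rewrite (bigID (fun f : {ffun 'I_k -> 'I_n} => injectiveb f)) /= addrC big1 ?add0r; last first.
  move=> f /injectivePn[a [b ab fab]]; rewrite (determinant_alternate ab) ?mulr0 //.
  by move=> j; rewrite !mxE fab.
(* A bijection from pairs (subset, permutation) onto the injective maps. *)
pose h (u : 'I_'C(n, k) * 'S_k) : {ffun 'I_k -> 'I_n} := [ffun a => L u.1 (u.2 a)].
have hinj : injective h.
  move=> [l s] [l' s'] /ffunP e.
  have ll' : l = l'.
    apply: lex_subset_eq => x; apply/tnthP/tnthP => -[a ->].
      by exists (s' (s^-1%g a)); have := e (s^-1%g a); rewrite !ffunE /= permKV.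
    by exists (s (s'^-1%g a)); have := e (s'^-1%g a); rewrite !ffunE /= permKV.
  subst l'; congr pair; apply/permP => a.
  by apply: (@lex_subset_tnth_inj _ _ l); have := e a; rewrite !ffunE.
transitivity (\sum_(f in h @: [set: 'I_'C(n, k) * 'S_k]%SET) (\prod_i A i (f i)) * \det (\matrix_(i, j) B (f i) j)).
  apply: eq_bigl => f; apply/injectiveP/imsetP.
    move=> /injective_lexP[l [s e]]; exists (l, s); first by rewrite inE.
    by apply/ffunP => a; rewrite ffunE e.
  move=> [[l s] _ ->] a b; rewrite !ffunE => /lex_subset_tnth_inj.
  exact: perm_inj.
rewrite big_imset /=; last by move=> ? ? _ _; exact: hinj.
rewrite (eq_bigl xpredT); last by move=> ?; rewrite inE.
rewrite -(pair_bigA _ (fun l s => (\prod_i A i (h (l, s) i)) *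
   \det (\matrix_(i, j) B (h (l, s) i) j))) /=.
apply: eq_bigr => l _; rewrite [X in X * _]/determinant mulr_suml.
apply: eq_bigr => s _.
have -> : \matrix_(i, j) B (h (l, s) i) j = \matrix_(i, j) B (L l (s i)) j.
  by apply/matrixP => i j; rewrite !mxE ffunE.
rewrite det_mxsub_perm mulrCA mulrA; congr (_ * _ * _).
by apply: eq_bigr => i _; rewrite mxE ffunE.
Qed.

End CauchyBinet.

Section MulCompound.
Variables (R : realType) (n k : nat).

Lemma mul_compoundM (A B : 'M[R]_n) :
  mul_compound k (A *m B) = mul_compound k A *m mul_compound k B.
Proof.
apply/matrixP => i j; rewrite !mxE.
have -> : forall (u v : 'I_k -> 'I_n), mxsub u v (A *m B) = mxsub u id A *m mxsub id v B.
  by move=> u v; apply/matrixP => a b; rewrite !mxE; apply: eq_bigr => l _; rewrite !mxE.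
rewrite Cauchy_Binet; apply: eq_bigr => l _; rewrite !mxE.
by congr (_ * _); congr (\det _); apply/matrixP => a b; rewrite !mxE.
Qed.

Lemma mul_compound1 : mul_compound k (1%:M : 'M[R]_n) = 1%:M.
Proof.
apply/matrixP => i j; rewrite !mxE; case: eqP => [->|ij].
  transitivity (\det (1%:M : 'M[R]_k)); last by rewrite det1.
  congr (\det _); apply/matrixP => a b; rewrite !mxE.
  by rewrite (inj_eq (@lex_subset_tnth_inj _ _ j)).
(* Distinct subsets of equal size: some element of the first is missing from the second, and the
   corresponding row of the minor vanishes. *)
have [x xi xj] : exists2 x, x \in tnth (lex_subsets n k) i & x \notin tnth (lex_subsets n k) j.
  apply: contrapT => h; apply: ij; apply: lex_subset_eq.
  set s := tnth _ i; set t := tnth _ j.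
  have sub : {subset s <= t}.
    by move=> x xs; apply: contrapT => /negP xt; apply: h; exists x.
  have us : uniq s by apply: subseq_uniq (lex_subsetP i) (enum_uniq _).
  have st : (size t <= size s)%N by rewrite !size_tuple.
  by have [] := uniq_min_size us sub st.
have /tnthP[a ea] := xi.
rewrite (expand_det_row _ a) big1 // => b _; rewrite !mxE -ea.
by case: eqP xj => [->|]; rewrite ?mem_tnth // mul0r.
Qed.

(** Pivoting selects rows and columns in arbitrary order; reordering changes only the sign of a
    minor, and a repetition makes it 0. *)
Lemma abs_minor_le (A : 'M[R]_n) (I J : 'I_k -> 'I_n) c : 0 <= c ->
  (forall i j, `|mul_compound k A i j| <= c) -> `|\det (mxsub I J A)| <= c.
Proof.
move=> c0 h.
have [/injectiveP Ii|/injectivePn[a [b ab e]]] := boolP (injectiveb I); last first.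
  by rewrite (determinant_alternate ab) ?normr0 // => x; rewrite !mxE e.
have [/injectiveP Ji|/injectivePn[a [b ab e]]] := boolP (injectiveb J); last first.
  by rewrite -det_tr (determinant_alternate ab) ?normr0 // => x; rewrite !mxE e.
have [i [s es]] := injective_lexP Ii; have [j [t et]] := injective_lexP Ji.
have := h i j; rewrite mxE.
set M := mxsub _ _ _ => hM.
have -> : mxsub I J A = row_perm s (col_perm t M).
  by apply/matrixP => a b; rewrite !mxE es et.
rewrite row_permE col_permE !det_mulmx !det_perm !normrM !normrX normrN1 !expr1n.
by rewrite mul1r mulr1.
Qed.

End MulCompound.

(** * First-order expansion of compounds *)

Section Linearization.
Variable R : realType.

(* For a list of pairs (x, dx), the first-order part of the product of the x + dx. *)
Fixpoint prod_lin (s : seq (R * R)) : R :=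
  if s is x :: s' then x.1 * prod_lin s' + x.2 * \prod_(y <- s') y.1 else 0.

(** One more factor turns the remainder into a sum of three terms, each at most 4^m e^2; hence the
    base 4. *)
Lemma prod_lin_approx (s : seq (R * R)) (e : R) : 0 <= e <= 1 ->
    (forall x, x \in s -> `|x.1| <= 1 /\ `|x.2| <= e) ->
  [/\ `|\prod_(x <- s) x.1| <= 1, `|prod_lin s| <= (size s)%:R * e &
    `|\prod_(x <- s) (x.1 + x.2) - \prod_(x <- s) x.1 - prod_lin s| <=
      4 ^+ size s * e ^+ 2].
Proof.
move=> /andP[e0 e1]; elim: s => [|x s IHs] h.
  rewrite !big_nil /= normr1 normr0 mul0r subrr subr0 normr0; split => //.
  by rewrite mulr_ge0 ?sqr_ge0.
have [] := IHs _; first by move=> y ys; apply: h; rewrite inE ys orbT.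
have [x1 x2] := h x (mem_head _ _).
rewrite !big_cons /=.
set a := \prod_(x <- s) x.1; set b := \prod_(x <- s) (_ + _); set d := prod_lin s.
move=> a1 d1 r1.
have d2 : `|d| <= 4 ^+ size s * e.
  apply: le_trans d1 _; rewrite ler_wpM2r // -natrX ler_nat.
  by rewrite ltnW // ltn_expl.
split.
- by rewrite normrM; apply: le_trans (ler_pM _ _ x1 a1) _; rewrite // mulr1.
- rewrite -[(size s).+1]addn1 natrD mulrDl mul1r; apply: le_trans (ler_normD _ _) _.
  rewrite !normrM; apply: lerD.
    by apply: le_trans (ler_pM _ _ x1 d1) _; rewrite // mul1r.
  by apply: le_trans (ler_pM _ _ x2 a1) _; rewrite // mulr1.
have -> : (x.1 + x.2) * b - x.1 * a - (x.1 * d + x.2 * a) =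
  x.1 * (b - a - d) + (x.2 * d + x.2 * (b - a - d)) by ring.
apply: le_trans (ler_normD _ _) _.
apply: le_trans (lerD (lexx _) (ler_normD _ _)) _.
rewrite !normrM.
have H1 : `|x.1| * `|b - a - d| <= 4 ^+ size s * e ^+ 2.
  by apply: le_trans (ler_pM _ _ x1 r1) _; rewrite // mul1r.
have H2 : `|x.2| * `|d| <= 4 ^+ size s * e ^+ 2.
  by apply: le_trans (ler_pM _ _ x2 d2) _; rewrite // mulrCA expr2.
have H3 : `|x.2| * `|b - a - d| <= 4 ^+ size s * e ^+ 2.
  apply: le_trans (ler_pM _ _ x2 r1) _ => //.
  by rewrite -[leRHS]mul1r ler_wpM2r // mulr_ge0 ?sqr_ge0.
apply: le_trans (lerD H1 (lerD H2 H3)) _.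
rewrite [4 ^+ _.+1]exprS; have : 0 <= 4 ^+ size s * e ^+ 2 :> R by rewrite mulr_ge0 ?sqr_ge0.
by lra.
Qed.

Lemma prod_linP (I : Type) (s : seq I) (u v w : I -> R) a :
  prod_lin [seq (u i, a * v i + w i) | i <- s] =
  a * prod_lin [seq (u i, v i) | i <- s] + prod_lin [seq (u i, w i) | i <- s].
Proof.
elim: s => [|i s IHs] /=; first by rewrite mulr0 addr0.
rewrite IHs !big_map /=; ring.
Qed.

(** The differential of [det] at P in direction E, expanded by Leibniz so that linearity and the
    remainder reduce to single products. *)
Definition det_lin k (P E : 'M[R]_k) : R :=
  \sum_(s : 'S_k) (-1) ^+ s * prod_lin [seq (P i (s i), E i (s i)) | i <- enum 'I_k].

Lemma det_lin_approx k (P E : 'M[R]_k) (e : R) : 0 <= e <= 1 ->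
    (forall i j, `|P i j| <= 1) -> (forall i j, `|E i j| <= e) ->
  `|\det (P + E) - \det P - det_lin P E| <= k`!%:R * (4 ^+ k * e ^+ 2).
Proof.
move=> e01 hP hE; rewrite /determinant /det_lin -!sumrB.
apply: le_trans (ler_norm_sum _ _ _) _.
rewrite -card_Sn mulr_natl -sumr_const; apply: ler_sum => s _.
rewrite -!mulrBr normrM normrX normrN1 expr1n mul1r.
pose t := [seq (P i (s i), E i (s i)) | i <- enum 'I_k].
have [|_ _] := @prod_lin_approx t e e01.
  by move=> x /mapP[i _ ->] /=; split.
have prodE (F : 'I_k -> R) : \prod_i F i = \prod_(i <- enum 'I_k) F i by rewrite big_enum.
rewrite /t size_map size_enum_ord !big_map /= !prodE.
by under [in X in _ -> X]eq_bigr do rewrite mxE.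
Qed.

Lemma det_linP k (P E F : 'M[R]_k) a :
  det_lin P (a *: E + F) = a * det_lin P E + det_lin P F.
Proof.
rewrite /det_lin mulr_sumr -big_split /=; apply: eq_bigr => s _.
rewrite mulrCA -mulrDr -prod_linP; congr (_ * prod_lin _).
by apply: eq_map => i; rewrite !mxE.
Qed.

Section Compound.
Variables n k : nat.

(** The differential of the compound at the identity: an explicit linear expression for
    [add_compound]. *)
Definition lin_compound (A : 'M[R]_n) : 'M[R]_'C(n, k) :=
  \matrix_(i, j) det_lin
    (mxsub (tnth (tnth (lex_subsets n k) i)) (tnth (tnth (lex_subsets n k) j)) 1%:M)
    (mxsub (tnth (tnth (lex_subsets n k) i)) (tnth (tnth (lex_subsets n k) j)) A).

Lemma lin_compoundP a (A B : 'M[R]_n) :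
  lin_compound (a *: A + B) = a *: lin_compound A + lin_compound B.
Proof.
apply/matrixP => i j; rewrite !mxE -det_linP; congr det_lin.
by apply/matrixP => x y; rewrite !mxE.
Qed.

Lemma mul_compound_lin (E : 'M[R]_n) (e : R) : 0 <= e <= 1 ->
    (forall i j, `|E i j| <= e) -> forall i j,
  `|(mul_compound k (1%:M + E) - 1%:M - lin_compound E) i j| <=
    k`!%:R * 4 ^+ k * e ^+ 2.
Proof.
move=> e01 hE i j; rewrite -(mul_compound1 R n k) !mxE -mulrA.
set f := tnth (tnth _ i); set g := tnth (tnth _ j).
have -> : mxsub f g (1%:M + E) = mxsub f g 1%:M + mxsub f g E.
  by apply/matrixP => x y; rewrite !mxE.
apply: det_lin_approx => // x y; rewrite !mxE //.
by case: eqP; rewrite ?normr1 ?normr0.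
Qed.

Lemma lin_compoundZ a (A : 'M[R]_n) : lin_compound (a *: A) = a *: lin_compound A.
Proof.
have l0 : lin_compound 0 = 0.
  have := lin_compoundP 1 0 0; rewrite !scale1r addr0 => /eqP.
  by rewrite -subr_eq0 opprD addrA subrr add0r oppr_eq0 => /eqP.
by have := lin_compoundP a A 0; rewrite !addr0 l0 addr0.
Qed.

Lemma add_compound_lin (A : 'M[R]_n) : add_compound k A = lin_compound A.
Proof.
have A1 : 0 < `|A| + 1 by rewrite ltr_wpDl.
apply: (@derive1_quadratic _ _ _ _ 1%:M _
    (k`!%:R * 4 ^+ k * (`|A| + 1) ^+ 2) (`|A| + 1)^-1).
- by rewrite invr_gt0.
- by rewrite mulr_ge0 ?sqr_ge0 // mulr_ge0.
move=> e; rewrite -[leRHS]mul1r ler_pdivlMr // => e1 i j.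
rewrite -lin_compoundZ -[leRHS]mulrA -exprMn.
have -> : (((`|A| + 1) * e) ^+ 2) = (`|e| * (`|A| + 1)) ^+ 2.
  by rewrite !exprMn real_normK ?num_real // mulrC.
apply: mul_compound_lin => [|x y]; first by rewrite e1 mulr_ge0 // ltW.
rewrite mxE normrM ler_wpM2l //; apply: le_trans (mxnorm_entry A x y) _.
by rewrite lerDl.
Qed.

(** One constant for all matrices with entries bounded by L, so that the Jacobians at all points of
    a compact set are treated at once. *)
Lemma mul_compound_add (L : R) : 0 <= L -> exists2 C : R, 0 <= C &
  forall (A : 'M[R]_n) (h : R), (forall i j, `|A i j| <= L) -> 0 <= h <= 1 -> h * L <= 1 ->
  forall i j, `|(mul_compound k (1%:M + h *: A) - 1%:M - h *: add_compound k A) i j| <= C * h ^+ 2.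
Proof.
move=> L0; exists (k`!%:R * 4 ^+ k * L ^+ 2); first by rewrite mulr_ge0 ?sqr_ge0 // mulr_ge0.
move=> A h hA /andP[h0 _] hL i j.
rewrite add_compound_lin -lin_compoundZ -[leRHS]mulrA -exprMn.
apply: mul_compound_lin => [|x y].
  by rewrite [L * h]mulrC hL andbT mulr_ge0.
by rewrite mxE normrM ger0_norm // mulrC ler_wpM2r.
Qed.

(** By linearity, with the images of the elementary matrices as constant; this transfers growth
    estimates between nearby points. *)
Lemma add_compound_lip : exists2 C : R, 0 <= C &
  forall A B : 'M[R]_n, forall c : R, (forall i j, `|(A - B) i j| <= c) ->
   forall i j, `|(add_compound k A - add_compound k B) i j| <= C * c.
Proof.
pose d (x : 'I_n * 'I_n) : 'M[R]_n := delta_mx x.1 x.2.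
exists (\sum_x `|lin_compound (d x)|); first exact: sumr_ge0.
move=> A B c hc i j.
have -> : add_compound k A - add_compound k B = lin_compound (A - B).
  have -> : A - B = -1 *: B + A by rewrite scaleN1r addrC.
  by rewrite !add_compound_lin lin_compoundP scaleN1r addrC.
have e (s : seq ('I_n * 'I_n)) (M : 'M[R]_n) :
    lin_compound (\sum_(x <- s) M x.1 x.2 *: d x) = \sum_(x <- s) M x.1 x.2 *: lin_compound (d x).
  elim: s => [|x s IHs]; last by rewrite !big_cons lin_compoundP IHs.
  by rewrite !big_nil; have := lin_compoundZ 0 0; rewrite !scale0r.
rewrite [X in lin_compound X]matrix_sum_delta pair_bigA /= e summxE mulr_suml.
apply: le_trans (ler_norm_sum _ _ _) _; apply: ler_sum => x _.
rewrite mxE normrM mulrC; apply: ler_pM => //; exact: mxnorm_entry.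
Qed.

End Compound.
End Linearization.

(** * Operator norms and matrix measures *)

Section LpNorm.
Variables (R : realType) (p : \bar R).
Hypothesis p1 : (1 <= p)%E.

Lemma powR_convex (q a x y : R) : 1 <= q -> 0 <= a <= 1 -> 0 <= x -> 0 <= y ->
  (a * x + (1 - a) * y) `^ q <= a * x `^ q + (1 - a) * y `^ q.
Proof.
move=> q1 /andP[a0 a1] x0 y0.
have := @convex_powR _ q q1 (Itv01 a0 a1) x y.
by rewrite !convRE /= /unstable.onem; apply; rewrite inE /= in_itv /= ?x0 ?y0.
Qed.

Lemma lp_norm_ge0 m (v : 'I_m -> R) : 0 <= lp_norm p v.
Proof.
case: p p1 => [q||] //= _; first exact: powR_ge0.
by apply: (big_ind (fun x => 0 <= x)) => // x y x0 y0; rewrite le_max x0.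
Qed.

Lemma powRVK (q x : R) : 1 <= q -> 0 <= x -> (x `^ q) `^ q^-1 = x.
Proof.
move=> q1 x0; rewrite -powRrM mulfV ?powRr1 //.
by rewrite gt_eqF // (lt_le_trans _ q1).
Qed.

Lemma powRKV (q x : R) : 1 <= q -> 0 <= x -> (x `^ q^-1) `^ q = x.
Proof. by move=> q1 x0; rewrite powRAC powRVK. Qed.

Lemma lp_normZ m (v : 'I_m -> R) a : lp_norm p (fun i => a * v i) = `|a| * lp_norm p v.
Proof.
case: p p1 => [q||] //= q1; last first.
  rewrite (eq_bigr (fun i => `|a| * `|v i|)); last by move=> i _; rewrite normrM.
  elim/big_ind2 : _ => [|x1 x2 y1 y2 -> ->|//]; first by rewrite mulr0.
  by rewrite -maxr_pMr.
rewrite lee_fin in q1.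
rewrite (eq_bigr (fun i => `|a| `^ q * `|v i| `^ q)); last first.
  by move=> i _; rewrite normrM powRM.
rewrite -mulr_sumr powRM ?powR_ge0 ?powRVK //.
by apply: sumr_ge0 => i _; exact: powR_ge0.
Qed.

Lemma lp_norm_coord m (v : 'I_m -> R) i : `|v i| <= lp_norm p v.
Proof.
case: p p1 => [q||] //= q1; last by rewrite (le_bigmax _ (fun i => `|v i|)).
rewrite lee_fin in q1.
rewrite -{1}(@powRVK q `|v i|) //.
apply: ge0_ler_powR; rewrite ?nnegrE ?powR_ge0 ?invr_ge0 ?(le_trans _ q1) //.
  by apply: sumr_ge0 => j _; exact: powR_ge0.
by rewrite (bigD1 i) //= lerDl; apply: sumr_ge0 => j _; exact: powR_ge0.
Qed.

Lemma lp_norm_delta m (j : 'I_m) : lp_norm p (fun i => (i == j)%:R : R) = 1.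
Proof.
case: p p1 => [q||] //= q1; last first.
  apply/eqP; rewrite eq_le; apply/andP; split.
    by apply/bigmax_leP; split=> // i _; case: eqP; rewrite ?normr1 ?normr0.
  by apply: le_trans (le_bigmax _ (fun i => `|(i == j)%:R : R|) j); rewrite eqxx normr1.
rewrite lee_fin in q1.
have q0 : q != 0 by rewrite gt_eqF // (lt_le_trans _ q1).
rewrite (bigD1 j) //= big1 ?addr0 ?eqxx ?normr1 ?powR1 // => i /negPf ->.
by rewrite normr0 powR0.
Qed.

(** Convexity of t^q at the points |u|/a and |v|/b, with weights a/(a+b) and b/(a+b). *)
Lemma Minkowski_sum m (q a b : R) (u v : 'I_m -> R) : 1 <= q -> 0 < a -> 0 < b ->
  \sum_i `|u i| `^ q = a `^ q -> \sum_i `|v i| `^ q = b `^ q ->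
  \sum_i `|u i + v i| `^ q <= (a + b) `^ q.
Proof.
move=> q1 a0 b0 su sv.
have q0 : 0 <= q by rewrite (le_trans _ q1).
have ab0 : 0 < a + b by rewrite addr_gt0.
pose t := a / (a + b).
have t1 : 1 - t = b / (a + b) by rewrite /t; field; rewrite gt_eqF.
have t0 : 0 <= t by rewrite divr_ge0 // ltW.
have t'0 : 0 <= 1 - t by rewrite t1 divr_ge0 // ltW.
have key i : `|u i + v i| `^ q <=
    (a + b) `^ q * (t * (`|u i| `^ q / a `^ q) + (1 - t) * (`|v i| `^ q / b `^ q)).
  have c0 : 0 <= t * (`|u i| / a) + (1 - t) * (`|v i| / b).
    by apply: addr_ge0; apply: mulr_ge0 => //; apply: divr_ge0 => //; exact: ltW.
  apply: (@le_trans _ _ (((a + b) * (t * (`|u i| / a) + (1 - t) * (`|v i| / b))) `^ q)).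
    apply: ge0_ler_powR; rewrite ?nnegrE ?mulr_ge0 ?(ltW ab0) //.
    apply: le_trans (ler_normD _ _) _.
    rewrite le_eqVlt; apply/orP; left; apply/eqP; rewrite t1 /t; field.
    by rewrite !gt_eqF.
  rewrite powRM ?(ltW ab0) // ler_wpM2l ?powR_ge0 //.
  have dp (x c : R) : 0 < c -> `|x| `^ q / c `^ q = (`|x| / c) `^ q.
    move=> c'0; rewrite powRM ?invr_ge0 ?(ltW c'0) //; congr (_ * _).
    by rewrite -[in RHS]powR_inv1 ?(ltW c'0) // -powRrM mulN1r powRN.
  rewrite !dp //; apply: powR_convex => //.
  - by rewrite t0 /= -subr_ge0.
  - by rewrite divr_ge0 // ltW.
  - by rewrite divr_ge0 // ltW.
apply: le_trans (ler_sum _ (fun i _ => key i)) _.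
rewrite -mulr_sumr big_split /= -!mulr_sumr -!mulr_suml su sv.
by rewrite !mulfV ?gt_eqF ?powR_gt0 // !mulr1 subrKC mulr1.
Qed.

Lemma ler_lp_normD m (u v : 'I_m -> R) :
  lp_norm p (fun i => u i + v i) <= lp_norm p u + lp_norm p v.
Proof.
have [u0|uN0] := eqVneq (lp_norm p u) 0.
  rewrite u0 add0r (_ : (fun i => u i + v i) = v) //.
  apply/funext => i; have := lp_norm_coord u i.
  by rewrite u0 normr_le0 => /eqP ->; rewrite add0r.
have [v0|vN0] := eqVneq (lp_norm p v) 0.
  rewrite v0 addr0 (_ : (fun i => u i + v i) = u) //.
  apply/funext => i; have := lp_norm_coord v i.
  by rewrite v0 normr_le0 => /eqP ->; rewrite addr0.
have up : 0 < lp_norm p u by rewrite lt0r uN0 lp_norm_ge0.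
have vp : 0 < lp_norm p v by rewrite lt0r vN0 lp_norm_ge0.
have cu := lp_norm_coord u; have cv := lp_norm_coord v.
case: p p1 up vp cu cv {uN0 vN0} => [q||] //= q1; last first.
  move=> up vp cu cv; apply/bigmax_leP; split; first by rewrite addr_ge0 // ltW.
  by move=> i _; apply: le_trans (ler_normD _ _) (lerD _ _).
rewrite lee_fin in q1.
have s0 (w : 'I_m -> R) : 0 <= \sum_i `|w i| `^ q.
  by apply: sumr_ge0 => j _; exact: powR_ge0.
have su : \sum_i `|u i| `^ q = ((\sum_i `|u i| `^ q) `^ q^-1) `^ q by rewrite powRKV.
have sv : \sum_i `|v i| `^ q = ((\sum_i `|v i| `^ q) `^ q^-1) `^ q by rewrite powRKV.
move: (_ `^ q^-1) (_ `^ q^-1) su sv => a b su sv a0 b0 _ _.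
have := Minkowski_sum q1 a0 b0 su sv.
set c := _ + _ => h.
have c0 : 0 <= c by rewrite addr_ge0 // ltW.
rewrite -[leRHS](powRVK q1 c0).
apply: ge0_ler_powR; rewrite ?nnegrE ?powR_ge0 ?invr_ge0 //.
by rewrite (le_trans _ q1).
Qed.

Lemma lp_norm_sum m (I : Type) (s : seq I) (v : I -> 'I_m -> R) :
  lp_norm p (fun i => \sum_(k <- s) v k i) <= \sum_(k <- s) lp_norm p (v k).
Proof.
elim: s => [|k s IHs].
  rewrite big_nil (_ : (fun _ => _) = (fun i => 0 * 0)); last first.
    by apply/funext => i; rewrite big_nil mulr0.
  by rewrite (lp_normZ (fun=> 0) 0) normr0 mul0r.
rewrite big_cons (_ : (fun _ => _) = (fun i => v k i + \sum_(j <- s) v j i)); last first.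
  by apply/funext => i; rewrite big_cons.
by apply: le_trans (ler_lp_normD _ _) _; rewrite lerD2l.
Qed.

(** Multiplicativity on product vectors is the property of L_p norms behind the treatment of
    fractional orders: it lets the norm of a Kronecker product dominate the product of the norms. *)
Lemma lp_norm_tens m n (v : 'I_m -> R) (w : 'I_n -> R) :
  lp_norm p (fun i => v (mxtens_unindex i).1 * w (mxtens_unindex i).2) =
  lp_norm p v * lp_norm p w.
Proof.
have cv := lp_norm_coord v; have cw := lp_norm_coord w.
have v0 := lp_norm_ge0 v; have w0 := lp_norm_ge0 w.
case: p p1 cv cw v0 w0 => [q||] //= q1 cv cw v0 w0.
  rewrite -powRM ?mulr_sum; last 2 first.
  - by apply: sumr_ge0 => j _; exact: powR_ge0.
  - by apply: sumr_ge0 => j _; exact: powR_ge0.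
  by congr (_ `^ _); apply: eq_bigr => i _; rewrite normrM powRM.
apply/eqP; rewrite eq_le; apply/andP; split.
  apply/bigmax_leP; split; first by rewrite mulr_ge0.
  by move=> i _; rewrite normrM ler_pM.
set c := leRHS.
have h i j : `|v i| * `|w j| <= c.
  have := le_bigmax 0 (fun i => `|v (mxtens_unindex i).1 * w (mxtens_unindex i).2|)
    (mxtens_index (i, j)).
  by rewrite mxtens_indexK normrM.
have c0 : 0 <= c by apply: (big_ind (fun x => 0 <= x)) => // x y x0 y0; rewrite le_max x0.
have v1 (i : 'I_m) : `|v i| * \big[Num.max/0]_j `|w j| <= c.
  have [->|vi0] := eqVneq (v i) 0; first by rewrite normr0 mul0r.
  have vi0' : 0 < `|v i| by rewrite normr_gt0.
  rewrite mulrC -ler_pdivlMr //; apply/bigmax_leP; split; first by rewrite divr_ge0.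
  by move=> j _; rewrite ler_pdivlMr // mulrC.
have [->|wN0] := eqVneq (\big[Num.max/0]_j `|w j|) 0; first by rewrite mulr0.
have {wN0} w0 : 0 < \big[Num.max/0]_j `|w j| by rewrite lt0r wN0.
rewrite -ler_pdivlMr //; apply/bigmax_leP; split; first by rewrite divr_ge0 // ltW.
by move=> i _; rewrite ler_pdivlMr.
Qed.

End LpNorm.

Section OpNorm.
Variables (R : realType) (p : \bar R).
Hypothesis p1 : (1 <= p)%E.
Local Notation N v := (lp_norm p (v ^~ 0)).
Local Notation opn := (lp_opnorm p).

Lemma lp_normZmx m a (v : 'cV[R]_m) : N (a *: v) = `|a| * N v.
Proof. by rewrite -lp_normZ //; congr lp_norm; apply/funext => i; rewrite mxE. Qed.

Lemma ler_lp_normDmx m (u v : 'cV[R]_m) : N (u + v) <= N u + N v.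
Proof.
apply: le_trans (ler_lp_normD p1 _ _).
by rewrite (_ : (u + v)^~ 0 = fun i => u i 0 + v i 0) //; apply/funext => i; rewrite mxE.
Qed.

(** A crude bound whose purpose is to make the supremum in [lp_opnorm] finite. *)
Lemma lp_norm_mulmx m (A : 'M[R]_m) (v : 'cV[R]_m) :
  N (A *m v) <= (\sum_j N (col j A)) * N v.
Proof.
rewrite (_ : (A *m v)^~ 0 = fun i => \sum_j v j 0 * A i j); last first.
  by apply/funext => i; rewrite mxE; apply: eq_bigr => j _; rewrite mulrC.
apply: le_trans (lp_norm_sum p1 _ (fun j i => v j 0 * A i j)) _.
rewrite mulr_suml; apply: ler_sum => j _; rewrite lp_normZ //.
rewrite mulrC (_ : (col j A)^~ 0 = A^~ j); last by apply/funext => i; rewrite mxE.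
by rewrite ler_wpM2l ?lp_norm_ge0 //; exact: (lp_norm_coord p1 (v^~ 0)).
Qed.

Lemma opnorm_has_ubound m (A : 'M[R]_m) : has_ubound
  [set N (A *m v) | v in [set v : 'cV[R]_m | N v = 1]].
Proof.
exists (\sum_j N (col j A)) => _ [v /= v1 <-].
by apply: le_trans (lp_norm_mulmx A v) _; rewrite v1 mulr1.
Qed.

Lemma opnormP m (A : 'M[R]_m) (v : 'cV[R]_m) : N (A *m v) <= opn A * N v.
Proof.
have [v0|v0] := eqVneq (N v) 0.
  by apply: le_trans (lp_norm_mulmx A v) _; rewrite v0 !mulr0.
have vp : 0 < N v by rewrite lt0r v0 lp_norm_ge0.
rewrite -ler_pdivrMr // mulrC.
have -> : (N v)^-1 * N (A *m v) = N (A *m ((N v)^-1 *: v)).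
  by rewrite -scalemxAr lp_normZmx ger0_norm // invr_ge0 ltW.
apply: ub_le_sup; first exact: opnorm_has_ubound.
by exists ((N v)^-1 *: v) => //=; rewrite lp_normZmx ger0_norm ?mulVf // invr_ge0 ltW.
Qed.

Lemma opnorm_le m (A : 'M[R]_m) c : 0 <= c ->
  (forall v : 'cV[R]_m, N v = 1 -> N (A *m v) <= c) -> opn A <= c.
Proof.
move=> c0 h; rewrite /lp_opnorm; set E := (X in sup X).
(* In dimension 0 there is no unit vector and the supremum of the empty set is 0; this case calls
   for [0 <= c]. *)
have [->|/set0P E0] := eqVneq E set0; first by rewrite sup0.
by apply: ge_sup => // _ [v v1 <-]; exact: h.
Qed.

Lemma opnorm_ge0 m (A : 'M[R]_m) : 0 <= opn A.
Proof.
rewrite /lp_opnorm; set E := (X in sup X).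
have [->|/set0P [x Ex]] := eqVneq E set0; first by rewrite sup0.
apply: le_trans (ub_le_sup (opnorm_has_ubound A) Ex).
by case: Ex => v _ <-; exact: lp_norm_ge0.
Qed.

Lemma lp_norm_delta_mx m (j : 'I_m) : N (delta_mx j 0 : 'cV[R]_m) = 1.
Proof.
rewrite -(lp_norm_delta p1 j); congr lp_norm.
by apply/funext => i; rewrite mxE eqxx andbT.
Qed.

Lemma opnormD m (A B : 'M[R]_m) : opn (A + B) <= opn A + opn B.
Proof.
apply: opnorm_le => [|v v1]; first by rewrite addr_ge0 ?opnorm_ge0.
rewrite mulmxDl; apply: le_trans (ler_lp_normDmx _ _) _.
by apply: lerD; rewrite -[leRHS]mulr1 -v1; exact: opnormP.
Qed.

Lemma opnormM m (A B : 'M[R]_m) : opn (A *m B) <= opn A * opn B.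
Proof.
apply: opnorm_le => [|v v1]; first by rewrite mulr_ge0 ?opnorm_ge0.
rewrite -mulmxA; apply: le_trans (opnormP _ _) _.
by rewrite ler_wpM2l ?opnorm_ge0 // -[leRHS]mulr1 -v1 opnormP.
Qed.

Lemma opnormZ m a (A : 'M[R]_m) : opn (a *: A) <= `|a| * opn A.
Proof.
apply: opnorm_le => [|v v1]; first by rewrite mulr_ge0 ?opnorm_ge0.
rewrite -scalemxAl lp_normZmx ler_wpM2l // -[leRHS]mulr1 -v1; exact: opnormP.
Qed.

Lemma opnorm1_le m : opn (1%:M : 'M[R]_m) <= 1.
Proof. by apply: opnorm_le => // v v1; rewrite mul1mx v1. Qed.

Lemma opnorm_entry m (A : 'M[R]_m) i j : `|A i j| <= opn A.
Proof.
rewrite -[leRHS]mulr1 -(lp_norm_delta_mx j).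
apply: le_trans (opnormP _ _).
have := lp_norm_coord p1 ((A *m (delta_mx j 0 : 'cV[R]_m))^~ 0) i.
by rewrite -colE mxE.
Qed.

Lemma opnorm1_ge m : (0 < m)%N -> 1 <= opn (1%:M : 'M[R]_m).
Proof.
case: m => // m _; apply: le_trans (opnorm_entry _ 0 0).
by rewrite mxE eqxx normr1.
Qed.

Lemma opnorm_le_entries m (A : 'M[R]_m) c : 0 <= c ->
  (forall i j, `|A i j| <= c) -> opn A <= m%:R * m%:R * c.
Proof.
move=> c0 h; apply: opnorm_le => [|v v1]; first by rewrite !mulr_ge0.
apply: le_trans (lp_norm_mulmx A v) _; rewrite v1 mulr1 -mulrA.
rewrite mulr_natl -[X in _ *+ X](card_ord m) -sumr_const; apply: ler_sum => j _.
rewrite (_ : (col j A)^~ 0 = fun i => \sum_k A k j * (i == k)%:R); last first.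
  apply/funext => i; rewrite (bigD1 i) //= big1 ?addr0 ?eqxx ?mulr1 ?mxE // => k.
  by rewrite eq_sym => /negPf ->; rewrite mulr0.
apply: le_trans (lp_norm_sum p1 _ (fun k i => A k j * (i == k)%:R)) _.
rewrite mulr_natl -[X in _ *+ X](card_ord m) -sumr_const; apply: ler_sum => k _.
by rewrite lp_normZ // lp_norm_delta // mulr1.
Qed.

(** Test [A *t B] on products of unit vectors, then take the supremum in one factor at a time; the
    vanishing cases are set apart because each passage divides by the other factor. *)
Lemma opnorm_tens m n (A : 'M[R]_m) (B : 'M[R]_n) : opn A * opn B <= opn (A *t B).
Proof.
have h (v : 'cV[R]_m) (w : 'cV[R]_n) : N v = 1 -> N w = 1 ->
    N (A *m v) * N (B *m w) <= opn (A *t B).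
  move=> v1 w1; rewrite -lp_norm_tens //.
  have tE k l (v' : 'cV[R]_k) (w' : 'cV[R]_l) :
      (fun i => v' (mxtens_unindex i).1 0 * w' (mxtens_unindex i).2 0) =
      ((v' *t w' : 'cV[R]_(k * l)) ^~ 0).
    by apply/funext => i; rewrite [in RHS]mxE; congr (v' _ _ * w' _ _); rewrite [RHS]ord1.
  rewrite (tE _ _ (A *m v) (B *m w)) -tensmx_mul -[leRHS]mulr1.
  apply: le_trans (opnormP _ _) _; rewrite -(tE _ _ v w).
  by rewrite (lp_norm_tens p1 (v^~ 0) (w^~ 0)) v1 w1 mulr1.
have h1 (w : 'cV[R]_n) : N w = 1 -> opn A * N (B *m w) <= opn (A *t B).
  move=> w1; have [->|w0] := eqVneq (N (B *m w)) 0; first by rewrite mulr0 opnorm_ge0.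
  have {}w0 : 0 < N (B *m w) by rewrite lt0r w0 lp_norm_ge0.
  rewrite -ler_pdivlMr //; apply: opnorm_le => [|v v1]; first by rewrite divr_ge0 ?opnorm_ge0 ?ltW.
  by rewrite ler_pdivlMr // h.
have [->|A0] := eqVneq (opn A) 0; first by rewrite mul0r opnorm_ge0.
have {}A0 : 0 < opn A by rewrite lt0r A0 opnorm_ge0.
rewrite mulrC -ler_pdivlMr //; apply: opnorm_le => [|v v1]; first by rewrite divr_ge0 ?opnorm_ge0 ?ltW.
by rewrite ler_pdivlMr // mulrC h1.
Qed.

End OpNorm.

Section LogNorm.
Variables (R : realType) (p : \bar R).
Hypothesis p1 : (1 <= p)%E.
Local Notation opn := (lp_opnorm p).

(** The difference quotient is kept at finite h, before the limit, so that estimates apply to actual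
    Euler factors 1 + h A. *)
Definition growth_rate m (A : 'M[R]_m) (h : R) : R := (opn (1%:M + h *: A) - 1) / h.

(* Convexity of [opn (1 + h A)] in h: the limit defining the measure is an infimum. *)
Lemma growth_rate_homo m (A : 'M[R]_m) (h h' : R) : 0 < h -> h <= h' ->
  growth_rate A h <= growth_rate A h'.
Proof.
move=> h0 hh'; have h'0 : 0 < h' := lt_le_trans h0 hh'.
rewrite /growth_rate ler_pdivrMr // mulrAC ler_pdivlMr //.
have -> : 1%:M + h *: A = (1 - h / h') *: 1%:M + (h / h') *: (1%:M + h' *: A).
  rewrite scalerDr addrA -scalerDl subrK scale1r scalerA.
  by rewrite -mulrA mulVf ?mulr1 // gt_eqF.
have a0 : 0 <= 1 - h / h' by rewrite subr_ge0 ler_pdivrMr // mul1r.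
have b0 : 0 <= h / h' by rewrite divr_ge0 ?ltW.
have := le_trans (opnormD p1 _ _) (lerD (opnormZ p1 (1 - h / h') (1%:M : 'M[R]_m))
   (opnormZ p1 (h / h') (1%:M + h' *: A))).
rewrite !ger0_norm // => H.
have {}H := le_trans H (lerD (ler_wpM2l a0 (opnorm1_le p m)) (lexx _)).
rewrite -ler_pdivlMr // -subr_ge0.
rewrite -subr_ge0 in H; congr (0 <= _): H; field; rewrite gt_eqF //.
Qed.

(** [0 < m] matters: in dimension 0 the identity has norm 0 and the quotient is -1/h, unbounded as h
    tends to 0. *)
Lemma growth_rate_ge m (A : 'M[R]_m) (h : R) : (0 < m)%N -> 0 < h -> - opn A <= growth_rate A h.
Proof.
move=> m0 h0; rewrite /growth_rate ler_pdivlMr // lerBrDr addrC mulNr lerBlDr.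
have := opnorm1_ge p1 m0.
have {1}-> : 1%:M = (1%:M + h *: A) + (- h) *: A by rewrite scaleNr addrK.
move=> H; apply: le_trans H _; apply: le_trans (opnormD p1 _ _) _.
rewrite lerD2l; apply: le_trans (opnormZ p1 _ _) _.
by rewrite normrN gtr0_norm // mulrC.
Qed.

Lemma growth_rate_le m (A : 'M[R]_m) (h : R) : 0 < h -> growth_rate A h <= opn A.
Proof.
move=> h0; rewrite /growth_rate ler_pdivrMr // lerBlDr.
apply: le_trans (opnormD p1 _ _) _; rewrite addrC; apply: lerD; last exact: opnorm1_le.
by apply: le_trans (opnormZ p1 _ _) _; rewrite gtr0_norm // mulrC.
Qed.

Lemma growth_rate_lip m (A B : 'M[R]_m) (h : R) : 0 < h ->
  growth_rate A h <= growth_rate B h + opn (A - B).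
Proof.
move=> h0; rewrite /growth_rate ler_pdivrMr // mulrDl divfK ?gt_eqF //.
rewrite lerBlDr addrAC subrK.
have -> : 1%:M + h *: A = 1%:M + h *: B + h *: (A - B).
  by rewrite scalerBr -addrA subrKC.
apply: le_trans (opnormD p1 _ _) _; rewrite lerD2l.
by apply: le_trans (opnormZ p1 _ _) _; rewrite gtr0_norm // mulrC.
Qed.

Lemma lp_measure_growth m (A : 'M[R]_m) (c e : R) : (0 < m)%N -> 0 < e -> lp_measure p A <= c ->
  exists2 h0 : R, 0 < h0 & forall h : R, 0 < h -> h <= h0 -> growth_rate A h <= c + e.
Proof.
move=> m0 e0 Ac.
(* [lim] is meaningful only for a convergent quotient: this one is monotone in h and bounded
   below. *)
have cv : cvg (growth_rate A h @[h --> 0^'+]).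
  apply: nondecreasing_at_right_is_cvgr; near=> x.
    move=> h h'; rewrite !in_itv /= => /andP[h0 _] _; exact: growth_rate_homo.
  by exists (- opn A) => _ [h /= + <-]; rewrite in_itv /= => /andP[h0 _]; exact: growth_rate_ge.
have : \forall h \near 0^'+, growth_rate A h < c + e.
  move/cvgrPdist_lt : cv => /(_ _ e0); apply: filterS => h.
  rewrite -/(lp_measure p A) distrC => /(le_lt_trans (ler_norm _)).
  by rewrite ltrBlDr => H; rewrite addrC; apply: lt_le_trans H _; rewrite lerD2l.
move=> H.
have [h0 Ph0 h00] : exists2 h0 : R, growth_rate A h0 < c + e & 0 < h0.
  by near (0 : R)^'+ => h0; exists h0; near: h0 => //; exact: nbhs_right_gt.
exists h0 => // h hp hh0; exact: le_trans (growth_rate_homo A hp hh0) (ltW Ph0).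
Unshelve. all: by end_near. Qed.

Lemma tens_expand m n (x y : R) (A : 'M[R]_m) (B : 'M[R]_n) :
  (1%:M + x *: A) *t (1%:M + y *: B) =
  1%:M + (x *: (A *t 1%:M) + y *: (1%:M *t B)) + (x * y) *: (A *t B).
Proof.
apply/matrixP => i j; case: (mxtens_indexP i)=> i0 i1; case: (mxtens_indexP j) => j0 j1.
rewrite tensmxE !mxE !mxtens_indexK /= (can_eq (@mxtens_indexK _ _)) xpair_eqE.
by case: eqP; case: eqP => _ _ /=; ring.
Qed.

(** Comparing (1 + a h x)(1 + b h y) with the norm of the expanded Kronecker product leaves two
    terms of order h^2, one from [A *t B] and one from x y; M collects both. *)
Lemma growth_rate_tens m n (A : 'M[R]_m) (B : 'M[R]_n) (a b : R) :
    (0 < m)%N -> (0 < n)%N -> 0 < a -> 0 < b ->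
  exists2 M : R, 0 <= M & forall h : R, 0 < h ->
    a * growth_rate A (a * h) + b * growth_rate B (b * h) <=
    growth_rate (a *: (A *t 1%:M) + b *: (1%:M *t B)) h + h * M.
Proof.
move=> m0 n0 a0 b0; set C := _ + _.
exists (a * b * (opn (A *t B) + opn A * opn B)).
  by rewrite !mulr_ge0 ?(ltW a0) ?(ltW b0) // addr_ge0 ?mulr_ge0 ?opnorm_ge0.
move=> h h0.
have ah : 0 < a * h by rewrite mulr_gt0.
have bh : 0 < b * h by rewrite mulr_gt0.
set x := growth_rate A _; set y := growth_rate B _; set z := growth_rate C h.
have ex : opn (1%:M + (a * h) *: A) = 1 + a * h * x.
  by rewrite /x /growth_rate [a * h * _]mulrC divfK ?gt_eqF // subrKC.
have ey : opn (1%:M + (b * h) *: B) = 1 + b * h * y.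
  by rewrite /y /growth_rate [b * h * _]mulrC divfK ?gt_eqF // subrKC.
have ez : opn (1%:M + h *: C) = 1 + h * z.
  by rewrite /z /growth_rate [h * _]mulrC divfK ?gt_eqF // subrKC.
have H := opnorm_tens p1 (1%:M + (a * h) *: A) (1%:M + (b * h) *: B).
move: H; rewrite tens_expand ex ey.
have -> : (a * h) *: (A *t 1%:M) + (b * h) *: (1%:M *t B) = h *: C.
  by rewrite /C scalerDr !scalerA ![h * _]mulrC.
move=> H; have {}H := le_trans H (opnormD p1 _ _).
have {}H := le_trans H (lerD (lexx _) (opnormZ p1 _ _)).
rewrite ez ger0_norm ?mulr_ge0 ?(ltW a0) ?(ltW b0) ?(ltW h0) // in H.
have xx : `|x| <= opn A by rewrite ler_norml growth_rate_ge ?growth_rate_le.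
have yy : `|y| <= opn B by rewrite ler_norml growth_rate_ge ?growth_rate_le.
have xy : - (x * y) <= opn A * opn B.
  by apply: le_trans (ler_norm _) _; rewrite normrN normrM ler_pM.
rewrite -(ler_pM2l h0).
have := ler_wpM2l (mulr_ge0 (ltW ah) (ltW bh)) xy.
move: H; nra.
Qed.

(* Up to terms of order h^2, 1 + h ((1-s) A (x) 1 + s 1 (x) B) is the Kronecker product of
   1 + (1-s) h A and 1 + s h B, whose norm is at least the product of the norms; growth
   rates at the smaller steps (1-s) h and s h bound those at a common step from above. *)
Lemma lp_measure_tens m n (A : 'M[R]_m) (B : 'M[R]_n) (s c e : R) :
    (0 < m)%N -> (0 < n)%N -> 0 < s < 1 -> 0 < e ->
    lp_measure p ((1 - s) *: (A *t 1%:M) + s *: (1%:M *t B)) <= c ->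
  exists2 h0 : R, 0 < h0 & forall h : R, 0 < h -> h <= h0 ->
    (1 - s) * growth_rate A h + s * growth_rate B h <= c + e.
Proof.
move=> m0 n0 /andP[s0 s1] e0 hC.
have s'0 : 0 < 1 - s by rewrite subr_gt0.
have [M M0 hM] := growth_rate_tens A B m0 n0 s'0 s0.
have e2 : 0 < e / 2 by rewrite divr_gt0.
have mn : (0 < m * n)%N by rewrite muln_gt0 m0.
have [h1 h10 hh1] := lp_measure_growth mn e2 hC.
pose h2 := Num.min h1 (e / 2 / (M + 1)).
have h20 : 0 < h2 by rewrite lt_min h10 divr_gt0 // ltr_pwDr.
have h2M : h2 * M <= e / 2.
  apply: (@le_trans _ _ (h2 * (M + 1))); first by rewrite ler_wpM2l ?(ltW h20) // lerDl.
  by rewrite -ler_pdivlMr ?ltr_pwDr // ge_min lexx orbT.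
exists (Num.min ((1 - s) * h2) (s * h2)); first by rewrite lt_min !mulr_gt0.
move=> h h0; rewrite le_min => /andP[ha hb].
have H1 : growth_rate A h <= growth_rate A ((1 - s) * h2) by exact: growth_rate_homo.
have H2 : growth_rate B h <= growth_rate B (s * h2) by exact: growth_rate_homo.
have H3 := hM h2 h20.
have H4 : growth_rate ((1 - s) *: (A *t 1%:M) + s *: (1%:M *t B)) h2 <= c + e / 2.
  by apply: hh1 => //; rewrite ge_min lexx.
apply: (@le_trans _ _ (c + e / 2 + h2 * M)); last by lra.
apply: le_trans (le_trans H3 (lerD H4 (lexx _))).
by apply: lerD; rewrite ler_wpM2l // ltW.
Qed.

End LogNorm.

(** * Existence of the Jordan form *)

Section JordanForm.
Variable F : numClosedFieldType.

Definition Jordan_mx (d : nat) (l : F) : 'M[F]_d :=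
  \matrix_(i, j) (l *+ (i == j) + (i.+1 == j :> nat)%:R).

Lemma Jordan_mxD d (a l : F) : Jordan_mx d (a + l) = a%:M + Jordan_mx d l.
Proof. by apply/matrixP => i j; rewrite !mxE mulrnDl addrA. Qed.

Lemma Jordan_mx0_mul q n (W : 'M[F]_(q.+1, n)) (i : 'I_q.+1) :
  row i (Jordan_mx q.+1 0 *m W) = if (i < q)%N then row (inord i.+1) W else 0.
Proof.
apply/rowP => j; rewrite !mxE; case: ltnP => iq.
  rewrite (bigD1 (inord i.+1)) //= !mxE mul0rn add0r inordK // eqxx mul1r.
  rewrite big1 ?addr0 // => l; rewrite mxE mul0rn add0r => il.
  case: eqP => [e|_]; last by rewrite mul0r.
  by case/eqP: il; apply/val_inj; rewrite /= inordK.
rewrite mxE big1 // => l _; rewrite mxE mul0rn add0r; case: eqP => [e|_]; last by rewrite mul0r.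
by have := ltn_ord l; rewrite -e ltnS ltnNge iq.
Qed.

Lemma col_mulmx (m n p : nat) (A : 'M[F]_(m, n)) (B : 'M[F]_(n, p)) j :
  col j (A *m B) = A *m col j B.
Proof. by apply/colP => i; rewrite !mxE; apply: eq_bigr => l _; rewrite mxE. Qed.

Section Split.
Variables (n : nat) (C : 'M[F]_n.+1).

Lemma kermx_stabilizes : exists j, (kermx (C ^+ j.+1) <= kermx (C ^+ j))%MS.
Proof.
apply: contrapT => h.
have rk j : (j <= \rank (kermx (C ^+ j)))%N.
  elim: j => // j IHj; apply: leq_ltn_trans IHj _.
  have sub : (kermx (C ^+ j) <= kermx (C ^+ j.+1))%MS.
    by apply/sub_kermxP; rewrite exprSr mulmxA mulmx_ker mul0mx.
  have [le eq] := mxrank_leqif_sup sub.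
  by rewrite ltn_neqAle le andbT eq; apply/negP => le'; apply: h; exists j.
have := leq_trans (rk n.+2) (rank_leq_row _).
by rewrite ltnn.
Qed.

(** q + 1 is the first exponent at which the kernels of the powers of C stabilise. A v in the new
    part of that kernel has v C^q outside the row space of C^(q+1), and f is a column of the
    cokernel detecting this. *)
Lemma Jordan_chain : C \notin unitmx -> exists (q : nat) (v : 'rV[F]_n.+1) (f : 'cV[F]_n.+1),
  [/\ v *m C ^+ q.+1 = 0, C ^+ q.+1 *m f = 0 & (v *m C ^+ q *m f) 0 0 != 0].
Proof.
move=> Cs; case: (ex_minnP kermx_stabilizes) => -[|q] Pq minq.
  case/negP: Cs; rewrite -row_free_unit -kermx_eq0 -submx0.
  by rewrite expr1 expr0 in Pq; apply: submx_trans Pq _; rewrite submx0 kermx_eq0 row_free_unit unitmx1.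
have : ~~ (kermx (C ^+ q.+1) <= kermx (C ^+ q))%MS by apply/negP => /minq; rewrite ltnn.
case/row_subPn => i; set v := row i _ => vq.
have vq1 : v *m C ^+ q.+1 = 0 by apply/sub_kermxP; exact: row_sub.
have wN0 : v *m C ^+ q != 0 by apply: contra vq => /eqP e; exact/sub_kermxP.
(* If v C^q = u C^(q+1), then u lies in the kernel of C^(q+2), hence of C^(q+1), and v C^q = 0. *)
have wN : ~~ (v *m C ^+ q <= C ^+ q.+1)%MS.
  apply: contra wN0 => /submxP[u e]; rewrite e.
  apply/eqP/sub_kermxP; apply: submx_trans Pq; apply/sub_kermxP.
  by rewrite [C ^+ q.+2]exprSr mulmxA -e -mulmxA -[C ^+ q *m C]exprSr.
move: wN; rewrite submxE => /matrix0Pn[a [b]]; rewrite (ord1 a) => wf.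
exists q, v, (col b (cokermx (C ^+ q.+1))); split => //.
  by rewrite -col_mulmx mulmx_coker; apply/colP => j; rewrite !mxE.
by rewrite -col_mulmx mxE.
Qed.

(** The rows v, v C, ..., v C^q of W span a Jordan block, and the row vectors annihilated by f, C f,
    ..., C^q f form an invariant complement U. The two are complementary because [W *m Phi] is a
    Hankel matrix that vanishes below its antidiagonal and is nonzero on it. *)
Lemma Jordan_split : C \notin unitmx -> exists (q m : nat)
    (W : 'M[F]_(q.+1, n.+1)) (U : 'M[F]_(m, n.+1)) (B' : 'M[F]_m),
  [/\ W *m C = Jordan_mx q.+1 0 *m W, U *m C = B' *m U,
      row_full (col_mx W U) & (q.+1 + m)%N = n.+1].
Proof.
move=> /Jordan_chain[q [v [f [vq fq vf]]]].
pose g m := (v *m C ^+ m *m f) 0 0.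
have g0 m : (q < m)%N -> g m = 0.
  by move=> /subnKC <-; rewrite /g exprD !mulmxA vq !mul0mx mxE.
pose W := \matrix_(i < q.+1) (v *m C ^+ i).
pose Phi := \matrix_(i < n.+1, j < q.+1) (C ^+ j *m f) i 0.
have colPhi j : col j Phi = C ^+ j *m f by apply/colP => i; rewrite !mxE.
have WPhi i j : (W *m Phi) i j = g (i + j)%N.
  have -> : (W *m Phi) i j = (row i W *m col j Phi) 0 0.
    by rewrite -row_mul -col_mulmx !mxE.
  by rewrite rowK colPhi /g exprD !mulmxA.
(* Column q - i of the system isolates u_i: terms with j > i vanish, and those with j < i are zero
   by induction. *)
have WPhi_free : row_free (W *m Phi).
  apply: inj_row_free => u u0; apply/rowP => i.
  have [N le_iN] := ubnP (val i); elim: N => // N IHN in i le_iN *.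
  have := congr1 (fun M : 'rV_q.+1 => M 0 (rev_ord i)) u0.
  rewrite !mxE (bigD1 i) //= WPhi.
  have -> : (i + rev_ord i)%N = q by rewrite /= subnKC // -ltnS.
  rewrite big1 ?addr0 => [/eqP|j ij].
    by rewrite mulf_eq0 (negPf vf) orbF => /eqP.
  rewrite WPhi; case: (ltngtP j i) => [ji|ji|/val_inj/eqP]; last by rewrite (negPf ij).
    by rewrite IHN ?mxE ?mul0r // (leq_trans ji).
  rewrite g0 ?mulr0 //=; have := ltn_ord i; move: ji; lia.
have rPhi : \rank Phi = q.+1.
  apply/eqP; rewrite eqn_leq rank_leq_col /=.
  by move: WPhi_free; rewrite /row_free => /eqP {1}<-; exact: mxrankM_maxr.
pose U := row_base (kermx Phi).
have UPhi : U *m Phi = 0 by apply/sub_kermxP; rewrite eq_row_base.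
have Uj j : (j <= q)%N -> U *m (C ^+ j *m f) = 0.
  move=> jq; have := congr1 (col (inord j)) UPhi; rewrite col_mulmx colPhi inordK //.
  by move=> ->; apply/colP => i; rewrite !mxE.
have : (U *m C <= U)%MS.
  rewrite eq_row_base; apply/sub_kermxP; apply/matrixP => i j.
  transitivity (col j (U *m C *m Phi) i 0); first by rewrite [RHS]mxE.
  rewrite col_mulmx colPhi -mulmxA [C *m (_ *m _)]mulmxA.
  have -> : C *m C ^+ j = C ^+ j.+1 by rewrite exprS.
  case: (ltngtP j q) => jq; first by rewrite Uj ?mxE.
    by have := ltn_ord j; rewrite ltnS leqNgt jq.
  by rewrite jq fq mulmx0 !mxE.
case/submxP => B' UC.
have mq : (q.+1 + \rank (kermx Phi))%N = n.+1.
  by rewrite mxrank_ker rPhi subnKC // -rPhi rank_leq_row.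
exists q, (\rank (kermx Phi)), W, U, B'; split => //.
  apply/row_matrixP => i; rewrite Jordan_mx0_mul row_mul rowK.
  case: ltnP => iq.
    by rewrite rowK inordK // -mulmxA -[C ^+ i *m C]exprSr.
  have -> : val i = q by apply/eqP; rewrite eqn_leq iq -ltnS ltn_ord.
  by rewrite -mulmxA -[C ^+ q *m C]exprSr.
suff fr : row_free (col_mx W U).
  by rewrite /row_full (eqP (fr : \rank _ == _)) mq.
apply: inj_row_free => x; rewrite -[x]hsubmxK mul_row_col => e.
have a0 : lsubmx x = 0.
  apply: (row_free_inj WPhi_free); rewrite mul0mx mulmxA.
  have := congr1 (mulmx^~ Phi) e; rewrite mulmxDl -[rsubmx x *m U *m Phi]mulmxA UPhi.
  by rewrite mulmx0 addr0 mul0mx.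
move: e; rewrite a0 mul0mx add0r => e.
have -> : rsubmx x = 0 by apply: (row_free_inj (row_base_free (kermx Phi))); rewrite mul0mx.
by rewrite row_mx0.
Qed.

End Split.

Local Notation chain n := {d : nat & (F * 'M[F]_(d, n))%type}.

Definition chain_space n (s : seq (chain n)) : 'M[F]_n :=
  (\sum_(x <- s) <<(tagged x).2>>)%MS.

(** Strong induction on n: for an eigenvalue l, one chain of B - l splits off, and the chains of the
    action of B on the complement are carried back by U. The tag is the size of the block. *)
Lemma Jordan_chains n (B : 'M[F]_n) : exists s : seq (chain n),
  [/\ all (fun x => (tagged x).2 *m B == Jordan_mx (tag x) (tagged x).1 *m (tagged x).2) s,
      (\sum_(x <- s) tag x)%N = n & (1%:M <= chain_space s)%MS].
Proof.
have [N le_nN] := ubnP n; elim: N => // N IHN in n B le_nN *.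
case: n B le_nN => [|n] B le_nN.
  by exists [::]; split; rewrite ?big_nil // (flatmx0 1%:M) sub0mx.
have [l /eigenvalueP[v vB v0]] := @eigenvalue_closed F n.+1 B isT.
have Cs : B - l%:M \notin unitmx.
  apply: contra v0 => u; apply/eqP; apply: (row_free_inj (A := B - l%:M)).
    by rewrite row_free_unit.
  by rewrite mul0mx mulmxBr vB mul_mx_scalar subrr.
have [q [m [W [U [B' [WC UC full nqm]]]]]] := Jordan_split Cs.
(* B' describes B - l on the rows of U, so B acts there as [B' + l%:M]. *)
have [|s' [hs' dim' sp']] := IHN m (B' + l%:M).
  by rewrite -ltnS (leq_trans _ le_nN) // -nqm ltnS addSn ltnS leq_addl.
pose ext (x : chain m) : chain n.+1 := existT (fun d => (F * 'M[F]_(d, n.+1))%type) (tag x)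
  ((tagged x).1, (tagged x).2 *m U).
pose c : chain n.+1 := existT (fun d => (F * 'M[F]_(d, n.+1))%type) q.+1 (l, W).
have WB : W *m B = Jordan_mx q.+1 l *m W.
  rewrite -[B](subrK l%:M) mulmxDr WC mul_mx_scalar.
  by rewrite -{2}[l]addr0 Jordan_mxD mulmxDl mul_scalar_mx addrC.
have UB : U *m B = (B' + l%:M) *m U.
  by rewrite -[B](subrK l%:M) mulmxDr UC mul_mx_scalar mulmxDl mul_scalar_mx.
exists (c :: map ext s'); split.
- rewrite /= WB eqxx all_map; apply: sub_all hs' => x /= /eqP hx.
  by rewrite -mulmxA UB mulmxA hx // mulmxA.
- by rewrite big_cons big_map /= dim'.
rewrite /chain_space big_cons big_map /=.
have h1 : (1%:M <= W + U)%MS.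
  by apply: submx_trans (_ : _ <= col_mx W U)%MS _; rewrite ?addsmxE // sub1mx.
apply: submx_trans h1 _; apply: addsmxS; first by rewrite genmxE.
have : (U <= chain_space s' *m U)%MS by rewrite -{1}[U]mul1mx submxMr.
move=> /submx_trans; apply; rewrite /chain_space.
elim: (s') => [|x s IHs]; first by rewrite !big_nil mul0mx sub0mx.
rewrite !big_cons addsmxMr addsmxS //= genmxE submxMr //.
by rewrite genmxE.
Qed.

Lemma Jordan_form n (B : 'M[F]_n) : exists (m : nat) (d : 'I_m -> nat) (l : 'I_m -> F)
    (T : 'M[F]_(n, \sum_i d i)) (T' : 'M[F]_(\sum_i d i, n)),
  [/\ T *m T' = 1%:M, T' *m T = 1%:M &
      B = T *m \mxdiag_(i < m) Jordan_mx (d i) (l i) *m T'].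
Proof.
have [s [hs dims sp]] := Jordan_chains B.
rewrite /chain_space big_tnth in sp.
pose x i := tnth (in_tuple s) i.
pose T' := \mxcol_i (tagged (x i)).2.
have full : row_full T'.
  rewrite -sub1mx; apply: submx_trans sp _.
  apply/sumsmx_subP => i _; rewrite genmxE.
  have -> : (tagged (x i)).2 = submxcol T' i by rewrite mxcolK.
  by rewrite /submxcol rowsubE submxMl.
have sz : (\sum_i tag (x i))%N = n by move: dims; rewrite big_tnth.
have free : row_free T' by rewrite /row_free (eqP (full : \rank T' == n)) sz.
exists (size s), (fun i => tag (x i)), (fun i => (tagged (x i)).1), (pinvmx T'), T'.
split; [exact: mulVpmx|exact: mulmxVp|].
rewrite -mulmxA mul_mxdiag_mxcol.
have -> : \mxcol_i (Jordan_mx (tag (x i)) (tagged (x i)).1 *m (tagged (x i)).2) = T' *m B.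
  rewrite mxcol_mul; apply: eq_mxcol => i; apply/esym/eqP.
  by have /(all_tnthP (t := in_tuple s)) := hs; apply.
by rewrite mulmxA mulVpmx // mul1mx.
Qed.

End JordanForm.

(** [principal_mxpow] is a choice with default 0; the existence of a Jordan form is what makes the
    chosen matrix meet its specification. *)
Lemma is_principal_mxpow_exists (R : realType) n (B : 'M[R[i]]_n) (b : R) :
  is_principal_mxpow B b (principal_mxpow B b).
Proof.
have [m [d [l [T [T' [TT' T'T e]]]]]] := Jordan_form B.
have {}e : B = T *m \mxdiag_(i < m) jordan_block (d i) (l i) *m T' by rewrite e.
have hP : is_principal_mxpow B b (T *m \mxdiag_(i < m) jordan_block_pow (d i) (l i) b *m T').
  by exists m, d, l, T, T'; split.
exact: (@xgetPex _ 0 _ (ex_intro _ _ hP)).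
Qed.

Lemma le_mean_value (R : realType) (f df : R -> R) (a b C : R) : a <= b ->
    (forall t, a <= t <= b -> is_derive t 1 f (df t)) ->
    (forall t, a <= t <= b -> `|df t| <= C) ->
  `|f b - f a| <= C * (b - a).
Proof.
move=> ab hf hC.
have [||c cab ->] := MVT_segment ab (f := f) (df := df).
- by move=> t; rewrite in_itv /= => /andP[ta tb]; apply: hf; rewrite !ltW.
- apply: derivable_within_continuous => t; rewrite in_itv /= => tab.
  by have [] := hf t tab.
rewrite normrM [`|b - a|]ger0_norm ?subr_ge0 // ler_wpM2r ?subr_ge0 //.
by apply: hC; move: cab; rewrite in_itv.
Qed.

Lemma is_derive_congr (R : realType) (f g : R -> R) (t a b : R) :
  is_derive t 1 f a -> f = g -> a = b -> is_derive t 1 g b.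
Proof. by move=> h <- <-. Qed.

(** * The binomial series for principal powers *)

Section RealDerivatives.
Variable R : realType.
Implicit Types (f g : R -> R) (t a b : R).

Lemma is_deriveDx f g t a b : is_derive t 1 f a -> is_derive t 1 g b ->
  is_derive t 1 (fun s => f s + g s) (a + b).
Proof. by move=> hf hg; exact: (is_derive_congr (is_deriveD hf hg)). Qed.

Lemma is_deriveMx f g t a b : is_derive t 1 f a -> is_derive t 1 g b ->
  is_derive t 1 (fun s => f s * g s) (a * g t + f t * b).
Proof.
move=> hf hg; apply: (is_derive_congr (is_deriveM hf hg)) => //.
by rewrite /GRing.scale /=; ring.
Qed.

Lemma is_deriveVx f t a : is_derive t 1 f a -> f t != 0 ->
  is_derive t 1 (fun s => (f s)^-1) (- a / f t ^+ 2).
Proof.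
move=> hf f0; apply: (is_derive_congr (is_deriveV f0 hf)) => //.
by rewrite /GRing.scale /=; field.
Qed.

Lemma is_derive_compx f g t a b : is_derive t 1 f a -> is_derive (f t) 1 g b ->
  is_derive t 1 (fun s => g (f s)) (b * a).
Proof. by move=> hf hg; exact: (is_derive_congr (is_derive1_comp hg hf)). Qed.

Lemma is_derive_affine t a b : is_derive t 1 (fun s => a + s * b) b.
Proof.
apply: (is_derive_congr (is_deriveDx (is_derive_cst a t 1)
  (is_deriveMx (is_derive_id t 1) (is_derive_cst b t 1)))) => //.
by rewrite mulr0 addr0 mul1r add0r.
Qed.

End RealDerivatives.

Section ComplexPower.
Variable R : realType.
Local Notation C := R[i].
Local Notation normc := (@Normc.normc R).
Local Notation Re := (@complex.Re R).
Local Notation Im := (@complex.Im R).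
Local Notation inj x := (real_complex R x).

Lemma normcD (x y : C) : normc (x + y) <= normc x + normc y.
Proof. exact: le_normcD. Qed.

Lemma normc_ge0 (x : C) : 0 <= normc x.
Proof. by case: x => a b; exact: sqrtr_ge0. Qed.

Lemma normc_inj (x : R) : normc (inj x) = `|x|.
Proof. by rewrite /= expr0n addr0 sqrtr_sqr. Qed.

Lemma normcN1 : normc (-1) = 1.
Proof. by rewrite /= oppr0 expr0n addr0 sqrtr_sqr normrN normr1. Qed.

Lemma normc_opp (x : C) : normc (- x) = normc x.
Proof. by case: x => a b /=; rewrite !sqrrN. Qed.

Lemma normcX (x : C) n : normc (x ^+ n) = normc x ^+ n.
Proof. by elim: n => [|n IHn]; rewrite ?expr0 ?Normc.normc1 // !exprS Normc.normcM IHn. Qed.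

Lemma normc_Re (x : C) : `|Re x| <= normc x.
Proof.
case: x => a b /=; rewrite -sqrtr_sqr ler_wsqrtr // lerDl sqr_ge0 //.
Qed.

Lemma normc_Im (x : C) : `|Im x| <= normc x.
Proof. by case: x => a b /=; rewrite -sqrtr_sqr ler_wsqrtr // lerDr sqr_ge0. Qed.

Lemma normc_ReIm (a b : R) : normc (a +i* b)%C <= `|a| + `|b|.
Proof.
rewrite -[leRHS]ger0_norm ?addr_ge0 // -sqrtr_sqr ler_wsqrtr //.
rewrite sqrrD !real_normK ?num_real // -addrA lerD2l lerDr.
by rewrite mulrn_wge0 // mulr_ge0.
Qed.

(** Componentwise, so that the real mean value theorem applies to each part. *)
Definition cderiv (f : R -> C) (t : R) (d : C) :=
  is_derive t 1 (fun s => Re (f s)) (Re d) /\ is_derive t 1 (fun s => Im (f s)) (Im d).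

Lemma cderiv_cst c t : cderiv (fun=> c) t 0.
Proof. by split; exact: is_derive_cst. Qed.

Lemma cderiv_inj t : cderiv (fun s => inj s) t 1.
Proof. by split; [exact: is_derive_id|exact: is_derive_cst]. Qed.

Lemma cderivD f g t (a b : C) : cderiv f t a -> cderiv g t b ->
  cderiv (fun s => f s + g s) t (a + b).
Proof.
move=> [f1 f2] [g1 g2]; split.
  have := is_deriveD f1 g1; rewrite raddfD /=.
  by congr (is_derive _ _ _ _); apply/funext => s /=; rewrite raddfD.
have := is_deriveD f2 g2; rewrite raddfD /=.
by congr (is_derive _ _ _ _); apply/funext => s /=; rewrite raddfD.
Qed.

Lemma cderivM f g t (a b : C) : cderiv f t a -> cderiv g t b ->
  cderiv (fun s => f s * g s) t (a * g t + f t * b).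
Proof.
have ReD (x y : C) : Re (x + y) = Re x + Re y by case: x; case: y.
have ImD (x y : C) : Im (x + y) = Im x + Im y by case: x; case: y.
have ReM (x y : C) : Re (x * y) = Re x * Re y - Im x * Im y by case: x; case: y.
have ImM (x y : C) : Im (x * y) = Re x * Im y + Im x * Re y by case: x; case: y.
move=> [f1 f2] [g1 g2]; split.
  apply: (is_derive_congr (is_deriveB (is_deriveM f1 g1) (is_deriveM f2 g2))).
    by apply/funext => s /=; rewrite ReM.
  by rewrite ReD !ReM /GRing.scale /=; ring.
apply: (is_derive_congr (is_deriveD (is_deriveM f1 g2) (is_deriveM f2 g1))).
  by apply/funext => s /=; rewrite ImM.
by rewrite ImD !ImM /GRing.scale /=; ring.
Qed.

Lemma cderiv_eq f t a b : a = b -> cderiv f t a -> cderiv f t b.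
Proof. by move->. Qed.

Lemma cmean_value (f df : R -> C) (e : R) :
    (forall t, 0 <= t <= 1 -> cderiv f t (df t)) ->
    (forall t, 0 <= t <= 1 -> normc (df t) <= e) ->
  normc (f 1 - f 0) <= 2 * e.
Proof.
move=> hf he.
have r : `|Re (f 1) - Re (f 0)| <= e * (1 - 0).
  apply: (@le_mean_value _ (fun s => Re (f s)) (fun s => Re (df s))) => // t t01.
    by have [] := hf t t01.
  exact: le_trans (normc_Re _) (he t t01).
have i : `|Im (f 1) - Im (f 0)| <= e * (1 - 0).
  apply: (@le_mean_value _ (fun s => Im (f s)) (fun s => Im (df s))) => // t t01.
    by have [] := hf t t01.
  exact: le_trans (normc_Im _) (he t t01).
have -> : f 1 - f 0 = ((Re (f 1) - Re (f 0)) +i* (Im (f 1) - Im (f 0)))%C.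
  by case: (f 1); case: (f 0).
by apply: le_trans (normc_ReIm _ _) _; move: r i; lra.
Qed.

(* Closed form of the principal power on the half-plane Re z > 0. *)
Definition cpow (c : R) (z : C) : C :=
  let r := expR (c * (ln (Re z ^+ 2 + Im z ^+ 2) / 2)) in
  let a := c * atan (Im z / Re z) in
  ((r * cos a) +i* (r * sin a))%C.

Lemma principal_powE (c : R) (z : C) : 0 < Re z -> principal_pow z c = cpow c z.
Proof.
case: z => x y /= x0; rewrite /principal_pow /cpow /=.
have r0 : 0 < x ^+ 2 + y ^+ 2 by rewrite ltr_pwDl ?exprn_gt0 // sqr_ge0.
have -> : Num.sqrt (x ^+ 2 + y ^+ 2) `^ c = expR (c * (ln (x ^+ 2 + y ^+ 2) / 2)).
  rewrite -powR12_sqrt ?ltW // -powRrM /powR gt_eqF //; congr expR; ring.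
have -> : principal_arg (x +i* y)%C = atan (y / x).
  rewrite /principal_arg /=.
  have ha := atan_ltpi2 (y / x); have hb := atan_gtNpi2 (y / x).
  have pi0 : 0 < pi :> R by exact: pi_gt0.
  have -> : x / Num.sqrt (x ^+ 2 + y ^+ 2) = cos (atan (y / x)).
    rewrite cos_atan; have -> : 1 + (y / x) ^+ 2 = (x ^+ 2 + y ^+ 2) / x ^+ 2.
      by field; rewrite gt_eqF.
    by rewrite sqrtrM ?ltW // sqrtrV ?sqr_ge0 // sqrtr_sqr gtr0_norm // invf_div.
  case: ifP => y0.
    rewrite cosK // in_itv /= -{1}atan0; apply/andP; split; last by lra.
    by rewrite le_atan // divr_ge0 // ltW.
  rewrite cosKN ?opprK //; apply/andP; split; first by lra.
  rewrite -[leRHS]atan0 le_atan // mulr_le0_ge0 ?invr_ge0 ?(ltW x0) //.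
  by rewrite leNgt; apply/negP => /ltW; rewrite y0.
by congr Complex; rewrite mul0r ?subr0 ?addr0.
Qed.

Lemma cpowN c z : cpow (- c) z * cpow c z = 1.
Proof.
rewrite /cpow; set l := _ / 2; set a := atan _.
have mulE (x y x' y' : R) : (x +i* y)%C * (x' +i* y')%C =
  ((x * x' - y * y') +i* (x * y' + y * x'))%C by [].
rewrite mulE !mulNr cosN sinN (_ : 1 = (1 +i* 0)%C) //.
have e : expR (- (c * l)) * expR (c * l) = 1 by rewrite -expRD addrC subrr expR0.
have s := cos2Dsin2 (c * a).
congr Complex; last by ring.
transitivity ((expR (- (c * l)) * expR (c * l)) * (cos (c * a) ^+ 2 + sin (c * a) ^+ 2)); first by ring.
by rewrite e s mulr1.
Qed.

Lemma normc_cpow c z : normc (cpow c z) = expR (c * (ln (Re z ^+ 2 + Im z ^+ 2) / 2)).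
Proof.
by rewrite /cpow /= !exprMn -mulrDr cos2Dsin2 mulr1 sqrtr_sqr ger0_norm // expR_ge0.
Qed.

(** Here |z| lies in [1/2, 3/2], and ln(1 + x) <= x, used for |z| and for its inverse, bounds the
    modulus of ln |z| by 1. *)
Lemma normc_cpow_le c z : normc (z - 1) <= 2^-1 -> normc (cpow c z) <= expR `|c|.
Proof.
case: z => x y h; rewrite normc_cpow /= ler_expR.
have h1 : normc (x +i* y)%C <= 3 / 2.
  have -> : (x +i* y)%C = ((x +i* y)%C - 1) + 1 by rewrite subrK.
  by apply: le_trans (normcD _ _) _; rewrite Normc.normc1; move: h; lra.
have h2 : 2^-1 <= normc (x +i* y)%C.
  have := normcD (x +i* y)%C (-1 * ((x +i* y)%C - 1)).
  rewrite Normc.normcM normcN1 mul1r mulN1r opprB subrKC Normc.normc1.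
  by move: h; lra.
move: h1 h2 => /=; set s := Num.sqrt _ => h1 h2.
have s0 : 0 < s by lra.
have -> : ln (x ^+ 2 + y ^+ 2) / 2 = ln s.
  have -> : x ^+ 2 + y ^+ 2 = s ^+ 2 by rewrite sqr_sqrtr // addr_ge0 // sqr_ge0.
  by rewrite lnXn // mulr2n; field.
apply: le_trans (ler_norm _) _; rewrite normrM -[leRHS]mulr1 ler_wpM2l // ler_norml.
apply/andP; split.
  rewrite lerNl -lnV ?posrE //.
  have si : s^-1 <= 2 by rewrite invf_ple ?posrE.
  have := @le_ln1Dx _ (s^-1 - 1); rewrite subrKC => H; apply: le_trans (H _) _; last by lra.
  by rewrite ltrBrDr addNr invr_gt0.
have := @le_ln1Dx _ (s - 1); rewrite subrKC => H; apply: le_trans (H _) _; last by lra.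
by rewrite ltrBrDr addNr.
Qed.

Lemma cderiv_cpow c (u : C) t : 0 < Re (1 + inj t * u) ->
  cderiv (fun s => cpow c (1 + inj s * u)) t (inj c * u / (1 + inj t * u) * cpow c (1 + inj t * u)).
Proof.
case: u => x y; set z := fun s : R => 1 + inj s * (x +i* y)%C.
have zE s : z s = ((1 + s * x) +i* (s * y))%C.
  rewrite /z; have -> : inj s * (x +i* y)%C = ((s * x - 0 * y) +i* (s * y + 0 * x))%C by [].
  by rewrite (_ : 1 = (1 +i* 0)%C) //; apply/eqP; rewrite eq_complex /= !mul0r subr0 addr0 add0r !eqxx.
rewrite -/(z t) zE /= => X0.
set X := 1 + t * x; set Y := t * y; rewrite -/X in X0.
have rho0 : 0 < X ^+ 2 + Y ^+ 2 by rewrite ltr_pwDl ?exprn_gt0 // sqr_ge0.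
have dX : is_derive t 1 (fun s => 1 + s * x) x by exact: is_derive_affine.
have dY : is_derive t 1 (fun s => s * y) y.
  by apply: (is_derive_congr (is_derive_affine t 0 y)) => //; apply/funext => s; rewrite add0r.
pose l s := c * (ln ((1 + s * x) ^+ 2 + (s * y) ^+ 2) / 2).
pose a s := c * atan (s * y / (1 + s * x)).
have dl : is_derive t 1 l (c * ((X * x + Y * y) / (X ^+ 2 + Y ^+ 2))).
  have h1 := is_deriveDx (is_deriveMx dX dX) (is_deriveMx dY dY).
  have h2 := is_derive_compx h1 (is_derive1_ln rho0).
  have h3 := is_deriveMx (is_derive_cst (c / 2) t 1) h2.
  apply: (is_derive_congr h3).
    by apply/funext => s; rewrite /l /=; ring.
  by rewrite /= -/X -/Y; field; rewrite gt_eqF.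
have da : is_derive t 1 a (c * ((y * X - Y * x) / (X ^+ 2 + Y ^+ 2))).
  have h1 := is_deriveMx dY (is_deriveVx dX (lt0r_neq0 X0)).
  have h2 := is_derive_compx h1 (is_derive1_atan _).
  have h3 := is_deriveMx (is_derive_cst c t 1) h2.
  apply: (is_derive_congr h3) => //.
  rewrite /= -/X -/Y mul0r add0r; field.
  by rewrite !gt_eqF.
have dr := is_derive_compx dl (is_derive_expR (l t)).
have dc := is_deriveMx dr (is_derive_compx da (is_derive_cos (a t))).
have ds := is_deriveMx dr (is_derive_compx da (is_derive_sin (a t))).
have E : inj c * (x +i* y)%C / (X +i* Y)%C =
    ((c * ((X * x + Y * y) / (X ^+ 2 + Y ^+ 2))) +i* (c * ((y * X - Y * x) / (X ^+ 2 + Y ^+ 2))))%C.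
  apply: (mulIf (x := (X +i* Y)%C)).
    by apply/eqP => /(congr1 Re) /= X00; rewrite X00 ltxx in X0.
  rewrite divfK; last by apply/eqP => /(congr1 Re) /= X00; rewrite X00 ltxx in X0.
  apply/eqP; rewrite eq_complex /=; apply/andP; split; apply/eqP; field; by rewrite gt_eqF.
rewrite E; split.
  apply: (is_derive_congr dc).
    by apply/funext => s; rewrite -/(z s) zE.
  by rewrite /= -/X -/Y -/(a t) -/(l t); ring.
apply: (is_derive_congr ds).
  by apply/funext => s; rewrite -/(z s) zE.
by rewrite /= -/X -/Y -/(a t) -/(l t); ring.
Qed.

Lemma gen_binomialS (b : R) m : m.+1%:R * gen_binomial b m.+1 = (b - m%:R) * gen_binomial b m.
Proof.
rewrite /gen_binomial big_ord_recr /= factS natrM.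
have f0 : m`!%:R != 0 :> R by rewrite pnatr_eq0 -lt0n fact_gt0.
have : m.+1%:R != 0 :> R by rewrite pnatr_eq0.
by move: (m.+1%:R : R) => k k0; field; rewrite f0 k0.
Qed.

Lemma gen_binomial0 (b : R) : gen_binomial b 0 = 1.
Proof. by rewrite /gen_binomial big_ord0 fact0 divr1. Qed.

Lemma gen_binomial_le (b : R) m : `|gen_binomial b m| <= (`|b| + 1) ^+ m.
Proof.
elim: m => [|m IHm]; first by rewrite gen_binomial0 normr1.
have m0 : 0 < m.+1%:R :> R by rewrite ltr0n.
rewrite -(ler_pM2l m0) -{1}[m.+1%:R]gtr0_norm // -normrM gen_binomialS normrM.
rewrite exprS mulrA; apply: ler_pM => //.
apply: le_trans (ler_normB _ _) _; rewrite normr_nat mulrDr mulr1.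
by rewrite lerD ?ler_nat // ler_peMl // ler1n.
Qed.

Definition binom_psum (b : R) (M : nat) (w : C) : C :=
  \sum_(m < M) inj (gen_binomial b m) * w ^+ m.

Lemma cderivX t m : cderiv (fun s => inj s ^+ m) t (m%:R * inj t ^+ m.-1).
Proof.
elim: m => [|m IHm].
  by apply: cderiv_eq (cderiv_cst 1 t); rewrite mul0r.
have := cderivM (cderiv_inj t) IHm.
under [X in cderiv X]eq_fun do rewrite -exprS.
apply: cderiv_eq; rewrite mul1r /=; case: m {IHm} => [|m] /=; first by rewrite mul0r mulr0 addr0 mul1r.
by rewrite exprS -[m.+2%:R]natr1; ring.
Qed.

(* The partial sums satisfy (1 + tu) y' = bu y up to the last term, so that
   y (1 + tu)^(-b) is almost constant. *)
Lemma binom_psum_ode (b : R) (u : C) M t : exists2 d,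
  cderiv (fun s => binom_psum b M (inj s * u)) t d &
  (1 + inj t * u) * d = inj b * u * binom_psum b M (inj t * u) -
    M%:R * inj (gen_binomial b M) * u ^+ M * inj t ^+ M.-1.
Proof.
elim: M => [|M [d hd e]].
  exists 0; last by rewrite /binom_psum big_ord0 !(mulr0, mul0r) subrr.
  apply: cderiv_eq (erefl _) _; have := cderiv_cst 0 t; congr cderiv.
  by apply/funext => s; rewrite /binom_psum big_ord0.
have := cderivD hd (cderivM (cderiv_cst (inj (gen_binomial b M) * u ^+ M) t) (cderivX t M)).
set d' := d + _ => hd'; exists d'.
  move: hd'; congr cderiv; apply/funext => s; rewrite /binom_psum big_ord_recr /=.
  by rewrite exprMn; ring.
rewrite /d' mulrDr e /binom_psum big_ord_recr /= exprMn.
have := gen_binomialS b M => /(congr1 (real_complex R)).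
rewrite !rmorphM rmorphB /= !rmorph_nat => H.
rewrite [M.+1%:R * _]H.
case: M {hd e hd' d' d H} => [|M] /=; rewrite ?expr0 ?exprS; ring.
Qed.

Lemma cpow1 c : cpow c 1 = 1.
Proof.
by rewrite /cpow /= expr1n expr0n addr0 ln1 !(mul0r, mulr0) expR0 atan0 mulr0 cos0 sin0 mulr1 mulr0.
Qed.

(** The product of the partial sum at t u with (1 + t u)^(-b) equals 1 at t = 0 and has a derivative
    of order 2^(-M) on [0, 1]; multiplying back by (1 + u)^b gives the claim. Both powers are
    bounded by [expR] of |b| on the disc. *)
Lemma binomial_series (b : R) (u : C) M : normc u <= (4 * (`|b| + 1))^-1 ->
  normc (principal_pow (1 + u) b - binom_psum b M u) <= 4 * (expR `|b| * expR `|b|) * 2^-1 ^+ M.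
Proof.
set E := expR `|b|.
have E0 : 0 <= E by exact: expR_ge0.
move=> hu.
have b0 : 0 < `|b| + 1 by rewrite ltr_wpDl.
have u4 : normc u <= 4^-1.
  by apply: le_trans hu _; rewrite lef_pV2 ?posrE ?mulr_gt0 // ler_peMr // lerDr.
have tu t : 0 <= t <= 1 -> normc (inj t * u) <= 4^-1.
  move=> /andP[t0 t1]; rewrite Normc.normcM normc_inj ger0_norm //.
  by apply: le_trans u4; rewrite ler_piMl // normc_ge0.
have tu2 t : 0 <= t <= 1 -> normc (1 + inj t * u - 1) <= 2^-1.
  by move=> /tu h; rewrite addrAC subrr add0r; lra.
have Re0 t : 0 <= t <= 1 -> 0 < Re (1 + inj t * u).
  move=> /tu h; have := normc_Re (inj t * u); rewrite ler_norml => /andP[h' _].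
  by rewrite raddfD /=; move: h h'; set r := complex.Re _; lra.
have N1 t : 0 <= t <= 1 -> 1 + inj t * u != 0.
  by move=> /Re0 h; apply/eqP => h'; rewrite h' ltxx in h.
(* From M <= 2^M and (|b| + 1) |u| <= 1/4; the radius in the hypothesis is made for this. *)
have cM : M%:R * `|gen_binomial b M| * normc u ^+ M <= 2^-1 ^+ M.
  apply: (@le_trans _ _ (2 ^+ M * 4^-1 ^+ M)); last first.
    by rewrite -exprMn (_ : 2 * 4^-1 = 2^-1 :> R) //; field.
  rewrite -mulrA; apply: ler_pM => //.
  - by rewrite mulr_ge0 // exprn_ge0 // normc_ge0.
  - by rewrite -natrX ler_nat ltnW // ltn_expl.
  apply: (@le_trans _ _ ((`|b| + 1) ^+ M * normc u ^+ M)).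
    by rewrite ler_wpM2r ?exprn_ge0 ?normc_ge0 ?gen_binomial_le.
  rewrite -exprMn lerXn2r ?nnegrE ?mulr_ge0 ?normc_ge0 ?(ltW b0) //.
  apply: le_trans (ler_wpM2l (ltW b0) hu) _.
  by rewrite le_eqVlt; apply/orP; left; apply/eqP; field; rewrite gt_eqF.
have z1 : 1 + inj 1 * u = 1 + u by rewrite mul1r.
have t1 : 0 <= (1 : R) <= 1 by rewrite ler01 lexx.
have t0 : 0 <= (0 : R) <= 1 by rewrite ler01 lexx.
rewrite principal_powE -z1 ?Re0 //.
have Eu : normc (cpow b (1 + inj 1 * u)) <= E by apply: normc_cpow_le; exact: tu2.
case: M cM => [|M] cM.
  rewrite /binom_psum big_ord0 subr0 expr0 mulr1; apply: le_trans Eu _.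
  have E1 : 1 <= E by rewrite /E -expR0 ler_expR.
  rewrite mulrA -[leLHS]mul1r ler_wpM2r //; lra.
pose q t := cpow (- b) (1 + inj t * u).
pose p t := binom_psum b M.+1 (inj t * u).
pose r t := M.+1%:R * inj (gen_binomial b M.+1) * u ^+ M.+1 * inj t ^+ M.
(* The outer 2 comes from [cmean_value], E bounds q, and the inner 2 bounds the inverse of 1 + t
   u. *)
have H : normc (q 1 * p 1 - q 0 * p 0) <= 2 * (E * (2 * 2^-1 ^+ M.+1)).
  apply: (@cmean_value (fun t => q t * p t) (fun t => - (q t * ((1 + inj t * u)^-1 * r t)))) => t t01.
    have [d hd e] := binom_psum_ode b u M.+1 t.
    apply: cderiv_eq (cderivM (cderiv_cpow (- b) (Re0 t t01)) hd).
    have {e} -> : d = (1 + inj t * u)^-1 * (inj b * u * p t - r t).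
      by rewrite -e mulKf // N1.
    by rewrite -/(q t) -/(p t) rmorphN /=; ring.
  rewrite -mulN1r !Normc.normcM normcN1 mul1r; apply: ler_pM.
  - exact: normc_ge0.
  - by rewrite !mulr_ge0 ?normc_ge0.
  - rewrite /E -normrN; apply: normc_cpow_le; exact: tu2.
  apply: ler_pM; rewrite ?normc_ge0 ?mulr_ge0 ?normc_ge0 //.
    rewrite Normc.normcV invf_ple ?posrE //; last first.
      by rewrite lt0r normc_ge0 andbT; apply/eqP => /Normc.eq0_normc/eqP; rewrite (negPf (N1 t t01)).
    have := normcD (1 + inj t * u) (-1 * (inj t * u)); rewrite mulN1r addrK Normc.normc1.
    by rewrite -mulN1r Normc.normcM normcN1 mul1r; have := tu t t01; lra.
  rewrite !normcX; apply: le_trans cM.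
  rewrite -[leRHS]mulr1; apply: ler_pM => //.
  - by rewrite !mulr_ge0 ?exprn_ge0 ?normc_ge0.
  - by rewrite exprn_ge0 ?normc_ge0.
  - by rewrite !normc_inj (_ : M.+1%:R = inj M.+1%:R) ?normc_inj ?normr_nat // rmorph_nat.
  - by rewrite normc_inj; case/andP: t01 => t00 t01; rewrite exprn_ile1 ?ger0_norm.
have q0 : q 0 * p 0 = 1.
  rewrite /q /p mul0r addr0 cpow1 mul1r /binom_psum big_ord_recl big1 ?addr0.
    by rewrite gen_binomial0 expr0 mulr1.
  by move=> i _; rewrite exprS mul0r mulr0.
rewrite q0 in H.
have -> : cpow b (1 + inj 1 * u) - binom_psum b M.+1 u =
    - cpow b (1 + inj 1 * u) * (q 1 * p 1 - 1).
  rewrite mulrBr mulr1 opprK addrC mulNr mulrA [cpow b _ * _]mulrC cpowN mul1r.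
  by rewrite /p !mul1r.
rewrite Normc.normcM normc_opp.
apply: le_trans (ler_pM _ _ Eu H) _; rewrite ?normc_ge0 //.
by rewrite le_eqVlt; apply/orP; left; apply/eqP; ring.
Qed.

End ComplexPower.

(** * Principal powers near the identity *)

Section MatrixPower.
Variable R : realType.
Local Notation C := R[i].
Local Notation normc := (@Normc.normc R).
Local Notation inj x := (real_complex R x).

Lemma normc_sum (I : Type) (s : seq I) (F : I -> C) :
  normc (\sum_(i <- s) F i) <= \sum_(i <- s) normc (F i).
Proof.
elim: s => [|i s IHs]; first by rewrite !big_nil Normc.normc0.
by rewrite !big_cons; apply: le_trans (normcD _ _) _; rewrite lerD2l.
Qed.

Definition entries_le m n (A : 'M[C]_(m, n)) (c : R) := forall i j, normc (A i j) <= c.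

Lemma entries_leW m n (A : 'M[C]_(m, n)) c c' : c <= c' -> entries_le A c -> entries_le A c'.
Proof. by move=> cc' h i j; exact: le_trans (h i j) cc'. Qed.

Lemma entries_leM m n p (A : 'M[C]_(m, n)) (B : 'M[C]_(n, p)) a b :
  entries_le A a -> entries_le B b -> entries_le (A *m B) (n%:R * (a * b)).
Proof.
move=> hA hB i j; rewrite mxE; apply: le_trans (normc_sum _ _) _.
rewrite mulr_natl -[X in _ *+ X](card_ord n) -sumr_const; apply: ler_sum => k _.
by rewrite Normc.normcM; apply: ler_pM; rewrite ?normc_ge0.
Qed.

Lemma entries_leD m n (A B : 'M[C]_(m, n)) a b :
  entries_le A a -> entries_le B b -> entries_le (A + B) (a + b).
Proof. by move=> hA hB i j; rewrite mxE; apply: le_trans (normcD _ _) (lerD _ _). Qed.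

Lemma entries_bound m n (A : 'M[C]_(m, n)) : exists2 a, 0 <= a & entries_le A a.
Proof.
exists (\sum_i \sum_j normc (A i j)).
  by apply: sumr_ge0 => i _; apply: sumr_ge0 => j _; exact: normc_ge0.
move=> i j; rewrite (bigD1 i) //= (bigD1 j) //= -addrA lerDl.
rewrite addr_ge0 ?sumr_ge0 // => *; rewrite ?normc_ge0 //.
by apply: sumr_ge0 => *; exact: normc_ge0.
Qed.

(** Partial sums of the binomial series for (1 + X)^b at a matrix X. *)
Definition binom_mx n (b : R) (M : nat) (X : 'M[C]_n) : 'M[C]_n :=
  \sum_(m < M) inj (gen_binomial b m) *: X ^+ m.

Lemma binom_mx_conj m n (b : R) M (W : 'M[C]_(m, n)) X Y :
  W *m X = Y *m W -> W *m binom_mx b M X = binom_mx b M Y *m W.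
Proof.
move=> e; have eX j : W *m X ^+ j = Y ^+ j *m W.
  elim: j => [|j IHj]; first by rewrite !expr0 mulmx1 mul1mx.
  by rewrite !exprSr mulmxA IHj -mulmxA e mulmxA.
rewrite /binom_mx mulmx_sumr mulmx_suml; apply: eq_bigr => j _.
by rewrite -scalemxAr -scalemxAl eX.
Qed.

Lemma Jordan_nilX d (w : C) m i j :
  ((jordan_block d w) ^+ m) i j = if (i <= j)%N then 'C(m, j - i)%:R * w ^+ (m - (j - i)) else 0.
Proof.
elim: m i j => [|m IHm] i j.
  rewrite expr0 mxE sub0n expr0 mulr1; case: leqP => ij.
    by rewrite bin0n subn_eq0 -(inj_eq val_inj) eqn_leq ij.
  by rewrite -(inj_eq val_inj) gtn_eqF.
rewrite exprSr mxE.
under eq_bigr do rewrite mxE mulrDr.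
rewrite big_split /= (bigD1 j) //= eqxx mulr1n big1 ?addr0; last first.
  by move=> k /negPf ->; rewrite mulr0n mulr0.
rewrite IHm; case: j => -[|j] jd /=.
  rewrite big1 ?addr0; last by move=> k _; rewrite mulr0.
  case: leqP => [|_]; last by rewrite mul0r.
  by rewrite leqn0 => /eqP ->; rewrite !bin0 !subn0 !mul1r exprSr.
rewrite (bigD1 (Ordinal (ltnW jd))) //= eqxx mulr1 big1 ?addr0; last first.
  move=> k kj; case: eqP => [[e]|]; last by rewrite mulr0.
  by case/eqP: kj; apply/val_inj.
rewrite IHm /=; case: (leqP i j) => ij.
  rewrite (leqW ij) subSn // binS subSS natrD mulrDl; congr (_ + _).
  rewrite -mulrA -exprSr; case: (ltnP (j - i) m) => jm; last by rewrite bin_small // !mul0r.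
  by congr (_ * _ ^+ _); rewrite subnSK.
case: (leqP i j.+1) => ij'; last by rewrite mul0r addr0.
have -> : nat_of_ord i = j.+1 by apply/eqP; rewrite eqn_leq ij' ij.
by rewrite subnn !bin0 !subn0 !mul1r addr0 exprSr.
Qed.

(** Trinomial revision: it turns the entry at distance r above the diagonal, for the series at a
    Jordan block, into [gen_binomial b r] times the series of exponent b - r, matching
    [jordan_block_pow]. *)
Lemma gen_binomial_split (b : R) r j :
  gen_binomial b (r + j) * 'C(r + j, r)%:R = gen_binomial b r * gen_binomial (b - r%:R) j.
Proof.
elim: j => [|j IHj]; first by rewrite addn0 binn gen_binomial0.
have j0 : j.+1%:R != 0 :> R by rewrite pnatr_eq0.
have rj0 : (r + j).+1%:R != 0 :> R by rewrite pnatr_eq0.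
apply: (mulfI j0); rewrite [RHS]mulrCA gen_binomialS.
rewrite addnS [LHS]mulrCA.
have -> : j.+1%:R * 'C((r + j).+1, r)%:R = (r + j).+1%:R * 'C(r + j, r)%:R :> R.
  rewrite -!natrM; have := mul_bin_down (r + j).+1 r; rewrite /= => ->.
  by rewrite subSn ?leq_addr // addKn.
rewrite mulrCA mulrA gen_binomialS -mulrA IHj natrD; ring.
Qed.

Lemma binom_mx_Jordan (b : R) M d (w : C) i j :
  binom_mx b M (jordan_block d w) i j = if (i <= j)%N then
    inj (gen_binomial b (j - i)) * binom_psum (b - (j - i)%:R) (M - (j - i)) w else 0.
Proof.
rewrite summxE; case: leqP => ij; last first.
  by rewrite big1 // => m _; rewrite mxE Jordan_nilX leqNgt ij mulr0.
set r := (j - i)%N.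
under eq_bigr do rewrite mxE Jordan_nilX ij -/r.
rewrite /binom_psum mulr_sumr.
case: (leqP M r) => Mr.
  rewrite (eqP (_ : (M - r)%N == 0)%N) ?subn_eq0 // big_ord0 big1 // => m _.
  by rewrite bin_small ?mul0r ?mulr0 // (leq_trans _ Mr).
have [q ->] : exists q, M = (r + q)%N by exists (M - r)%N; rewrite subnKC // ltnW.
rewrite addKn big_split_ord /= big1 ?add0r; last first.
  by move=> m _; rewrite bin_small ?mul0r ?mulr0.
apply: eq_bigr => m _; rewrite addKn !mulrA; congr (_ * _).
by rewrite -(rmorph_nat (real_complex R)) -!rmorphM gen_binomial_split.
Qed.

(** K serves all blocks of size at most N. At distance r from the diagonal stands a series of
    exponent b - r cut at M - r: hence the factor 2^r in k, and a radius that suits every |b -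
    r|. *)
Lemma jordan_block_pow_approx (b : R) N : exists2 K : R, 0 <= K &
  forall d (l : C) M, (d <= N)%N -> normc (l - 1) <= (4 * (`|b| + N%:R + 1))^-1 -> (N <= M)%N ->
  entries_le (jordan_block_pow d l b - binom_mx b M (jordan_block d l - 1%:M)) (K * 2^-1 ^+ M).
Proof.
pose k r := `|gen_binomial b r| * (4 * (expR `|b - r%:R| * expR `|b - r%:R|) * 2 ^+ r).
have k0 r : 0 <= k r by rewrite !mulr_ge0 ?expR_ge0.
exists (\sum_(r < N) k r); first by apply: sumr_ge0 => r _; exact: k0.
move=> d l M dN hl NM i j.
have -> : jordan_block d l - 1%:M = jordan_block d (l - 1).
  by apply/matrixP => x y; rewrite !mxE mulrnBl addrAC.
have KM : 0 <= (\sum_(r < N) k r) * 2^-1 ^+ M.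
  by rewrite mulr_ge0 ?exprn_ge0 ?invr_ge0 // sumr_ge0.
rewrite 3!mxE binom_mx_Jordan; case: leqP => ij; last by rewrite subr0 Normc.normc0.
have jN : (j - i < N)%N by rewrite (leq_ltn_trans (leq_subr _ _)) // (leq_trans (ltn_ord j)).
move: (j - i)%N jN => r rN.
rewrite -mulrBr Normc.normcM normc_inj.
apply: (@le_trans _ _ (k r * 2^-1 ^+ M)); last first.
  rewrite ler_wpM2r ?exprn_ge0 ?invr_ge0 //.
  by rewrite (bigD1 (Ordinal rN)) //= lerDl sumr_ge0.
rewrite /k -mulrA ler_wpM2l //.
have hw : normc (l - 1) <= (4 * (`|b - r%:R| + 1))^-1.
  apply: le_trans hl _; rewrite lef_pV2 ?posrE ?mulr_gt0 ?ltr_wpDl ?addr_ge0 //.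
  rewrite ler_wpM2l // lerD2r; apply: le_trans (ler_normB _ _) _.
  by rewrite normr_nat lerD2l ler_nat ltnW.
have := binomial_series (M - r) hw; rewrite subrKC => H; apply: le_trans H _.
have -> : 2^-1 ^+ M = 2^-1 ^+ (M - r) * 2^-1 ^+ r :> R.
  by rewrite -exprD subnK // (leq_trans (ltnW rN)).
rewrite -[leRHS]mulrA ler_wpM2l ?mulr_ge0 ?expR_ge0 //.
by rewrite mulrCA -exprMn mulfV ?expr1n ?mulr1.
Qed.

(** The last row w of W is a left eigenvector of B for l; reading w (B - 1) = (l - 1) w at an entry
    of w of largest modulus gives the bound. It brings every block into the disc of the binomial
    series. *)
Lemma Jordan_eigenvalue_near N (B : 'M[C]_N) d (l : C) (W : 'M[C]_(d, N)) (V : 'M[C]_(N, d)) (e : R) :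
    entries_le (B - 1%:M) e -> W *m B = jordan_block d l *m W -> W *m V = 1%:M -> (0 < d)%N ->
  normc (l - 1) <= N%:R * e.
Proof.
case: d W V => // d W V hB WB WV _.
pose w := row ord_max W.
have wB : w *m (B - 1%:M) = (l - 1) *: w.
  rewrite mulmxBr mulmx1 scalerBl scale1r; congr (_ - _).
  rewrite -row_mul WB; apply/rowP => j; rewrite !mxE (bigD1 ord_max) //= !mxE eqxx.
  rewrite mulr1n gtn_eqF // addr0 big1 ?addr0 // => k kd.
  by rewrite mxE eq_sym (negPf kd) mulr0n add0r gtn_eqF ?mul0r.
have [j wj] : exists j, w 0 j != 0.
  apply: contrapT => h; have w0 k : w 0 k = 0.
    by apply/eqP/negPn/negP => wk; apply: h; exists k.
  have := congr1 (fun M : 'M[C]_d.+1 => M ord_max ord_max) WV; rewrite !mxE eqxx big1.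
    by move=> /esym/eqP; rewrite oner_eq0.
  by move=> k _; have := w0 k; rewrite mxE => ->; rewrite mul0r.
pose k := [arg max_(k > j) normc (w 0 k)]%O.
have kmax i : normc (w 0 i) <= normc (w 0 k).
  by rewrite /k; case: arg_maxP => // k' _; apply.
have wk : 0 < normc (w 0 k).
  apply: lt_le_trans (kmax j); rewrite lt0r normc_ge0 andbT.
  by apply: contra wj => /eqP/Normc.eq0_normc ->.
rewrite -(ler_pM2r wk) -Normc.normcM.
have -> : (l - 1) * w 0 k = (w *m (B - 1%:M)) 0 k by rewrite wB [RHS]mxE.
rewrite mxE; apply: le_trans (normc_sum _ _) _.
rewrite -mulrA mulr_natl -[X in _ *+ X](card_ord N) -sumr_const; apply: ler_sum => i _.
by rewrite Normc.normcM mulrC; apply: ler_pM; rewrite ?normc_ge0.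
Qed.

Lemma gen_binomial_le1 (b : R) m : 0 <= b <= 1 -> `|gen_binomial b m| <= 1.
Proof.
move=> /andP[b0 b1]; elim: m => [|m IHm]; first by rewrite gen_binomial0 normr1.
have m0 : 0 < m.+1%:R :> R by rewrite ltr0n.
rewrite -(ler_pM2l m0) -{1}[m.+1%:R]gtr0_norm // -normrM gen_binomialS normrM.
apply: ler_pM => //; rewrite ler_norml -natr1.
by have := ler0n R m; move=> h; apply/andP; split; lra.
Qed.

Lemma binom_mx_near N (b : R) M (E : 'M[C]_N) (e : R) : 0 <= b <= 1 -> 0 <= e ->
    N%:R * e <= 2^-1 -> entries_le E e ->
  entries_le (binom_mx b M.+2 E - 1%:M - inj b *: E) (2 * N%:R * e ^+ 2).
Proof.
move=> b01 e0 Ne hE.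
have hX m : entries_le (E ^+ m.+1) (e * (N%:R * e) ^+ m).
  elim: m => [|m IHm]; first by rewrite expr1 expr0 mulr1.
  rewrite exprSr; apply: entries_leW (entries_leM IHm hE).
  by rewrite le_eqVlt; apply/orP; left; apply/eqP; rewrite exprSr; ring.
(* The induction needs the geometric sum itself: the next term is at most N e^2 2^(-M). *)
suff: entries_le (binom_mx b M.+2 E - 1%:M - inj b *: E) (2 * N%:R * e ^+ 2 * (1 - 2^-1 ^+ M)).
  apply: entries_leW; rewrite -[leRHS]mulr1 ler_wpM2l ?mulr_ge0 ?sqr_ge0 //.
elim: M => [|M IHM].
  move=> i j; rewrite /binom_mx !big_ord_recr big_ord0 /= add0r expr0 expr1 gen_binomial0.
  have -> : gen_binomial b 1 = b.
    by have := gen_binomialS b 0; rewrite mul1r gen_binomial0 subr0 mulr1.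
  have -> : forall X Y : 'M[C]_N, inj 1 *: X + Y - X - Y = 0.
    by move=> X Y; rewrite scale1r [X + Y]addrC addrK subrr.
  by rewrite mxE Normc.normc0 expr0 subrr mulr0.
have -> : binom_mx b M.+3 E - 1%:M - inj b *: E =
    (binom_mx b M.+2 E - 1%:M - inj b *: E) + inj (gen_binomial b M.+2) *: E ^+ M.+2.
  rewrite [binom_mx b M.+3 E]/binom_mx big_ord_recr /= -/(binom_mx b M.+2 E).
  by rewrite -addrA -opprD addrAC opprD addrA.
have h2 : entries_le (inj (gen_binomial b M.+2) *: E ^+ M.+2) (N%:R * e ^+ 2 * 2^-1 ^+ M).
  move=> i j; rewrite mxE Normc.normcM normc_inj.
  apply: le_trans (ler_pM _ _ (gen_binomial_le1 _ b01) (hX M.+1 i j)) _; rewrite ?normc_ge0 //.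
  have -> : 1 * (e * (N%:R * e) ^+ M.+1) = N%:R * e ^+ 2 * (N%:R * e) ^+ M by rewrite exprSr; ring.
  rewrite ler_wpM2l ?mulr_ge0 ?sqr_ge0 // lerXn2r ?nnegrE ?mulr_ge0 //.
apply: entries_leW (entries_leD IHM h2).
by rewrite le_eqVlt; apply/orP; left; apply/eqP; rewrite [2^-1 ^+ M.+1]exprS; field.
Qed.

(* The principal power is the limit of the binomial series evaluated at B - 1: this holds on
   Jordan blocks, and the partial sums commute with conjugation. *)
Lemma principal_mxpow_near N (b : R) : 0 <= b <= 1 -> exists2 e0 : R, 0 < e0 &
  forall (B : 'M[C]_N) e, 0 <= e -> e <= e0 -> entries_le (B - 1%:M) e ->
  entries_le (principal_mxpow B b - 1%:M - inj b *: (B - 1%:M)) (2 * N%:R * e ^+ 2).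
Proof.
move=> b01; have [K K0 hK] := jordan_block_pow_approx b N.
have c0 : 0 < 4 * (`|b| + N%:R + 1) by rewrite mulr_gt0 // ltr_wpDl ?addr_ge0.
have N1 : 0 < N%:R + 1 :> R by rewrite ltr_wpDl.
(* This e0 makes N e at most the radius required by the blocks of size up to N. *)
exists (4 * (`|b| + N%:R + 1) * (N%:R + 1))^-1; first by rewrite invr_gt0 mulr_gt0.
move=> B e e0 ee0 hB.
have Ne : N%:R * e <= (4 * (`|b| + N%:R + 1))^-1.
  apply: (@le_trans _ _ ((N%:R + 1) * e)); first by rewrite ler_wpM2r // lerDl.
  by rewrite -ler_pdivlMl // mulrC -invfM.
have Ne2 : N%:R * e <= 2^-1.
  apply: le_trans Ne _; rewrite lef_pV2 ?posrE //.
  have := normr_ge0 b; have := ler0n R N; lra.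
have [m [d [l [T [T' [TT' T'T eB eP]]]]]] := is_principal_mxpow_exists B b.
set P := principal_mxpow B b in eP *.
pose W i := submxcol T' i.
have T'E : T' = \mxcol_i W i by rewrite submxcolK.
have WB i : W i *m B = jordan_block (d i) (l i) *m W i.
  move: i; apply/eq_mxcolP; rewrite -mxcol_mul -mul_mxdiag_mxcol -T'E eB.
  by rewrite !mulmxA T'T mul1mx.
have WP i : W i *m P = jordan_block_pow (d i) (l i) b *m W i.
  move: i; apply/eq_mxcolP; rewrite -mxcol_mul -mul_mxdiag_mxcol -T'E eP.
  by rewrite !mulmxA T'T mul1mx.
have dN : (\sum_i d i <= N)%N by exact: mulmx1_min T'T.
have diN i : (d i <= N)%N.
  by apply: leq_trans dN; rewrite (bigD1 i) //= leq_addr.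
have WV i : W i *m submxrow T i = 1%:M.
  apply/matrixP => a c; have := congr1 (fun M : 'M[C]_(\sum_i d i) => M (tagnat.Rank i a) (tagnat.Rank i c)) T'T.
  rewrite !mxE => e'; transitivity ((tagnat.Rank i a == tagnat.Rank i c)%:R : C).
    by rewrite -e'; apply: eq_bigr => k _; rewrite !mxE.
  by rewrite /tagnat.Rank (inj_eq (@tagnat.rank_inj _ _)) eq_Tagged.
have lnear i : (0 < d i)%N -> normc (l i - 1) <= (4 * (`|b| + N%:R + 1))^-1.
  by move=> di; apply: le_trans (Jordan_eigenvalue_near hB (WB i) (WV i) di) Ne.
have [t t0 ht] := entries_bound T; have [t' t'0 ht'] := entries_bound T'.
pose G := N%:R * (t * (N%:R * (K * t'))).
have G0 : 0 <= G by rewrite !mulr_ge0.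
(* G depends on the conditioning of the Jordan basis, which is uncontrolled; this is harmless
   because B stays fixed while M grows, so G disappears from the final bound. *)
have close M : (N <= M)%N -> entries_le (P - binom_mx b M (B - 1%:M)) (G * 2^-1 ^+ M).
  move=> NM.
  have -> : P - binom_mx b M (B - 1%:M) = T *m (T' *m (P - binom_mx b M (B - 1%:M))).
    by rewrite mulmxA TT' mul1mx.
  have h1 : entries_le (T' *m (P - binom_mx b M (B - 1%:M))) (N%:R * (K * 2^-1 ^+ M * t')).
    rewrite T'E mxcol_mul => i j; rewrite mxE.
    set x := tagnat.sig1 i; set y := tagnat.sig2 i.
    have -> : W x *m (P - binom_mx b M (B - 1%:M)) =
        (jordan_block_pow (d x) (l x) b - binom_mx b M (jordan_block (d x) (l x) - 1%:M)) *m W x.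
      rewrite mulmxBr WP mulmxBl; congr (_ - _); apply: binom_mx_conj.
      by rewrite mulmxBr mulmxBl WB mulmx1 mul1mx.
    have dx : (0 < d x)%N by case: (d x) y => [[]|].
    have hW : entries_le (W x) t' by move=> a c; rewrite mxE.
    have := entries_leM (hK _ _ _ (diN x) (lnear x dx) NM) hW y j.
    move=> h; apply: le_trans h _.
    by rewrite ler_wpM2r ?ler_nat // !mulr_ge0 // exprn_ge0 ?invr_ge0.
  apply: entries_leW (entries_leM ht h1).
  have -> : G * 2^-1 ^+ M = N%:R * (t * (N%:R * (K * 2^-1 ^+ M * t'))) by rewrite /G; ring.
  by rewrite ler_wpM2r ?ler_nat // !mulr_ge0 // exprn_ge0 ?invr_ge0.
move=> i j; apply/ler_addgt0Pr => eps eps0.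
pose M := (maxn N (Num.truncn (G / eps)).+1).+2.
have GM : G * 2^-1 ^+ M <= eps.
  rewrite exprVn ler_pdivrMr ?exprn_gt0 // mulrC -ler_pdivrMr //.
  have := truncnS_gt (G / eps) => /ltW h; apply: le_trans h _.
  rewrite -natrX ler_nat (leq_trans _ (ltnW (ltn_expl M (isT : 1 < 2)%N))) //.
  by rewrite /M ltnS leqW // (leq_trans _ (leq_maxr _ _)).
have NM : (N <= M)%N by rewrite /M 2?leqW // leq_maxl.
have -> : P - 1%:M - inj b *: (B - 1%:M) =
    (P - binom_mx b M (B - 1%:M)) + (binom_mx b M (B - 1%:M) - 1%:M - inj b *: (B - 1%:M)).
  by rewrite !addrA subrK.
rewrite addrC; apply: (entries_leD (binom_mx_near _ b01 e0 Ne2 hB) _) => i' j'.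
exact: le_trans (close M NM i' j') GM.
Qed.

Lemma compound_pow_near n k (b : R) (A : 'M[R]_n) : 0 <= b <= 1 ->
  exists e0 K : R, [/\ 0 < e0, 0 <= K & forall e : R, `|e| <= e0 -> forall i j,
    normc (principal_mxpow (map_mx (real_complex R) (mul_compound k (1%:M + e *: A))) b i j -
      inj ((i == j)%:R + e * (b * add_compound k A i j))) <= K * e ^+ 2].
Proof.
move=> b01; have /andP[b0 b1] := b01.
set D := add_compound k A; set N := 'C(n, k).
have [d0 d00 hd] := principal_mxpow_near N b01.
pose a := `|A| + 1; have a0 : 0 < a by rewrite ltr_wpDl.
pose c : R := k`!%:R * 4 ^+ k; have c0 : 0 <= c by rewrite mulr_ge0.
pose L := `|D| + c * a ^+ 2; have L0 : 0 <= L by rewrite addr_ge0 // mulr_ge0 // sqr_ge0.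
pose e0 := Num.min 1 (Num.min a^-1 (d0 / (L + 1))).
have L1 : 0 < L + 1 by rewrite ltr_wpDl.
exists e0, (2 * N%:R * L ^+ 2 + c * a ^+ 2); split.
- by rewrite !lt_min ltr01 invr_gt0 a0 divr_gt0.
- by apply: addr_ge0; apply: mulr_ge0; rewrite ?sqr_ge0 // mulr_ge0.
move=> e; rewrite !le_min => /and3P[e1 ea eL] i j.
set B := mul_compound k (1%:M + e *: A).
have ea1 : `|e| * a <= 1 by rewrite -ler_pdivlMr // mul1r.
have hB i' j' : `|(B - 1%:M - e *: D) i' j'| <= c * a ^+ 2 * e ^+ 2.
  rewrite /D add_compound_lin -lin_compoundZ.
  have -> : c * a ^+ 2 * e ^+ 2 = c * (`|e| * a) ^+ 2.
    by rewrite exprMn real_normK ?num_real //; ring.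
  apply: mul_compound_lin => [|x y]; first by rewrite ea1 mulr_ge0 // ltW.
  rewrite mxE normrM ler_wpM2l //; apply: le_trans (mxnorm_entry A x y) _.
  by rewrite lerDl.
clearbody B.
have hB1 : entries_le (map_mx (real_complex R) B - 1%:M) (`|e| * L).
  move=> i' j'; rewrite !mxE -(rmorph_nat (real_complex R)) -rmorphB normc_inj.
  have -> : B i' j' - (i' == j')%:R = (B - 1%:M - e *: D) i' j' + e * D i' j'.
    by rewrite !mxE subrK.
  apply: le_trans (ler_normD _ _) _; rewrite /L mulrDr addrC lerD //.
    by rewrite normrM ler_wpM2l // mxnorm_entry.
  apply: le_trans (hB i' j') _; rewrite mulrC ler_wpM2r ?mulr_ge0 ?sqr_ge0 ?(ltW a0) //.
  by rewrite -real_normK ?num_real // expr2 ler_piMl.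
have eLd : `|e| * L <= d0.
  apply: (@le_trans _ _ (`|e| * (L + 1))); first by rewrite ler_wpM2l // lerDl.
  by rewrite -ler_pdivlMr.
have H := hd _ _ (mulr_ge0 (normr_ge0 e) L0) eLd hB1 i j.
have Ne2 : (`|e| * L) ^+ 2 = L ^+ 2 * e ^+ 2 by rewrite exprMn real_normK ?num_real // mulrC.
rewrite Ne2 in H.
set P := principal_mxpow _ _ in H *.
have -> : P i j - inj ((i == j)%:R + e * (b * D i j)) =
   (P - 1%:M - inj b *: (map_mx (real_complex R) B - 1%:M)) i j +
   inj (b * (B - 1%:M - e *: D) i j).
  rewrite !mxE !rmorphD !rmorphM !rmorphB !rmorphM /= !rmorph_nat; ring.
apply: le_trans (normcD _ _) _; rewrite mulrDl; apply: lerD.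
  by apply: le_trans H _; rewrite mulrA.
rewrite normc_inj normrM ger0_norm //; apply: le_trans (ler_piMl _ b1) _ => //.
Qed.

Lemma product_near (x y : C) (a a' c c' e K L : R) : 0 <= K -> 0 <= L -> `|e| <= 1 ->
    `|a| <= 1 -> `|c| <= 1 -> `|a'| <= L -> `|c'| <= L ->
    normc (x - inj (a + e * a')) <= K * e ^+ 2 ->
    normc (y - inj (c + e * c')) <= K * e ^+ 2 ->
  `|complex.Re (x * y) - a * c - e * (a' * c + a * c')| <=
    (L ^+ 2 + 2 * (1 + L) * K + K ^+ 2) * e ^+ 2.
Proof.
move=> K0 L0 e1 ha hc ha' hc'.
set r := x - _; set r' := y - _ => hr hr'.
have e2 : 0 <= e ^+ 2 by rewrite sqr_ge0.
have e21 : e ^+ 2 <= 1 by rewrite -real_normK ?num_real // exprn_ile1.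
have -> : complex.Re (x * y) - a * c - e * (a' * c + a * c') =
  complex.Re (inj (e ^+ 2 * (a' * c')) + inj (a + e * a') * r' + r * inj (c + e * c') + r * r').
  have -> : x * y = inj (a * c + e * (a' * c + a * c')) + (inj (e ^+ 2 * (a' * c')) + inj (a + e * a') * r' + r * inj (c + e * c') + r * r').
    by rewrite /r /r' !(rmorphD, rmorphM, rmorphXn) /=; ring.
  by rewrite [in LHS]raddfD /=; ring.
apply: le_trans (normc_Re _) _.
have u1 z z' : `|z| <= 1 -> `|z'| <= L -> normc (inj (z + e * z')) <= 1 + L.
  move=> hz hz'; rewrite normc_inj; apply: le_trans (ler_normD _ _) _; rewrite lerD //.
  by rewrite normrM -[leRHS]mul1r ler_pM.
apply: le_trans (normcD _ _) _; apply: le_trans (lerD (normcD _ _) (lexx _)) _.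
apply: le_trans (lerD (lerD (normcD _ _) (lexx _)) (lexx _)) _.
rewrite !Normc.normcM.
have h1 : normc (inj (e ^+ 2 * (a' * c'))) <= L ^+ 2 * e ^+ 2.
  by rewrite normc_inj normrM (ger0_norm e2) normrM mulrC ler_wpM2r // expr2 ler_pM.
have h2 : normc (inj (a + e * a')) * normc r' <= (1 + L) * (K * e ^+ 2).
  by apply: ler_pM; rewrite ?normc_ge0 ?u1.
have h3 : normc r * normc (inj (c + e * c')) <= (K * e ^+ 2) * (1 + L).
  by apply: ler_pM; rewrite ?normc_ge0 ?u1.
have h4 : normc r * normc r' <= K ^+ 2 * e ^+ 2.
  apply: le_trans (ler_pM _ _ hr hr') _; rewrite ?normc_ge0 //.
  rewrite (_ : K * e ^+ 2 * (K * e ^+ 2) = K ^+ 2 * e ^+ 2 * e ^+ 2); last by ring.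
  by rewrite ler_piMr // mulr_ge0 ?sqr_ge0.
apply: le_trans (lerD (lerD (lerD h1 h2) h3) h4) _.
by rewrite le_eqVlt; apply/orP; left; apply/eqP; ring.
Qed.

(** An entry of the Kronecker product is a product of one entry of each power, both known up to
    O(e^2), so the product rule applies entry by entry. *)
Lemma frac_add_compoundE n k (s : R) (A : 'M[R]_n) : 0 <= s <= 1 ->
  frac_add_compound k s A =
  (1 - s) *: (add_compound k A *t 1%:M) + s *: (1%:M *t add_compound k.+1 A).
Proof.
move=> /andP[s0 s1].
have s'01 : 0 <= 1 - s <= 1 by rewrite subr_ge0 s1 lerBlDr lerDl.
have s01 : 0 <= s <= 1 by rewrite s0.
have [e1 [K1 [e10 K10 h1]]] := compound_pow_near k A s'01.
have [e2 [K2 [e20 K20 h2]]] := compound_pow_near k.+1 A s01.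
set D1 := add_compound k A in h1 *; set D2 := add_compound k.+1 A in h2 *.
pose K := K1 + K2; have K0 : 0 <= K by rewrite addr_ge0.
pose L := `|D1| + `|D2|; have L0 : 0 <= L by rewrite addr_ge0.
apply: (@derive1_quadratic _ _ _ _ 1%:M _ (L ^+ 2 + 2 * (1 + L) * K + K ^+ 2) (Num.min 1 (Num.min e1 e2))).
- by rewrite !lt_min ltr01 e10.
- by rewrite !addr_ge0 ?mulr_ge0 ?addr_ge0 ?sqr_ge0.
move=> e; rewrite !le_min => /and3P[e1' ee1 ee2] i j.
case: (mxtens_indexP i)=> i0 i1; case: (mxtens_indexP j) => j0 j1.
set F := frac_mul_compound _ _ _.
have -> : (map_mx (@complex.Re R) F - 1%:M - e *: ((1 - s) *: (D1 *t 1%:M) + s *: (1%:M *t D2)))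
    (mxtens_index (i0, i1)) (mxtens_index (j0, j1)) =
  complex.Re (principal_mxpow (map_mx (real_complex R) (mul_compound k (1%:M + e *: A))) (1 - s) i0 j0 *
    principal_mxpow (map_mx (real_complex R) (mul_compound k.+1 (1%:M + e *: A))) s i1 j1) -
  (i0 == j0)%:R * (i1 == j1)%:R -
  e * (((1 - s) * D1 i0 j0) * (i1 == j1)%:R + (i0 == j0)%:R * (s * D2 i1 j1)).
  rewrite 3!mxE /F /frac_mul_compound tensmxE !mxE !mxtens_indexK /=.
  rewrite (can_eq (@mxtens_indexK _ _)) xpair_eqE.
  congr (_ - _ - _); first by case: eqP; case: eqP; rewrite /= ?mulr1 ?mulr0.
  ring.
apply: product_near => //.
- by case: eqP; rewrite ?normr1 ?normr0.
- by case: eqP; rewrite ?normr1 ?normr0.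
- rewrite normrM ger0_norm ?subr_ge0 //; apply: le_trans (ler_piMl _ _) _ => //.
    by case/andP: s'01.
  by apply: le_trans (mxnorm_entry _ _ _) _; rewrite lerDl.
- rewrite normrM ger0_norm //; apply: le_trans (ler_piMl _ _) _ => //.
  by apply: le_trans (mxnorm_entry _ _ _) _; rewrite lerDr.
- by apply: le_trans (h1 e ee1 i0 j0) _; rewrite ler_wpM2r ?sqr_ge0 // lerDl.
- by apply: le_trans (h2 e ee2 i1 j1) _; rewrite ler_wpM2r ?sqr_ge0 // lerDr.
Qed.

End MatrixPower.

(** * Complete pivoting and coverings *)

Section Pivot.
Variables (R : realType) (n : nat).
Implicit Types A : 'M[R]_n.+1.

Definition pivot A : 'I_n.+1 * 'I_n.+1 :=
  [arg max_(ij > (ord0, ord0)) `|A ij.1 ij.2|]%O.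

Lemma pivotE A : `|A (pivot A).1 (pivot A).2| = `|A|.
Proof.
apply/eqP; rewrite eq_le mxnorm_entry /=.
apply: mxnorm_le => // i j; rewrite /pivot.
by case: arg_maxP => //= ij _ /(_ (i, j)); apply.
Qed.

(** The division by the pivot makes all entries at most 1 in modulus; for A = 0 the convention that
    0 is its own inverse makes the row 0. *)
Definition pivot_row A : 'rV[R]_n.+1 := (A (pivot A).1 (pivot A).2)^-1 *: row (pivot A).1 A.
Definition pivot_col A : 'cV[R]_n.+1 := col (pivot A).2 A.
(** Gaussian elimination kept at full size: for a nonzero A the pivot row and column become zero
    instead of being deleted, so all iterates act on the same space. *)
Definition pivot_step A := A - pivot_col A *m pivot_row A.

Lemma pivot_row_le A : `|pivot_row A| <= 1.
Proof.
apply: mxnorm_le => // i j; rewrite !mxE normrM normfV pivotE.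
have [->|A0] := eqVneq A 0; first by rewrite normr0 invr0 mul0r.
by rewrite mulrC ler_pdivrMr ?normr_gt0 // mul1r mxnorm_entry.
Qed.

Lemma pivot_col_le A : `|pivot_col A| <= `|A|.
Proof. by apply: mxnorm_le => // i j; rewrite mxE mxnorm_entry. Qed.

(** Growth factor of complete pivoting; iterated, it bounds later pivots by earlier ones. *)
Lemma pivot_step_le A : `|pivot_step A| <= 2 * `|A|.
Proof.
apply: mxnorm_le => [|i j]; first by rewrite mulr_ge0.
rewrite !mxE big_ord1; apply: le_trans (ler_normB _ _) _.
rewrite normrM mulrDl mul1r lerD ?mxnorm_entry //.
rewrite -[leRHS]mulr1 ler_pM //.
  exact: le_trans (mxnorm_entry _ _ _) (pivot_col_le A).
exact: le_trans (mxnorm_entry _ _ _) (pivot_row_le A).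
Qed.

Definition pivot_iter a A := iter a pivot_step A.

Lemma pivot_iter_le a b A : (a <= b)%N ->
  `|pivot_iter b A| <= 2 ^+ (b - a) * `|pivot_iter a A|.
Proof.
move=> /subnKC => <-; rewrite addKn; elim: (b - a)%N => [|c IHc].
  by rewrite addn0 mul1r.
rewrite addnS /pivot_iter iterS exprS -mulrA.
by apply: le_trans (pivot_step_le _) _; rewrite ler_wpM2l.
Qed.

Lemma pivot_decomposition k A : A = \sum_(a < k)
  pivot_col (pivot_iter a A) *m pivot_row (pivot_iter a A) + pivot_iter k A.
Proof.
elim: k => [|k IHk]; first by rewrite big_ord0 add0r.
by rewrite {1}IHk big_ord_recr /= -addrA; congr (_ + _); rewrite /pivot_step subrKC.
Qed.

(** Block elimination: bordering a minor of [pivot_step A] by the pivot row and column gives a minor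
    of A, and multiplies the determinant by the pivot. I and J are plain functions, free to be
    unordered or to repeat. *)
Lemma pivot_minor k A : exists I J : 'I_k -> 'I_n.+1,
  `|\det (mxsub I J A)| = \prod_(a < k) `|pivot_iter a A|.
Proof.
elim: k A => [|k IHk] A.
  by exists (fun=> ord0), (fun=> ord0); rewrite big_ord0 det_mx00 normr1.
have [A0|A0] := eqVneq A 0.
  exists (fun=> ord0), (fun=> ord0); rewrite big_ord_recl /= A0 normr0 mul0r.
  have -> : mxsub (fun=> ord0) (fun=> ord0) (0 : 'M[R]_n.+1) = 0 :> 'M[R]_k.+1.
    by apply/matrixP => i j; rewrite !mxE.
  by rewrite det0 normr0.
have [I [J IJ]] := IHk (pivot_step A).
pose i0 := (pivot A).1; pose j0 := (pivot A).2.
have p0 : A i0 j0 != 0 by rewrite -normr_gt0 pivotE normr_gt0.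
pose I' (i : 'I_(1 + k)) := match fintype.split i with inl _ => i0 | inr i => I i end.
pose J' (i : 'I_(1 + k)) := match fintype.split i with inl _ => j0 | inr i => J i end.
exists I', J'.
rewrite big_ord_recl /= -[in X in _ = X * _]pivotE -/i0 -/j0.
rewrite [RHS](_ : _ = `|A i0 j0| * \prod_(a < k) `|pivot_iter a (pivot_step A)|); last first.
  congr (_ * _); apply: eq_bigr => a _.
  by rewrite add0n /pivot_iter -iterS iterSr.
rewrite -IJ -normrM; congr `|_|.
pose c : 'cV[R]_k := \col_i A (I i) j0; pose r : 'rV[R]_k := \row_j A i0 (J j).
have -> : mxsub I' J' A = block_mx (A i0 j0)%:M r c (mxsub I J A).
  apply/matrixP => i j; rewrite !mxE /I' /J'.
  by case: splitP => i' ei; rewrite !mxE; case: splitP => j' ej; rewrite !mxE // !ord1 ?eqxx.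
have -> : block_mx (A i0 j0)%:M r c (mxsub I J A) =
    block_mx 1%:M 0 ((A i0 j0)^-1 *: c) 1%:M *m
    block_mx (A i0 j0)%:M r 0 (mxsub I J (pivot_step A)).
  rewrite mulmx_block !mul1mx !mul0mx !addr0 -scalemxAl.
  congr block_mx.
    by rewrite mul_mx_scalar scalerA mulVf // scale1r.
  apply/matrixP => i j; rewrite !mxE !big_ord1 !mxE -/i0 -/j0.
  rewrite addrC -[LHS]addr0; ring.
have := det_mulmx (block_mx 1%:M 0 ((A i0 j0)^-1 *: c) 1%:M : 'M[R]_(1 + k))
  (block_mx (A i0 j0)%:M r 0 (mxsub I J (pivot_step A))).
by rewrite det_lblock !det1 !mul1r det_ublock det_scalar expr1.
Qed.

End Pivot.

Section Boxes.
Variables (R : realType) (V : Type).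

Lemma truncn_dist (x y : R) : 0 <= x -> 0 <= y -> Num.truncn x = Num.truncn y -> `|x - y| <= 1.
Proof.
move=> x0 y0 e; have := truncn_itv x0; have := truncn_itv y0; rewrite e -natr1.
by move=> /andP[a b] /andP[c d]; rewrite ler_norml; apply/andP; split; lra.
Qed.

(** The cells are the level sets of the truncated quotients q a / d, cut one coordinate at a time; L
    a / d + 1 bounds the number of values. *)
Lemma box_cover k (q : 'I_k -> V -> R) (L : 'I_k -> R) (U : set V) (d : R) :
    0 < d -> (forall a, 0 <= L a) -> (forall a z, U z -> 0 <= q a z <= L a) ->
  exists s : seq (set V),
    [/\ (size s)%:R <= \prod_a (L a / d + 1),
        forall z, U z -> exists2 W, W \in s & W z &
        forall W, W \in s -> W `<=` U /\
          forall z z', W z -> W z' -> forall a, `|q a z - q a z'| <= d].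
Proof.
move=> d0; elim: k q L => [|k IHk] q L L0 hq.
  exists [:: U]; split; rewrite ?big_ord0 //.
    by move=> z Uz; exists U => //; rewrite inE.
  by move=> W; rewrite inE => /eqP ->; split=> // z z' _ _ [].
have [|a z Uz|s [ss sU sW]] := IHk (fun a => q (lift ord0 a)) (fun a => L (lift ord0 a)).
- by move=> a; exact: L0.
- exact: hq.
pose N := (Num.truncn (L ord0 / d)).+1.
have qd z : U z -> 0 <= q ord0 z / d.
  by move=> /(hq ord0)/andP[? _]; rewrite divr_ge0 // ltW.
pose cut (W : set V) (j : nat) := W `&` [set z | Num.truncn (q ord0 z / d) = j].
exists [seq cut W j | W <- s, j <- iota 0 N]; split.
- rewrite size_allpairs size_iota natrM big_ord_recl mulrC; apply: ler_pM => //.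
  rewrite /N -natr1 lerD2r.
  by have /andP[] := truncn_itv (divr_ge0 (L0 ord0) (ltW d0)).
- move=> z Uz; have [W Ws Wz] := sU z Uz.
  exists (cut W (Num.truncn (q ord0 z / d))); last by split.
  apply: allpairs_f => //; rewrite mem_iota add0n /= ltnS.
  apply: le_truncn; rewrite ler_pM2r ?invr_gt0 //.
  by have /andP[] := hq ord0 z Uz.
move=> _ /allpairsP[[W j] /= [Ws _ ->]]; have [WU hW] := sW W Ws.
split=> [z [Wz _]|z z' [Wz /= zj] [Wz' /= z'j] a]; first exact: WU.
case: (unliftP ord0 a) => [b|] ->; first exact: hW.
have H : `|q ord0 z / d - q ord0 z' / d| <= 1.
  by apply: truncn_dist; rewrite ?zj ?z'j //; apply: qd; exact: WU.
by move: H; rewrite -mulrBl normrM normfV (gtr0_norm d0) ler_pdivrMr // mul1r.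
Qed.

End Boxes.

Section PivotCover.
Variables (R : realType) (n : nat).
Local Notation V := 'rV[R]_n.+1.

Lemma norm_mulmx_row (z : V) m (A : 'M[R]_(n.+1, m)) (c r : R) :
  0 <= c -> 0 <= r -> `|z| <= r -> `|A| <= c -> `|z *m A| <= n.+1%:R * c * r.
Proof.
move=> c0 r0 zr Ac; apply: mxnorm_le => [|i j]; first by rewrite !mulr_ge0.
rewrite mxE; apply: le_trans (ler_norm_sum _ _ _) _.
rewrite -mulrA mulr_natl -[X in _ *+ X](card_ord n.+1) -sumr_const.
apply: ler_sum => l _; rewrite normrM mulrC; apply: ler_pM => //.
  exact: le_trans (mxnorm_entry _ _ _) Ac.
exact: le_trans (mxnorm_entry _ _ _) zr.
Qed.

(** Only the k pivot directions are cut. The constant adds k from the cells, 2 [n.+1] from the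
    residual [pivot_iter k A] at two points, and 2 from the nonlinear remainder at two points. *)
Lemma pivot_cover (k : nat) (A : 'M[R]_n.+1) (phi : V -> V) (U : set V) z0
    (r d kappa : R) :
    0 < r -> 0 < d -> `|pivot_iter k A| <= d -> kappa <= d ->
    (forall z, U z -> `|z - z0| <= r) ->
    (forall z, U z -> `|phi z - phi z0 - (z - z0) *m A| <= kappa * r) ->
  exists s : seq (set V),
    [/\ (size s)%:R <= \prod_(a < k) (2 * n.+1%:R * `|pivot_iter a A| / d + 1),
        forall z, U z -> exists2 W, W \in s & W z &
        forall W, W \in s -> W `<=` U /\
          forall z z', W z -> W z' ->
            `|phi z - phi z'| <= (k%:R + 2 * n.+1%:R + 2) * d * r].
Proof.
move=> r0 d0 Ad kd hU hphi.
pose p a := `|pivot_iter a A|.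
pose x (a : 'I_k) z := ((z - z0) *m pivot_col (pivot_iter a A)) 0 0.
(* Shifted to be nonnegative, as truncation to cells requires. *)
pose q (a : 'I_k) z := x a z + n.+1%:R * p a * r.
have dr : 0 < d * r by rewrite mulr_gt0.
have hq a z : U z -> 0 <= q a z <= 2 * n.+1%:R * p a * r.
  move=> /hU zr.
  have := norm_mulmx_row (normr_ge0 _) (ltW r0) zr (pivot_col_le (pivot_iter a A)).
  move=> /(le_trans (mxnorm_entry _ 0 0)); rewrite -/(x a z) ler_norml -/(p a) /q.
  by move=> /andP[h1 h2]; apply/andP; split; lra.
have [|s [ss sU sW]] := box_cover dr _ hq.
  by move=> a; rewrite mulr_ge0 ?(ltW r0) // /p !mulr_ge0.
exists s; split => //.
  apply: le_trans ss _; apply: ler_prod => a _.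
  have -> : 2 * n.+1%:R * p a * r / (d * r) = 2 * n.+1%:R * p a / d.
    by field; rewrite !gt_eqF.
  by rewrite lexx andbT addr_ge0 // divr_ge0 ?(ltW d0) // /p !mulr_ge0.
move=> W Ws; have [WU hW] := sW W Ws; split=> // z z' Wz Wz'.
have zA w : (w - z0) *m A = \sum_(a < k) x a w *: pivot_row (pivot_iter a A) +
    (w - z0) *m pivot_iter k A.
  rewrite {1}(pivot_decomposition k A) mulmxDr mulmx_sumr; congr (_ + _).
  apply: eq_bigr => a _; rewrite mulmxA /x.
  by rewrite [X in X *m _]mx11_scalar mul_scalar_mx.
pose E w := phi w - phi z0 - (w - z0) *m A.
have -> : phi z - phi z' = \sum_(a < k) (x a z - x a z') *: pivot_row (pivot_iter a A) +
    ((z - z0) *m pivot_iter k A - (z' - z0) *m pivot_iter k A) + (E z - E z').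
  under eq_bigr do rewrite scalerBl.
  rewrite sumrB /E !zA; set s1 := \sum_a _; set s2 := \sum_a _.
  rewrite -[phi z - phi z'](subrKA (phi z0)).
  by apply/matrixP => i j; rewrite !mxE; ring.
have r1 : `|\sum_(a < k) (x a z - x a z') *: pivot_row (pivot_iter a A)| <= k%:R * (d * r).
  apply: le_trans (ler_norm_sum _ _ _) _.
  rewrite mulr_natl -[X in _ *+ X](card_ord k) -sumr_const; apply: ler_sum => a _.
  rewrite normrZ -[leRHS]mulr1; apply: ler_pM => //; last exact: pivot_row_le.
  by have := hW z z' Wz Wz' a; rewrite /q opprD addrACA subrr addr0.
have r2 w : W w -> `|(w - z0) *m pivot_iter k A| <= n.+1%:R * d * r.
  by move=> /WU/hU zr; apply: norm_mulmx_row => //; exact: ltW.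
have r3 w : W w -> `|E w| <= d * r.
  by move=> /WU/hphi zr; apply: le_trans zr _; rewrite ler_wpM2r // ltW.
apply: le_trans (ler_normD _ _) _.
apply: le_trans (lerD (ler_normD _ _) (ler_normB _ _)) _.
apply: le_trans (lerD (lerD (lexx _) (ler_normB _ _)) (lexx _)) _.
apply: le_trans (lerD (lerD r1 (lerD (r2 _ Wz) (r2 _ Wz'))) (lerD (r3 _ Wz) (r3 _ Wz'))) _.
by rewrite le_eqVlt; apply/orP; left; apply/eqP; ring.
Qed.

End PivotCover.

(** * The flow on a compact invariant set *)

Section CompactUniformity.
Variables (R : realType) (X Y : normedModType R).

(** P is downward closed in d, so the local thresholds on a finite subcover have a common one. *)
Lemma compact_uniform (Q : set X) (P : R -> X -> Prop) : compact Q ->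
    (forall d d' q, 0 < d -> d <= d' -> P d' q -> P d q) ->
    (forall q0, Q q0 -> exists r d : R,
      [/\ 0 < r, 0 < d & forall q, `|q0 - q| < r -> P d q]) ->
  exists2 d : R, 0 < d & forall q, Q q -> P d q.
Proof.
move=> /compact_near_coveringP cov Pmono loc.
have H : \forall d \near (0 : R)^'+, Q `<=` P d.
  apply: (cov R (0 : R)^'+ P) => q0 Qq0.
  have [r [d [r0 d0 hr]]] := loc q0 Qq0.
  exists ([set q | `|q0 - q| < r], [set d' : R | 0 < d' /\ d' <= d]); last first.
    by case=> q d' /= [qr [d'0 d'd]]; apply: Pmono d'0 d'd _; exact: hr.
  split => /=; first by apply/nbhs_normP; exists r.
  near=> d'; split; near: d'; first exact: nbhs_right_gt.
  exact: nbhs_right_le.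
have [d Qd d0] : exists2 d : R, Q `<=` P d & 0 < d.
  by near (0 : R)^'+ => d; exists d; near: d => //; exact: nbhs_right_gt.
by exists d => // q; exact: Qd.
Unshelve. all: by end_near. Qed.

(** q' is not confined to Q: segments between two trajectories may leave K. *)
Lemma compact_uniform_continuity (G : X -> Y) (Q : set X) (e : R) :
    compact Q -> continuous G -> 0 < e ->
  exists2 d : R, 0 < d & forall q, Q q -> forall q', `|q - q'| < d -> `|G q - G q'| < e.
Proof.
move=> Qc Gc e0; have e2 : 0 < e / 2 by rewrite divr_gt0.
apply: (compact_uniform (P := fun d q => forall q', `|q - q'| < d -> `|G q - G q'| < e)) => //.
  by move=> d d' q _ dd' h q' qq'; apply: h; exact: lt_le_trans dd'.
move=> q0 _; have /cvgrPdist_lt/(_ _ e2)/nbhs_normP[r /= r0 hr] := Gc q0.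
have r2 : 0 < r / 2 by rewrite divr_gt0.
exists (r / 2), (r / 2); split => // q q0q q' qq'.
rewrite -[G q](subrK (G q0)) -addrA; apply: le_lt_trans (ler_normD _ _) _.
rewrite (splitr e) ltrD //.
  by rewrite distrC; apply: hr => /=; apply: lt_trans q0q _; rewrite ltr_pdivrMr // ltr_pMr // ltr1n.
apply: hr => /=; rewrite -[q0](subrK q) -addrA; apply: le_lt_trans (ler_normD _ _) _.
by rewrite (splitr r) ltrD.
Qed.

Lemma compact_continuous_bounded (G : X -> Y) (Q : set X) :
  compact Q -> continuous G -> exists2 M : R, 0 < M & forall q, Q q -> `|G q| <= M.
Proof.
move=> Qc Gc.
(* A bound written as the inverse of d becomes a downward closed condition on d. *)
have [d d0 hd] : exists2 d : R, 0 < d & forall q, Q q -> `|G q| <= d^-1.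
  apply: (compact_uniform (P := fun d q => `|G q| <= d^-1)) => //.
    by move=> d d' q d0 dd' h; apply: le_trans h _; rewrite lef_pV2 ?posrE // (lt_le_trans d0).
  move=> q0 _; have /cvgrPdist_lt/(_ _ ltr01)/nbhs_normP[r /= r0 hr] := Gc q0.
  have G1 : 0 < `|G q0| + 1 by rewrite ltr_wpDl.
  exists r, (`|G q0| + 1)^-1; split => //; rewrite ?invr_gt0 // => q q0q; rewrite invrK -[G q](subrKC (G q0)).
  by apply: le_trans (ler_normD _ _) _; rewrite lerD2l distrC ltW // hr.
by exists d^-1 => //; rewrite invr_gt0.
Qed.

End CompactUniformity.

Section MeanValue.
Variables (R : realType) (n : nat).
Local Notation V := 'rV[R]_n.

Lemma is_derive_coord (y : R -> V) (t : R) (dy : V) j :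
  is_derive t 1 y dy -> is_derive t 1 (fun s => y s 0 j) (dy 0 j).
Proof.
move=> [hy ey]; apply: DeriveDef; first by move/derivable_mxP : hy; apply.
by rewrite -ey derive_mx // mxE.
Qed.

(** The sup norm reduces this to each coordinate with no loss in the constant. *)
Lemma le_mean_value_rV (y dy : R -> V) (a b C : R) : a <= b -> 0 <= C ->
    {within `[a, b], continuous y} ->
    (forall t, a < t < b -> is_derive t 1 y (dy t)) ->
    (forall t, a < t < b -> `|dy t| <= C) ->
  `|y b - y a| <= C * (b - a).
Proof.
move=> ab C0 yc hy hC.
have [->|aNb] := eqVneq a b; first by rewrite !subrr normr0 mulr0.
have {aNb} ltab : a < b by rewrite lt_neqAle aNb.
apply: mxnorm_le => [|i j]; first by rewrite mulr_ge0 // subr_ge0.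
rewrite !mxE (ord1 i).
have [||c cab ->] := MVT (f := fun t => y t 0 j) (df := fun t => dy t 0 j) ltab.
- move=> t; rewrite in_itv /= => tab; apply: is_derive_coord; exact: hy.
- move=> t; apply: (@continuous_comp (subspace `[a, b]) _ _ y (fun M : V => M 0 j) t (yc t)).
  exact: coord_continuous.
rewrite in_itv /= in cab.
rewrite normrM [`|b - a|]ger0_norm ?subr_ge0 // ler_wpM2r ?subr_ge0 //.
exact: le_trans (mxnorm_entry _ _ _) (hC _ cab).
Qed.

Lemma norm_mulmxr (z : V) m (A : 'M[R]_(n, m)) : `|z *m A| <= n%:R * `|A| * `|z|.
Proof.
apply: mxnorm_le => [|i j]; first by rewrite !mulr_ge0.
rewrite mxE; apply: le_trans (ler_norm_sum _ _ _) _.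
rewrite -mulrA mulr_natl -[X in _ *+ X](card_ord n) -sumr_const.
apply: ler_sum => l _; rewrite normrM mulrC.
by apply: ler_pM => //; exact: mxnorm_entry.
Qed.

End MeanValue.

Section SpaceDerivative.
Variables (R : realType) (n : nat).
Local Notation V := 'rV[R]_n.
Variable g : R * V -> V.
Hypothesis gC1 : C1 g.

Definition space_jac (q : R * V) : 'M[R]_n :=
  \matrix_(i, j) ('d g q (0, delta_mx 0 i)) 0 j.

Lemma space_jacE q v : v *m space_jac q = 'd g q (0, v).
Proof.
rewrite {2}[v]row_sum_delta.
have -> : (0, \sum_j v 0 j *: delta_mx 0 j) = \sum_j v 0 j *: ((0 : R), (delta_mx 0 j : V)).
  elim: (index_enum _) => [|j s IHs]; rewrite ?big_nil // !big_cons -IHs.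
  by congr (_, _); rewrite /= scaler0 add0r.
rewrite linear_sum; apply/rowP => j; rewrite mxE summxE.
by apply: eq_bigr => i _; rewrite linearZ !mxE.
Qed.

Lemma space_jac_continuous : continuous space_jac.
Proof.
have [_ gc] := gC1.
move=> q; apply/cvgrPdist_le => e e0.
have H (i : 'I_n) : \forall q' \near q,
    `|'d g q (0, delta_mx 0 i) - 'd g q' (0, delta_mx 0 i)| <= e.
  by have /cvgrPdist_le := gc (0, delta_mx 0 i) q; apply.
have := filter_forall (nbhs_filter q) H.
apply: filterS => q' h; apply: mxnorm_le => [|i j]; first exact: ltW.
rewrite !mxE; apply: le_trans (h i).
by have := mxnorm_entry ('d g q (0, delta_mx 0 i) - 'd g q' (0, delta_mx 0 i)) 0 j; rewrite !mxE.
Qed.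

Lemma jacobian_slice t z : jacobian (fun z => g (t, z)) z = space_jac (t, z).
Proof.
apply/row_matrixP => i; rewrite !rowE space_jacE mul_rV_lin1.
have dp : is_diff z (fun z : V => (t, z)) (fun v => (0, v)).
  exact: (is_diff_pair (is_diff_cst t z) (is_diff_id z)).
have dg : is_diff (t, z) g ('d g (t, z)) by apply: differentiableP; have [] := gC1.
by rewrite (diff_val (is_diff_def := is_diff_comp dp dg)).
Qed.

Lemma is_derive_segment (t : R) (a w : V) (s : R) :
  is_derive s 1 (fun s : R => g (t, a + s *: w)) (w *m space_jac (t, a + s *: w)).
Proof.
have d1 : is_diff s (fun s : R => (t, a + s *: w)) (fun h => (0, 0 + h *: w)).
  exact: (is_diff_pair (is_diff_cst t s) (is_diffD (is_diff_cst a s) (is_diff_scalel s w))).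
have dg : is_diff (t, a + s *: w) g ('d g (t, a + s *: w)).
  by apply: differentiableP; have [] := gC1.
have d2 := is_diff_comp d1 dg.
have df : differentiable (fun s : R => g (t, a + s *: w)) s by exact: (ex_diff (is_diff_def := d2)).
apply: DeriveDef; first exact: diff_derivable.
by rewrite deriveE // (diff_val (is_diff_def := d2)) /= add0r scale1r space_jacE.
Qed.

Lemma space_increment (t : R) (a b z : V) (J : 'M[R]_n) (e : R) : 0 <= e ->
    (forall s : R, 0 <= s <= 1 -> `|space_jac (t, a + s *: (b - a)) - J| <= e) ->
  `|g (t, b) - g (t, a) - (b - a) *m J| <= n%:R * e * `|b - a|.
Proof.
move=> e0 h; set w := b - a in h *.
pose y (s : R) := g (t, a + s *: w) - s *: (w *m J).
pose dy (s : R) := w *m (space_jac (t, a + s *: w) - J).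
have dyE (s : R) : is_derive s 1 y (dy s).
  have h1 := is_derive_segment t a w s.
  have h2 : is_derive s 1 (fun s : R => s *: (w *m J)) (w *m J).
    have d1 := is_diff_scalel s (w *m J).
    have df : differentiable (fun s : R => s *: (w *m J)) s by exact: (ex_diff (is_diff_def := d1)).
    apply: DeriveDef; first exact: diff_derivable.
    by rewrite deriveE // (diff_val (is_diff_def := d1)) scale1r.
  by rewrite /dy mulmxBr; exact: (is_deriveB h1 h2).
have := @le_mean_value_rV _ _ y dy 0 1 (n%:R * e * `|w|) ler01 _ _ (fun s _ => dyE s) _.
rewrite /y scale0r addr0 scale1r /w subrKC scale1r scale0r subr0 subr0 mulr1.
rewrite addrAC; apply.
- by rewrite !mulr_ge0.
- apply: derivable_within_continuous => s _; by case: (dyE s).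
move=> s /andP[s0 s1]; apply: le_trans (norm_mulmxr _ _) _.
by rewrite ler_wpM2r // ler_wpM2l // h // !ltW.
Qed.

End SpaceDerivative.

Lemma prod_norm_lt (R : realType) (U W : normedModType R) (a : U) (b : W) (d : R) :
  `|a| < d -> `|b| < d -> `|(a, b)| < d.
Proof. by move=> ha hb; rewrite prod_normE /= gt_max ha hb. Qed.

Lemma scaled_quarter_le (R : realType) (a b : R) : 0 <= a -> 0 < b ->
  a * (b / (4 * (a + 1))) <= b / 4.
Proof.
move=> a0 b0; have a1 : 0 < a + 1 by rewrite ltr_wpDl.
have -> : a * (b / (4 * (a + 1))) = b / 4 * (a / (a + 1)) by field; rewrite gt_eqF.
by rewrite ler_piMr ?divr_ge0 ?(ltW b0) // ler_pdivrMr // mul1r lerDl.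
Qed.

Section Flow.
Variables (R : realType) (n : nat).
Local Notation V := 'rV[R]_n.
Variables (g : R * V -> V) (f x : R -> V -> V) (K : set V).
Hypotheses (gC1 : C1 g) (fg : forall t z, 0 <= t -> f t z = g (t, z)).
Hypothesis hx : forall z, K z -> is_solution f z (x ^~ z).
Hypothesis hK : forall z t, K z -> 0 <= t -> K (x t z).
Hypothesis Kc : compact K.

Lemma flow_continuous z t h : K z -> 0 <= t -> {within `[t, t + h], continuous (x ^~ z)}.
Proof.
move=> Kz t0; have [_ c _] := hx Kz.
apply: continuous_subspaceW c => s /=; rewrite !in_itv /= andbT => /andP[ts _].
exact: le_trans ts.
Qed.

Lemma flow_derive z (t : R) : K z -> 0 < t -> is_derive t 1 (x ^~ z) (g (t, x t z)).
Proof. by move=> Kz t0; have [_ _ d] := hx Kz; rewrite -fg ?ltW //; exact: d. Qed.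

(** The difference w of two trajectories satisfies w' = w J up to an error relative to |w|,
    uniformly over K and [0, T]. Relative errors are what a product of many steps can accumulate. *)
Lemma flow_step (T e : R) : 0 <= T -> 0 < e -> exists h0 rho : R, [/\ 0 < h0, 0 < rho &
  forall z z' t h, K z -> K z' -> 0 <= t <= T -> 0 < h -> h <= h0 ->
    `|x t z' - x t z| <= rho ->
  `|x (t + h) z' - x (t + h) z - (x t z' - x t z) *m (1%:M + h *: space_jac g (t, x t z))|
    <= h * e * `|x t z' - x t z|].
Proof.
move=> T0 e0.
pose Q := `[0, T + 1] `*` K.
have Qc : compact Q by apply: compact_setX => //; exact: segment_compact.
have gc : continuous g by move=> q; apply: differentiable_continuous; have [] := gC1.
have [M M0 hM] := compact_continuous_bounded Qc gc.
have [Jb Jb0 hJ] := compact_continuous_bounded Qc (space_jac_continuous gC1).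
pose N : R := n%:R; have N0 : 0 <= N by [].
have e'0 : 0 < e / (4 * (N + 1)) by rewrite divr_gt0 // mulr_gt0 // ltr_wpDl.
have [d d0 hd] := compact_uniform_continuity Qc (space_jac_continuous gC1) e'0.
pose L := N * Jb; have L0 : 0 <= L by rewrite mulr_ge0 // ltW.
pose A := L + e / 4; have A0 : 0 < A by rewrite ltr_wpDl // divr_gt0.
(* In turn: 1 keeps times below T + 1; the bound with M keeps each trajectory within d/4 of its
   position at t; the inverse of 2 A serves the absorption that bounds w by 2 |w t|; the last makes
   h L A at most e/4. *)
pose h0 := Num.min (Num.min 1 (d / (4 * (M + 1)))) (Num.min (2 * A)^-1 (e / (4 * (L * A + 1)))).
have LA : 0 <= L * A by rewrite mulr_ge0 // ltW.
exists h0, (d / 2); split.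
- rewrite !lt_min ltr01 invr_gt0 !divr_gt0 ?mulr_gt0 //; first by rewrite ltr_wpDl.
  by rewrite ltr_wpDl // ltW.
- by rewrite divr_gt0.
move=> z z' t h Kz Kz' /andP[t0 tT] hp; rewrite !le_min => /andP[/andP[h1 hd'] /andP[hA hLA]] close.
have M1 : 0 < M + 1 by rewrite ltr_wpDl // ltW.
rewrite ler_pdivlMr ?mulr_gt0 // in hd'.
rewrite -div1r ler_pdivlMr ?mulr_gt0 // in hA.
rewrite ler_pdivlMr ?mulr_gt0 ?ltr_wpDl // in hLA.
have tQ s y : t <= s -> s <= t + h -> K y -> Q (s, x s y).
  move=> ts sh Ky; have s0 : 0 <= s := le_trans t0 ts; split => /=; last exact: hK.
  by rewrite in_itv /= s0 (le_trans sh) // lerD.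
have tt : t <= t + h by rewrite lerDl ltW.
have lip y s : K y -> t <= s -> s <= t + h -> `|x s y - x t y| <= M * h.
  move=> Ky ts sh; have := @le_mean_value_rV R n (x ^~ y) (fun s => g (s, x s y)) t s M ts (ltW M0).
  move=> /(_ _ _ _) H; apply: le_trans (H _ _ _) _.
  - by rewrite -[s](subrKC t); exact: flow_continuous.
  - by move=> u /andP[tu _]; apply: flow_derive => //; exact: le_lt_trans tu.
  - move=> u /andP[tu us]; apply: hM; apply: tQ => //; first exact: ltW.
    exact: le_trans (ltW us) sh.
  - by rewrite ler_wpM2l ?(ltW M0) // lerBlDl.
pose w s := x s z' - x s z.
pose J := space_jac g (t, x t z).
have Jt (v : V) : `|v *m J| <= L * `|v|.
  apply: le_trans (norm_mulmxr _ _) _; rewrite ler_wpM2r // ler_wpM2l // hJ //.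
  exact: tQ.
have key s : t <= s -> s <= t + h -> `|g (s, x s z') - g (s, x s z) - w s *m J| <= e / 4 * `|w s|.
  move=> ts sh.
  apply: (@le_trans _ _ (N * (e / (4 * (N + 1))) * `|w s|)); last first.
    by rewrite ler_wpM2r // scaled_quarter_le.
  apply: space_increment => //; first exact: ltW.
  move=> u /andP[u0 u1]; rewrite distrC ltW //; apply: hd; first exact: tQ.
  apply: prod_norm_lt => /=.
    rewrite distrC ger0_norm ?subr_ge0 //; nra.
  have -> : x t z - (x s z + u *: (x s z' - x s z)) =
     (1 - u) *: (x t z - x s z) + u *: ((x t z' - x s z') - (x t z' - x t z)).
    by rewrite !scalerBl !scalerBr !scale1r; apply/matrixP => i j; rewrite !mxE; ring.
  apply: le_lt_trans (ler_normD _ _) _; rewrite !normrZ.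
  rewrite (ger0_norm u0) ger0_norm ?subr_ge0 //.
  have l1 := lip z s Kz ts sh; have l2 := lip z' s Kz' ts sh.
  have l3 := ler_normB (x t z' - x s z') (x t z' - x t z).
  rewrite distrC in l1; rewrite distrC in l2.
  have := ler_wpM2l u0 (le_trans l3 (lerD l2 close)).
  have u1' : 0 <= 1 - u by rewrite subr_ge0.
  have := ler_wpM2l u1' l1; nra.
have dw s : t < s -> is_derive s 1 w (g (s, x s z') - g (s, x s z)).
  by move=> ts; have s0 := le_lt_trans t0 ts; apply: is_deriveB; exact: flow_derive.
have wc s : t <= s -> s <= t + h -> {within `[t, s], continuous w}.
  move=> ts sh; rewrite -[s](subrKC t) => u.
  by apply: continuousB; exact: flow_continuous.
have dwb s : t <= s -> s <= t + h -> `|g (s, x s z') - g (s, x s z)| <= A * `|w s|.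
  move=> ts sh; rewrite -[g _ - _](subrK (w s *m J)); apply: le_trans (ler_normD _ _) _.
  by rewrite mulrDl addrC lerD // key.
(* At a maximum c of |w|, |w c| <= |w t| + A h |w c| and A h <= 1/2, so the last term is
   absorbed. *)
have [S S0 hS] : exists2 S, 0 <= S & (forall s, t <= s -> s <= t + h -> `|w s| <= S) /\ S <= 2 * `|w t|.
  have [|c] := @EVT_max _ (fun s => `|w s|) t (t + h) tt.
    move=> u; apply: (@continuous_comp (subspace `[t, t + h]) _ _ w (fun v : V => `|v|) u (wc _ tt (lexx _) u)).
    exact: norm_continuous.
  rewrite in_itv /= => /andP[tc ch] cmax; exists `|w c| => //; split.
    by move=> s ts sh; apply: cmax; rewrite in_itv /= ts.
  have H : `|w c - w t| <= A * `|w c| * (c - t).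
    apply: (@le_mean_value_rV R n w (fun s => g (s, x s z') - g (s, x s z))) => //.
    - by rewrite mulr_ge0 // ltW.
    - exact: wc.
    - by move=> s /andP[ts _]; exact: dw.
    - move=> s /andP[/ltW ts /ltW sc]; have sh := le_trans sc ch.
      apply: le_trans (dwb s ts sh) _; rewrite ler_wpM2l ?(ltW A0) //.
      by apply: cmax; rewrite in_itv /= ts.
  have H2 := ler_normD (w c - w t) (w t); rewrite subrK in H2.
  have H3 : A * `|w c| * (c - t) <= `|w c| / 2.
    rewrite mulrAC mulrC ler_wpM2l //; nra.
  lra.
case: hS => hS S2.
have wdiff s : t <= s -> s <= t + h -> `|w s - w t| <= A * S * h.
  move=> ts sh; apply: (@le_trans _ _ (A * S * (s - t))); last first.
    by rewrite ler_wpM2l ?mulr_ge0 ?(ltW A0) // lerBlDl.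
  apply: (@le_mean_value_rV R n w (fun s => g (s, x s z') - g (s, x s z))) => //.
  - by rewrite mulr_ge0 // ltW.
  - exact: wc.
  - by move=> u /andP[tu _]; exact: dw.
  - move=> u /andP[/ltW tu /ltW us]; have uh := le_trans us sh.
    by apply: le_trans (dwb u tu uh) _; rewrite ler_wpM2l ?(ltW A0) // hS.
pose y s := w s - s *: (w t *m J).
have dy s : t < s -> is_derive s 1 y (g (s, x s z') - g (s, x s z) - w t *m J).
  move=> ts; apply: is_deriveB; first exact: dw.
  have d1 := is_diff_scalel s (w t *m J).
  have df : differentiable (fun s : R => s *: (w t *m J)) s by exact: (ex_diff (is_diff_def := d1)).
  apply: DeriveDef; first exact: diff_derivable.
  by rewrite deriveE // (diff_val (is_diff_def := d1)) scale1r.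
have H : `|y (t + h) - y t| <= e * `|w t| * (t + h - t).
  apply: (@le_mean_value_rV R n y (fun s => g (s, x s z') - g (s, x s z) - w t *m J)) => //.
  - by rewrite mulr_ge0 // ltW.
  - move=> u; apply: continuousB; first exact: wc.
    apply: continuous_subspaceT => v; exact: scalel_continuous.
  - by move=> s /andP[ts _]; exact: dy.
  - move=> s /andP[/ltW ts /ltW sh].
    rewrite -[g _ - _ - _](subrKA (w s *m J)) -mulmxBl; apply: le_trans (ler_normD _ _) _.
    have k1 := key s ts sh; have k2 := le_trans (Jt (w s - w t)) (ler_wpM2l L0 (wdiff s ts sh)).
    have k3 := ler_wpM2l (ltW e0) (hS s ts sh).
    apply: le_trans (lerD k1 k2) _.
    have h3 : h * (L * A) <= e / 4 by lra.
    have k4 := ler_wpM2r S0 h3.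
    have -> : L * (A * S * h) = h * (L * A) * S by ring.
    have k5 := ler_wpM2l (ltW e0) S2.
    move: k3 k4 k5; lra.
have -> : x (t + h) z' - x (t + h) z - (x t z' - x t z) *m (1%:M + h *: space_jac g (t, x t z)) =
    y (t + h) - y t.
  rewrite /y mulmxDr mulmx1 -scalemxAr -/J -/(w t) -/(w (t + h)).
  by apply/matrixP => i j; rewrite !mxE; ring.
by move: H; rewrite [t + h]addrC addrK; congr (_ <= _); ring.
Qed.

End Flow.

(** * Euler products for the variational equation *)

Section Euler.
Variables (R : realType) (n : nat).
Local Notation V := 'rV[R]_n.
Variables (g : R * V -> V) (f x : R -> V -> V) (K : set V).

(* Explicit Euler products for the variational equation along the trajectory of z. *)
Fixpoint euler (h : R) (z : V) (i : nat) : 'M[R]_n :=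
  if i is j.+1 then euler h z j *m (1%:M + h *: space_jac g (j%:R * h, x (j%:R * h) z))
  else 1%:M.

Hypotheses (gC1 : C1 g) (fg : forall t z, 0 <= t -> f t z = g (t, z)).
Hypothesis hx : forall z, K z -> is_solution f z (x ^~ z).
Hypothesis hK : forall z t, K z -> 0 <= t -> K (x t z).
Hypothesis Kc : compact K.

Lemma powR1D_expR (b : R) i : 0 <= 1 + b -> (1 + b) ^+ i <= expR (b * i%:R).
Proof.
move=> b0; rewrite mulrC expRM_natl; apply: lerXn2r; rewrite ?nnegrE ?expR_ge0 //.
exact: expR_ge1Dx.
Qed.

(** A discrete Gronwall estimate. B depends on T but not on e, so kappa can be chosen from
    [expR (B * T)] and e afterwards from kappa. *)
Lemma euler_error (T : R) : 0 <= T -> exists2 B : R, 0 <= B &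
  (forall h z N, 0 < h -> N%:R * h <= T -> K z -> `|euler h z N| <= expR (B * T)) /\
  forall e : R, 0 < e <= 1 -> exists h0 rho : R, [/\ 0 < h0, 0 < rho &
    forall h z z' N, 0 < h -> h <= h0 -> N%:R * h <= T -> K z -> K z' -> `|z' - z| <= rho ->
    `|x (N%:R * h) z' - x (N%:R * h) z - (z' - z) *m euler h z N| <= T * e * expR (B * T) * `|z' - z|].
Proof.
move=> T0; pose Q := `[0, T] `*` K.
have Qc : compact Q by apply: compact_setX => //; exact: segment_compact.
have [Jb Jb0 hJ] := compact_continuous_bounded Qc (space_jac_continuous gC1).
pose L : R := n%:R * Jb; have L0 : 0 <= L by rewrite mulr_ge0 // ltW.
(* The extra 1 absorbs the one-step error, as e <= 1. *)
pose B := L + 1; have B0 : 0 <= B by rewrite addr_ge0.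
have hT h N i : 0 < h -> N%:R * h <= T -> (i <= N)%N -> 0 <= i%:R * h <= T.
  move=> h0 NT iN; rewrite mulr_ge0 ?(ltW h0) //=; apply: le_trans NT.
  by rewrite ler_wpM2r ?(ltW h0) // ler_nat.
have hL h N i z (v : V) : 0 < h -> N%:R * h <= T -> (i <= N)%N -> K z ->
    `|v *m (1%:M + h *: space_jac g (i%:R * h, x (i%:R * h) z))| <= (1 + h * L) * `|v|.
  move=> h0 NT iN Kz; have := hT h N i h0 NT iN => ih; case/andP: (ih) => ih0 _.
  rewrite mulmxDr mulmx1 -scalemxAr; apply: le_trans (ler_normD _ _) _.
  rewrite mulrDl mul1r lerD2l normrZ gtr0_norm // -mulrA ler_wpM2l ?(ltW h0) //.
  apply: le_trans (norm_mulmxr _ _) _; rewrite ler_wpM2r // ler_wpM2l // hJ //.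
  by split => /=; [rewrite in_itv|exact: hK].
exists B => //; split.
  move=> h z N h0 NT Kz.
  have hv (v : V) i : (i <= N)%N -> `|v *m euler h z i| <= (1 + h * B) ^+ i * `|v|.
    elim: i => [|i IHi] iN; first by rewrite expr0 mul1r mulmx1.
    rewrite /= mulmxA; apply: le_trans (hL _ _ _ _ _ h0 NT (ltnW iN) Kz) _.
    rewrite exprS -mulrA; apply: ler_pM => //; last exact: IHi (ltnW iN).
      by rewrite addr_ge0 // mulr_ge0 // ltW.
    by rewrite lerD2l ler_wpM2l ?(ltW h0) // lerDl.
  apply: mxnorm_le => [|i j]; first exact: expR_ge0.
  have := mxnorm_entry (delta_mx 0 i *m euler h z N : V) 0 j.
  rewrite -rowE mxE => H; apply: le_trans H _.
  rewrite rowE; apply: le_trans (hv _ N (leqnn N)) _.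
  rewrite -[leRHS]mulr1; apply: ler_pM => //.
  - by rewrite exprn_ge0 // addr_ge0 // mulr_ge0 // ltW.
  - apply: le_trans (powR1D_expR _ _) _; first by rewrite addr_ge0 // mulr_ge0 // ltW.
    by rewrite ler_expR mulrAC mulrC ler_wpM2l // mulrC.
  - apply: mxnorm_le => // a b; rewrite mxE; case: (_ && _); rewrite ?normr1 ?normr0 //.
move=> e /andP[e0 e1].
have [h0 [rho [h00 rho0 step]]] := flow_step gC1 fg hx hK Kc T0 e0.
(* Distances grow by at most [expR (B * T)], so this initial closeness keeps every step within the
   range of [flow_step]. *)
exists h0, (rho / expR (B * T)); split => //; first by rewrite divr_gt0 // expR_gt0.
move=> h z z' N hp hh0 NT Kz Kz' close.
pose D i := x (i%:R * h) z' - x (i%:R * h) z.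
have D0 : D 0%N = z' - z.
  by rewrite /D mul0r; have [-> _ _] := hx Kz; have [-> _ _] := hx Kz'.
pose q := 1 + h * B.
have q0 : 0 <= q by rewrite addr_ge0 // mulr_ge0 // ltW.
have qE i : (i <= N)%N -> q ^+ i <= expR (B * T).
  move=> iN; apply: le_trans (powR1D_expR _ q0) _.
  rewrite ler_expR mulrAC mulrC ler_wpM2l // mulrC.
  by case/andP: (hT h N i hp NT iN).
have main i : (i <= N)%N -> `|D i| <= q ^+ i * `|z' - z| /\
    `|D i - (z' - z) *m euler h z i| <= i%:R * h * e * q ^+ i * `|z' - z|.
  elim: i => [|i IHi] iN; first by rewrite D0 expr0 mul1r mulmx1 subrr normr0 !mul0r.
  have [IH1 IH2] := IHi (ltnW iN).
  have Dr : `|D i| <= rho.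
    apply: le_trans IH1 _; apply: le_trans (ler_pM _ _ (qE _ (ltnW iN)) close) _ => //.
      by rewrite exprn_ge0.
    by rewrite mulrCA mulfV ?mulr1 // gt_eqF // expR_gt0.
  have iT := hT h N i hp NT (ltnW iN).
  have := step z z' (i%:R * h) h Kz Kz' iT hp hh0 Dr.
  rewrite -/(D i) (_ : i%:R * h + h = i.+1%:R * h); last by rewrite -natr1 mulrDl mul1r.
  rewrite -/(D i.+1); set J := 1%:M + _ => H.
  have HJ (v : V) : `|v *m J| <= (1 + h * L) * `|v| by exact: hL hp NT (ltnW iN) Kz.
  split.
    rewrite -[D i.+1](subrK (D i *m J)); apply: le_trans (ler_normD _ _) _.
    apply: le_trans (lerD H (HJ _)) _; rewrite -mulrDl exprS -mulrA.
    apply: ler_pM => //; first by rewrite addr_ge0 ?mulr_ge0 ?addr_ge0 ?mulr_ge0 // ltW.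
    rewrite /q /B mulrDr mulr1 addrCA lerD2l addrC lerD2l.
    by rewrite -[leRHS]mulr1 ler_wpM2l // ltW.
  rewrite /= mulmxA -/J.
  have -> : D i.+1 - (z' - z) *m euler h z i *m J =
    (D i.+1 - D i *m J) + (D i - (z' - z) *m euler h z i) *m J.
    by rewrite (mulmxBl (D i)) addrA subrK.
  apply: le_trans (ler_normD _ _) _; apply: le_trans (lerD H (HJ _)) _.
  have qq : 1 + h * L <= q by rewrite lerD2l ler_wpM2l ?(ltW hp) // lerDl.
  have h1 : h * e * `|D i| <= h * e * (q ^+ i.+1 * `|z' - z|).
    rewrite ler_wpM2l ?mulr_ge0 ?(ltW hp) ?(ltW e0) //.
    apply: le_trans IH1 _; rewrite ler_wpM2r // exprS ler_peMl ?exprn_ge0 //.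
    by rewrite /q lerDl mulr_ge0 // ltW.
  have h2 : (1 + h * L) * `|D i - (z' - z) *m euler h z i| <= q * (i%:R * h * e * q ^+ i * `|z' - z|).
    by apply: ler_pM => //; rewrite addr_ge0 // mulr_ge0 // ltW.
  apply: le_trans (lerD h1 h2) _.
  by rewrite le_eqVlt; apply/orP; left; apply/eqP; rewrite exprS -natr1; ring.
have [_ H] := main N (leqnn N).
apply: le_trans H _; rewrite ler_wpM2r //.
apply: ler_pM; rewrite ?exprn_ge0 ?mulr_ge0 ?(ltW hp) ?(ltW e0) ?qE //.
by rewrite ler_wpM2r // ltW.
Qed.

End Euler.

(** * Exponential decay of the compounds of Euler products *)

Lemma growth_perturb (R : realFieldType) (s eta u1 u2 v1 v2 e1 e2 : R) :
  (1 - s) * u1 <= (1 - s) * (v1 + e1) -> s * u2 <= s * (v2 + e2) ->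
  (1 - s) * e1 <= e1 -> s * e2 <= e2 -> e1 + e2 = eta / 4 ->
  (1 - s) * v1 + s * v2 <= - eta + eta / 4 -> (1 - s) * u1 + s * u2 <= - eta / 2.
Proof. by lra. Qed.

Section Growth.
Variables (R : realType) (n' : nat) (p : \bar R) (k : nat) (s eta : R).
Local Notation n := n'.+1.
Local Notation V := 'rV[R]_n.
Hypotheses (p1 : (1 <= p)%E) (s0 : 0 < s) (s1 : s <= 1) (eta0 : 0 < eta).
Variables (g : R * V -> V) (x : R -> V -> V) (K : set V).
Hypotheses (gC1 : C1 g) (Kc : compact K).
Hypothesis hK : forall z t, K z -> 0 <= t -> K (x t z).
Local Notation opn := (lp_opnorm p).
Local Notation sys q := (space_jac g q)^T.

Hypothesis contr : forall t z e, 0 <= t -> K z -> 0 < e -> exists2 h0 : R, 0 < h0 &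
  forall h : R, 0 < h -> h <= h0 ->
    (1 - s) * growth_rate p (add_compound k (sys (t, z))) h +
    s * growth_rate p (add_compound k.+1 (sys (t, z))) h <= - eta + e.

Lemma weighted_AMGM (a b : R) : 0 <= a -> 0 <= b -> a `^ (1 - s) * b `^ s <= (1 - s) * a + s * b.
Proof.
(* For s = 1 the inverse of 1 - s is no conjugate exponent; the factor with exponent 0 is then 1,
   even at a = 0. *)
move=> a0 b0; have [->|sN1] := eqVneq s 1.
  by rewrite subrr powRr0 powRr1 // !mul1r mul0r add0r.
have s'0 : 0 < 1 - s by rewrite subr_gt0 lt_neqAle sN1.
have e1 : (a `^ (1 - s)) `^ (1 - s)^-1 = a by rewrite -powRrM mulfV ?gt_eqF // powRr1.
have e2 : (b `^ s) `^ s^-1 = b by rewrite -powRrM mulfV ?gt_eqF // powRr1.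
have := @conjugate_powR _ (a `^ (1 - s)) (b `^ s) (1 - s)^-1 s^-1.
rewrite e1 e2 !invrK subrK [(1 - s) * a]mulrC [s * b]mulrC.
by apply; rewrite ?powR_ge0 ?invr_gt0.
Qed.

Lemma powR_le1 (u c : R) : 0 <= u -> u <= 1 -> 0 <= c -> u `^ c <= 1.
Proof.
move=> u0 u1 c0; rewrite -[leRHS](_ : 1 `^ c = 1); last by rewrite powR1.
by apply: ge0_ler_powR; rewrite ?nnegrE.
Qed.

Lemma add_compound_opnorm_lip l : exists2 C : R, 0 < C & forall A B : 'M[R]_n,
  opn (add_compound l A - add_compound l B) <= C * `|A - B|.
Proof.
have [C C0 hC] := add_compound_lip R n l.
exists ('C(n, l)%:R * 'C(n, l)%:R * C + 1); first by rewrite ltr_wpDl // !mulr_ge0.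
move=> A B; apply: le_trans (opnorm_le_entries p1 (c := C * `|A - B|) _ _) _.
- by rewrite mulr_ge0.
- by move=> i j; apply: hC => a b; exact: mxnorm_entry.
- by rewrite mulrA ler_wpM2r // lerDl.
Qed.

(** The threshold in [contr] depends on (t, z). At a fixed step the growth rate is Lipschitz in the
    matrix, so the estimate persists nearby, and monotonicity in h lets compactness supply one
    threshold. The two losses of eta/4 leave - eta/2. *)
Lemma uniform_growth (T : R) : exists2 h0 : R, 0 < h0 & forall t z h, 0 <= t <= T -> K z ->
  0 < h -> h <= h0 ->
    (1 - s) * growth_rate p (add_compound k (sys (t, z))) h +
    s * growth_rate p (add_compound k.+1 (sys (t, z))) h <= - eta / 2.
Proof.
have Qc : compact (`[0, T] `*` K) by apply: compact_setX => //; exact: segment_compact.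
have s'0 : 0 <= 1 - s by rewrite subr_ge0.
pose G h q := (1 - s) * growth_rate p (add_compound k (sys q)) h +
    s * growth_rate p (add_compound k.+1 (sys q)) h.
have Gmono d d' q : 0 < d -> d <= d' -> G d q <= G d' q.
  by move=> d0 dd'; rewrite lerD // ler_wpM2l ?(ltW s0) // growth_rate_homo.
have [|q0 [/= q0T q0K]|h0 h00 H] := compact_uniform (P := fun h q => G h q <= - eta / 2) Qc.
- by move=> d d' q d0 dd'; apply: le_trans; exact: Gmono.
- have e4 : 0 < eta / 4 by rewrite divr_gt0.
  have t0 : 0 <= q0.1 by move: q0T; rewrite in_itv => /andP[].
  have [d d0 hd] := contr t0 q0K e4.
  have [C1 C10 hC1] := add_compound_opnorm_lip k.
  have [C2 C20 hC2] := add_compound_opnorm_lip k.+1.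
  have e' : 0 < eta / 4 / (C1 + C2) by rewrite divr_gt0 // addr_gt0.
  have Gc := space_jac_continuous gC1.
  have /cvgrPdist_lt/(_ _ e')/nbhs_normP[r /= r0 hr] := Gc q0.
  exists r, d; split => // q q0q.
  have := hr q q0q; rewrite distrC => close.
  have trn : `|sys q - sys q0| <= eta / 4 / (C1 + C2).
    apply: mxnorm_le => [|i j]; first exact: ltW.
    have := mxnorm_entry (space_jac g q - space_jac g q0) j i.
    by rewrite !mxE => h; exact: le_trans h (ltW close).
  have l1 := growth_rate_lip p1 (add_compound k (sys q)) (add_compound k (sys q0)) d0.
  have l2 := growth_rate_lip p1 (add_compound k.+1 (sys q)) (add_compound k.+1 (sys q0)) d0.
  have b1 := le_trans (hC1 (sys q) (sys q0)) (ler_wpM2l (ltW C10) trn).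
  have b2 := le_trans (hC2 (sys q) (sys q0)) (ler_wpM2l (ltW C20) trn).
  have := hd d d0 (lexx _).
  have e12 : C1 * (eta / 4 / (C1 + C2)) + C2 * (eta / 4 / (C1 + C2)) = eta / 4.
    by field; rewrite gt_eqF // addr_gt0.
  have c1 := ler_wpM2l s'0 (le_trans l1 (lerD (lexx _) b1)).
  have c2 := ler_wpM2l (ltW s0) (le_trans l2 (lerD (lexx _) b2)).
  have f1 : (1 - s) * (C1 * (eta / 4 / (C1 + C2))) <= C1 * (eta / 4 / (C1 + C2)).
    by apply: ler_piMl (mulr_ge0 (ltW C10) (ltW e')) _; rewrite lerBlDr lerDl ltW.
  have f2 : s * (C2 * (eta / 4 / (C1 + C2))) <= C2 * (eta / 4 / (C1 + C2)).
    exact: ler_piMl (mulr_ge0 (ltW C20) (ltW e')) s1.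
  by rewrite -surjective_pairing; exact: growth_perturb c1 c2 f1 f2 e12.
exists h0 => // t z h tT Kz hp hh0; apply: le_trans (Gmono _ _ (t, z) hp hh0) (H (t, z) _).
by split => //=; rewrite in_itv.
Qed.

Lemma mul_compound_opnorm l (L : R) : 0 <= L -> exists2 C : R, 0 <= C &
  forall (A : 'M[R]_n) (h : R), `|A| <= L -> 0 < h <= 1 -> h * L <= 1 ->
   opn (mul_compound l (1%:M + h *: A)) <= 1 + h * growth_rate p (add_compound l A) h + C * h ^+ 2.
Proof.
move=> L0; have [C C0 hC] := mul_compound_add n l L0.
exists ('C(n, l)%:R * 'C(n, l)%:R * C); first by rewrite !mulr_ge0.
move=> A h AL /andP[h0 h1] hL.
set M := mul_compound _ _; set D := add_compound l A.
have -> : M = (1%:M + h *: D) + (M - 1%:M - h *: D) by rewrite -[M - _ - _]addrA -opprD subrKC.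
apply: le_trans (opnormD p1 _ _) _; apply: lerD.
  by rewrite /growth_rate mulrC divfK ?gt_eqF // subrKC.
rewrite -mulrA; apply: opnorm_le_entries => //; first by rewrite mulr_ge0 // sqr_ge0.
move=> i j; apply: hC => //; last by rewrite (ltW h0).
by move=> a b; apply: le_trans (mxnorm_entry _ _ _) AL.
Qed.

Lemma compound_euler (T : R) : 0 <= T -> exists2 h0 : R, 0 < h0 & forall h z N, 0 < h -> h <= h0 ->
  N%:R * h <= T -> K z ->
  opn (mul_compound k (euler g x h z N)^T) `^ (1 - s) *
  opn (mul_compound k.+1 (euler g x h z N)^T) `^ s <= expR (- eta / 4 * (N%:R * h)).
Proof.
move=> T0.
have [h1 h10 hg] := uniform_growth T.
have Qc : compact (`[0, T] `*` K) by apply: compact_setX => //; exact: segment_compact.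
have [L L0 hL] := compact_continuous_bounded Qc (space_jac_continuous gC1).
have [C1 C10 hC1] := mul_compound_opnorm k (ltW L0).
have [C2 C20 hC2] := mul_compound_opnorm k.+1 (ltW L0).
have s'0 : 0 <= 1 - s by rewrite subr_ge0.
have C120 : 0 < C1 + C2 + 1 by rewrite ltr_wpDl // addr_ge0.
(* A factor 1 + h J contributes at most 1 - h eta/2 plus a remainder of order h^2 from the
   compounds; the last bound makes that remainder at most h eta/4. *)
exists (Num.min (Num.min h1 1) (Num.min L^-1 (eta / 4 / (C1 + C2 + 1)))).
  by rewrite !lt_min h10 ltr01 invr_gt0 L0 !divr_gt0.
move=> h z N hp; rewrite !le_min => /andP[/andP[hh1 hle1] /andP[hL1 hC]] NT Kz.
have hL1' : h * L <= 1 by rewrite -ler_pdivlMr // mul1r.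
have h01 : 0 < h <= 1 by rewrite hp.
suff main i : (i <= N)%N ->
  opn (mul_compound k (euler g x h z i)^T) `^ (1 - s) *
  opn (mul_compound k.+1 (euler g x h z i)^T) `^ s <= expR (- eta / 4 * h) ^+ i.
  by rewrite mulrCA expRM_natl; exact: main.
elim: i => [|i IHi] iN.
  rewrite expr0 /= trmx1 !mul_compound1 -[leRHS]mulr1.
  apply: ler_pM; rewrite ?powR_ge0 //.
    by rewrite powR_le1 ?opnorm_ge0 ?opnorm1_le.
  by rewrite powR_le1 ?opnorm_ge0 ?opnorm1_le ?(ltW s0).
rewrite /=; set q := (i%:R * h, _).
have tT : 0 <= i%:R * h <= T.
  rewrite mulr_ge0 ?(ltW hp) //=; apply: le_trans NT.
  by rewrite ler_wpM2r ?(ltW hp) // ler_nat ltnW.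
have Kq : K (x (i%:R * h) z) by apply: hK => //; case/andP: tT.
have jq : `|sys q| <= L.
  apply: mxnorm_le => [|a b]; first exact: ltW.
  rewrite mxE; apply: le_trans (mxnorm_entry _ _ _) (hL _ _).
  by split => //=; rewrite in_itv.
(* Euler products act on row vectors and the system Jacobian on columns; after transposition the new
   factor stands on the left. *)
have -> : (euler g x h z i *m (1%:M + h *: space_jac g q))^T = (1%:M + h *: sys q) *m (euler g x h z i)^T.
  by rewrite trmx_mul linearD linearZ /= trmx1.
rewrite !mul_compoundM exprS.
have o1 := hC1 (sys q) h jq h01 hL1'; have o2 := hC2 (sys q) h jq h01 hL1'.
have gr := hg _ _ h tT Kq hp hh1.
set a1 := mul_compound k (1%:M + _) in o1 *; set a2 := mul_compound k.+1 (1%:M + _) in o2 *.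
have stepb : opn a1 `^ (1 - s) * opn a2 `^ s <= expR (- eta / 4 * h).
  apply: le_trans (weighted_AMGM (opnorm_ge0 p1 _) (opnorm_ge0 p1 _)) _.
  apply: le_trans (expR_ge1Dx _).
  have p1' := ler_wpM2l s'0 o1; have p2' := ler_wpM2l (ltW s0) o2.
  have gr' := ler_wpM2l (ltW hp) gr.
  have hC' : h * (C1 + C2 + 1) <= eta / 4 by rewrite -ler_pdivlMr.
  have hh : h * (h * (C1 + C2 + 1)) <= h * (eta / 4) by rewrite ler_wpM2l // ltW.
  have f1 : (1 - s) * (C1 * h ^+ 2) <= C1 * h ^+ 2.
    by apply: ler_piMl (mulr_ge0 C10 (sqr_ge0 _)) _; rewrite lerBlDr lerDl ltW.
  have f2 : s * (C2 * h ^+ 2) <= C2 * h ^+ 2.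
    exact: ler_piMl (mulr_ge0 C20 (sqr_ge0 _)) s1.
  have h2 : 0 <= h ^+ 2 by rewrite sqr_ge0.
  move: p1' p2' gr' hh f1 f2 h2; rewrite -/q; set G1 := growth_rate _ _ _; set G2 := growth_rate _ _ _.
  rewrite expr2; lra.
apply: le_trans (ler_pM _ _ stepb (IHi (ltnW iN))); rewrite ?mulr_ge0 ?powR_ge0 //.
rewrite mulrACA; apply: ler_pM; rewrite ?powR_ge0 //.
  by rewrite -powRM ?opnorm_ge0 // ge0_ler_powR ?nnegrE ?mulr_ge0 ?opnorm_ge0 ?opnormM.
by rewrite -powRM ?opnorm_ge0 // ge0_ler_powR ?nnegrE ?mulr_ge0 ?opnorm_ge0 ?opnormM ?(ltW s0).
Qed.

Lemma pivot_euler (T : R) : 0 <= T -> exists2 h0 : R, 0 < h0 & forall h z N, 0 < h -> h <= h0 ->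
  N%:R * h <= T -> K z ->
  (\prod_(a < k) `|pivot_iter a (euler g x h z N)|) `^ (1 - s) *
  (\prod_(a < k.+1) `|pivot_iter a (euler g x h z N)|) `^ s <= expR (- eta / 4 * (N%:R * h)).
Proof.
move=> T0; have [h0 h00 H] := compound_euler T0; exists h0 => // h z N hp hh0 NT Kz.
apply: le_trans (H h z N hp hh0 NT Kz).
have piv l : \prod_(a < l) `|pivot_iter a (euler g x h z N)| <=
    opn (mul_compound l (euler g x h z N)^T).
  have [I [J <-]] := pivot_minor l (euler g x h z N).
  have -> : \det (mxsub I J (euler g x h z N)) = \det (mxsub J I (euler g x h z N)^T).
    by rewrite -det_tr; congr (\det _); apply/matrixP => i j; rewrite !mxE.
  by apply: abs_minor_le => [|i j]; [exact: opnorm_ge0|exact: opnorm_entry].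
have pg l : 0 <= \prod_(a < l) `|pivot_iter a (euler g x h z N)| by apply: prodr_ge0.
by apply: ler_pM; rewrite ?powR_ge0 // ge0_ler_powR ?nnegrE ?opnorm_ge0 ?subr_ge0 ?(ltW s0) ?pg.
Qed.

End Growth.

Lemma alpha_contracting_growth (R : realType) (n : nat) (p : \bar R) (alpha : R)
    (f : R -> 'rV[R]_n -> 'rV[R]_n) (g : R * 'rV[R]_n -> 'rV[R]_n) (D : set 'rV[R]_n) :
  (1 <= p)%E -> 1 <= alpha < n%:R -> C1 g -> (forall t z, 0 <= t -> f t z = g (t, z)) ->
  alpha_contracting p alpha f D ->
  exists (k : nat) (s eta : R), [/\ (k < n)%N, 0 < s <= 1, alpha = k%:R + s, 0 < eta &
    forall t z e, 0 <= t -> D z -> 0 < e -> exists2 h0 : R, 0 < h0 & forall h : R, 0 < h -> h <= h0 ->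
      (1 - s) * growth_rate p (add_compound k (space_jac g (t, z))^T) h +
      s * growth_rate p (add_compound k.+1 (space_jac g (t, z))^T) h <= - eta + e].
Proof.
move=> p1 /andP[a1 an] gC1 fg [eta eta0 hc].
have jacE t z : 0 <= t -> system_jacobian f t z = (space_jac g (t, z))^T.
  move=> t0; have ft : f t = fun y => g (t, y) by apply/funext => y; exact: fg.
  by rewrite /system_jacobian ft jacobian_slice.
have a0 : 0 <= alpha by exact: le_trans a1.
have /andP[ta ta1] := truncn_itv a0.
move: hc; rewrite /alpha_contracting /alpha_add_compound; set k := Num.truncn alpha in ta ta1 *.
have kn : (k < n)%N by rewrite -(ltr_nat R); exact: le_lt_trans an.
have [s0|s0] := eqVneq (alpha - k%:R) 0 => /= hc.
  have ak : alpha = k%:R by apply/eqP; rewrite -subr_eq0 s0.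
  have k0 : (0 < k)%N by rewrite -(ler_nat R) -ak.
  exists k.-1, 1, eta; split => //; first by rewrite prednK // ltnW.
  - by rewrite ltr01 lexx.
  - by rewrite natr1 prednK.
  move=> t z e t0 Dz e0; have := hc t z t0 Dz; rewrite jacE // => hm.
  rewrite prednK //.
  have [|h0 h00 H] := lp_measure_growth p1 _ e0 hm; first by rewrite bin_gt0 ltnW.
  by exists h0 => // h hp hh; rewrite subrr mul0r add0r mul1r; exact: H.
pose s := alpha - k%:R; have s'0 : 0 < s by rewrite lt_neqAle eq_sym s0 subr_ge0.
have s1 : s < 1 by rewrite ltrBlDl natr1.
exists k, s, eta; split => //; first by rewrite s'0 ltW.
  by rewrite /s addrC subrK.
move=> t z e t0 Dz e0; have := hc t z t0 Dz; rewrite jacE // -/s frac_add_compoundE ?(ltW s'0) ?(ltW s1) //.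
by apply: lp_measure_tens; rewrite ?bin_gt0 ?s'0 ?s1 // ltnW.
Qed.

(* If q k >= kappa, the hypothesis on theta controls the weight since q k is bounded by
   2^k times every earlier pivot; otherwise kappa^s is small and only the crude bound P is used. *)
Lemma prod_pivot_weight (R : realType) (k : nat) (s b c m P theta kappa d : R) (q : nat -> R) :
  0 < s -> 0 <= b <= s -> 1 <= c -> 0 <= m -> 0 < kappa <= 1 -> kappa `^ (- b) <= 2 ->
  (forall a, 0 <= q a) -> (forall a, (a <= k)%N -> q k <= 2 ^+ k * q a) ->
  (forall a, (a < k)%N -> q a <= P) ->
  (\prod_(a < k) q a) `^ (1 - s) * (\prod_(a < k.+1) q a) `^ s <= theta ->
  c `^ (k%:R + s) * (m + 2 ^+ k) ^+ k * theta <= 1 / 4 ->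
  c `^ (k%:R + s) * (m * P + 1) ^+ k * kappa `^ s <= 1 / 4 ->
  d = Num.max (q k) kappa ->
  (\prod_(a < k) (m * q a / d + 1)) * (c * d) `^ (k%:R + s - b) <= 1 / 2.
Proof.
move=> s0 /andP[b0 bs] c1 m0 /andP[k0 k1] kb q0 qk qP qth hth hka dmax.
have c0 : 0 < c by exact: lt_le_trans c1.
have dk : kappa <= d by rewrite dmax le_max lexx orbT.
have d0 : 0 < d by exact: lt_le_trans dk.
have -> : (\prod_(a < k) (m * q a / d + 1)) * (c * d) `^ (k%:R + s - b) =
  c `^ (k%:R + s - b) * ((\prod_(a < k) (m * q a + d)) * (d `^ s * d `^ (- b))).
  rewrite powRM ?(ltW c0) ?(ltW d0) //.
  have -> : \prod_(a < k) (m * q a + d) = (\prod_(a < k) (m * q a / d + 1)) * d ^+ k.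
    rewrite -[X in d ^+ X]card_ord -prodr_const -big_split; apply: eq_bigr => a _ /=.
    by rewrite mulrDl mul1r divfK // gt_eqF.
  have -> : d `^ (k%:R + s - b) = d ^+ k * (d `^ s * d `^ (- b)).
    by rewrite -powR_mulrn ?(ltW d0) // -!powRD ?addrA // (gt_eqF d0) implybT.
  by rewrite mulrCA; congr (_ * _); rewrite !mulrA.
have db : d `^ (- b) <= 2.
  apply: le_trans kb; rewrite !powRN lef_pV2 ?posrE ?powR_gt0 //.
  by rewrite ge0_ler_powR ?nnegrE ?(ltW k0) ?(ltW d0).
have cb : c `^ (k%:R + s - b) <= c `^ (k%:R + s).
  by apply: ler_powR => //; rewrite gerBl.
set X := \prod_(a < k) (m * q a + d).
have X0 : 0 <= X by apply: prodr_ge0 => a _; rewrite addr_ge0 ?mulr_ge0 ?q0 // ltW.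
suff main : c `^ (k%:R + s) * (X * d `^ s) <= 1 / 4.
  apply: (@le_trans _ _ (c `^ (k%:R + s) * (X * (d `^ s * 2)))).
    by rewrite ler_pM ?powR_ge0 ?mulr_ge0 ?powR_ge0 // ler_wpM2l // ler_wpM2l ?powR_ge0.
  by rewrite [X * _]mulrA [_ * (_ * 2)]mulrA; move: main; lra.
have [kq|qk'] := leP kappa (q k).
  have dE : d = q k by rewrite dmax; apply/max_idPl.
  apply: le_trans hth; rewrite -mulrA ler_wpM2l ?powR_ge0 //.
  have th0 : 0 <= theta by apply: le_trans qth; rewrite mulr_ge0 ?powR_ge0.
  have Pi0 l : 0 <= \prod_(a < l) q a by apply: prodr_ge0.
  (* The weighted product of the two pivot products is the first k pivots times the power s of pivot
     number k. *)
  have e1 : (\prod_(a < k) q a) * q k `^ s <= theta.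
    apply: le_trans qth; rewrite big_ord_recr /= (powRM _ (Pi0 k) (q0 k)) mulrA -powRD.
      by rewrite subrK powRr1 ?Pi0.
    by rewrite subrK oner_eq0.
  (* Here d is the last pivot, at most 2^k times each earlier one, so d is absorbed into every
     factor. *)
  have e2 : X <= (m + 2 ^+ k) ^+ k * \prod_(a < k) q a.
    rewrite -[X in _ ^+ X * _]card_ord -prodr_const -big_split; apply: ler_prod => a _ /=.
    rewrite addr_ge0 ?mulr_ge0 ?q0 ?(ltW d0) //= mulrDl lerD2l dE.
    by apply: qk; exact: ltnW.
  apply: (@le_trans _ _ ((m + 2 ^+ k) ^+ k * (\prod_(a < k) q a) * d `^ s)).
    by rewrite ler_wpM2r ?powR_ge0.
  by rewrite -mulrA ler_wpM2l ?exprn_ge0 ?addr_ge0 ?exprn_ge0 // dE.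
have dE : d = kappa by rewrite dmax; apply/max_idPr; exact: ltW.
apply: le_trans hka; rewrite -mulrA ler_wpM2l ?powR_ge0 // dE ler_wpM2r ?powR_ge0 //.
rewrite -[X in _ ^+ X]card_ord -prodr_const; apply: ler_prod => a _ /=.
rewrite addr_ge0 ?mulr_ge0 ?q0 ?(ltW d0) //= dE; apply: lerD => //.
by rewrite ler_wpM2l // qP.
Qed.

(** * One covering step: the choice of all constants *)

Section Step.
Variables (R : realType) (n' : nat) (p : \bar R) (k : nat) (s eta : R).
Local Notation n := n'.+1.
Local Notation V := 'rV[R]_n.
Hypotheses (p1 : (1 <= p)%E) (s0 : 0 < s) (s1 : s <= 1) (eta0 : 0 < eta).
Variables (g : R * V -> V) (f x : R -> V -> V) (K : set V).
Hypotheses (gC1 : C1 g) (Kc : compact K) (fg : forall t z, 0 <= t -> f t z = g (t, z)).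
Hypothesis hx : forall z, K z -> is_solution f z (x ^~ z).
Hypothesis hK : forall z t, K z -> 0 <= t -> K (x t z).
Hypothesis contr : forall t z e, 0 <= t -> K z -> 0 < e -> exists2 h0 : R, 0 < h0 &
  forall h : R, 0 < h -> h <= h0 ->
    (1 - s) * growth_rate p (add_compound k (space_jac g (t, z))^T) h +
    s * growth_rate p (add_compound k.+1 (space_jac g (t, z))^T) h <= - eta + e.

Lemma covering_step : exists T d rho : R, [/\ 0 <= T, 0 < d, d < k%:R + s, 0 < rho &
  forall (U : set V) (r : R), U `<=` K -> 0 < r <= rho ->
    (forall z z', U z -> U z' -> `|z - z'| <= r) ->
    exists (L : seq (set V)) (r' : R),
      [/\ 0 < r', r' `^ d <= r `^ d / 2, (size L)%:R * r' `^ d <= r `^ d / 2,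
          forall z, U z -> exists2 W, W \in L & W (x T z) &
          forall W, W \in L -> W `<=` K /\ forall z z', W z -> W z' -> `|z - z'| <= r']].
Proof.
pose c : R := k%:R + 2 * n%:R + 2.
have c1 : 1 <= c by rewrite /c ler_wpDl ?addr_ge0 ?mulr_ge0 ?ler1n.
have c0 : 0 < c by exact: lt_le_trans c1.
pose m : R := 2 * n%:R; have m0 : 0 <= m by rewrite mulr_ge0.
pose A := c `^ (k%:R + s) * (m + 2 ^+ k) ^+ k.
have A0 : 0 <= A by rewrite mulr_ge0 ?powR_ge0 // exprn_ge0 // addr_ge0 // exprn_ge0.
(* Chosen so that eta T / 4 = 4 A + 1/4; then exp(x) >= 1 + x gives A theta <= 1/4. *)
pose T := (16 * A + 1) / eta; have T0 : 0 < T by rewrite divr_gt0 // ltr_wpDl // mulr_ge0.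
pose theta := expR (- eta / 4 * T).
have hth : A * theta <= 1 / 4.
  rewrite /theta mulNr mulNr expRN ler_pdivrMr ?expR_gt0 //.
  apply: le_trans (ler_wpM2l _ (expR_ge1Dx _)); last by rewrite divr_ge0.
  have -> : eta / 4 * T = 4 * A + 1 / 4 by rewrite /T; field; rewrite gt_eqF.
  by move: A0; lra.
have [B B0 [hE hstep]] := euler_error gC1 fg hx hK Kc (ltW T0).
have [h1 h10 hpiv] := pivot_euler p1 s0 s1 eta0 gC1 Kc hK contr (ltW T0).
pose E := expR (B * T); have E0 : 0 < E by exact: expR_gt0.
pose P := 2 ^+ k * E; have P0 : 0 <= P by rewrite mulr_ge0 ?exprn_ge0 // ltW.
pose C := c `^ (k%:R + s) * (m * P + 1) ^+ k.
have Cge1 : 1 <= C.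
  rewrite -[leLHS]mulr1; apply: ler_pM => //.
    rewrite -[leLHS](powRr0 c); apply: ler_powR => //; by rewrite addr_ge0 // ltW.
  by apply: exprn_ege1; rewrite lerDr mulr_ge0.
have C0 : 0 < C by exact: lt_le_trans Cge1.
(* The solution of C kappa^s = 1/4. *)
pose kappa := ((4 * C)^-1) `^ s^-1.
have kappas : kappa `^ s = (4 * C)^-1.
  by rewrite /kappa -powRrM mulVf ?gt_eqF // powRr1 // invr_ge0 mulr_ge0 // ltW.
have kappa0 : 0 < kappa by rewrite powR_gt0 // invr_gt0 mulr_gt0.
have kappa1 : kappa <= 1.
  have C40 : 0 < 4 * C by exact: mulr_gt0.
  apply: powR_le1; [by rewrite invr_ge0 ltW| |by rewrite invr_ge0 ltW].
  by rewrite (invf_le1 C40); move: Cge1; lra.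
have hka : C * kappa `^ s <= 1 / 4.
  by rewrite kappas invfM mulrCA (mulfV (lt0r_neq0 C0)) mulr1 mul1r.
have [b /andP[b0 bs] kb] : exists2 b : R, 0 < b < s & kappa `^ (- b) <= 2.
  have l0 : 0 <= - ln kappa by rewrite oppr_ge0 ln_le0.
  have l1 : 0 < 1 - ln kappa by rewrite ltr_pwDl.
  (* The first bound keeps d positive; the second gives - b ln kappa <= ln 2, the 1 keeping the
     denominator positive. *)
  exists (Num.min (s / 2) (ln 2 / (1 - ln kappa))).
    rewrite lt_min gt_min !divr_gt0 ?ln_gt0 ?ltr1n //=.
    by apply/orP; left; move: s0; lra.
  rewrite /powR gt_eqF //; apply: (@le_trans _ _ (expR (ln 2))); last by rewrite lnK // posrE.
  rewrite ler_expR mulNr -mulrN.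
  apply: (@le_trans _ _ (ln 2 / (1 - ln kappa) * - ln kappa)).
    by rewrite ler_wpM2r // ge_min lexx orbT.
  rewrite -mulrA ler_piMr ?ln_ge0 ?ler1n // mulrC ler_pdivrMr // mul1r.
  by rewrite lerDr.
pose e := Num.min 1 (kappa / (T * E)).
have TE0 : 0 < T * E by rewrite mulr_gt0.
have e01 : 0 < e <= 1 by rewrite lt_min ltr01 divr_gt0 //= ge_min lexx.
have eTE : T * e * E <= kappa.
  rewrite mulrAC mulrC -ler_pdivlMr //; by rewrite ge_min lexx orbT.
have [h2 [rho [h20 rho0 herr]]] := hstep e e01.
pose h0 := Num.min h1 h2; have h00 : 0 < h0 by rewrite lt_min h10.
(* N whole steps end exactly at T, with a step at most h0. *)
pose N := (Num.truncn (T / h0)).+1.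
have N0 : 0 < N%:R :> R by rewrite ltr0n.
pose h := T / N%:R; have hp : 0 < h by rewrite divr_gt0.
have hh0 : h <= h0.
  rewrite /h ler_pdivrMr // mulrC -ler_pdivrMr //; apply: ltW.
  by have /andP[] := truncn_itv (divr_ge0 (ltW T0) (ltW h00)).
have [hh1 hh2] : h <= h1 /\ h <= h2 by apply/andP; rewrite -le_min.
have NT : N%:R * h = T by rewrite /h mulrCA mulfV ?mulr1 // gt_eqF.
have NT' : N%:R * h <= T by rewrite NT.
pose d := k%:R + s - b.
have d0 : 0 < d by rewrite /d -addrA ltr_wpDl // subr_gt0.
exists T, d, rho; split => //; first exact: ltW.
  by rewrite /d gtrBl.
move=> U r UK /andP[r0 rr] Ud.
have [[z0 Uz0]|Unone] := pselect (exists z, U z); last first.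
  (* An empty U offers no base point for the linearisation; the empty list covers it, with the
     radius for which r'^d = r^d / 2. *)
  exists [::], (r * (2^-1) `^ d^-1); split => //.
  - by rewrite mulr_gt0 // powR_gt0 // invr_gt0.
  - rewrite powRM ?powR_ge0 ?(ltW r0) // -powRrM mulVf ?gt_eqF //.
    by rewrite powRr1 ?invr_ge0.
  - by rewrite mul0r divr_ge0 ?powR_ge0.
  - by move=> z Uz; case: Unone; exists z.
have Kz0 := UK _ Uz0.
set Y := euler g x h z0 N.
pose q a := `|pivot_iter a Y|.
have qle a l : (a <= l)%N -> q l <= 2 ^+ (l - a) * q a by move=> al; exact: pivot_iter_le.
have pow2 a l : (a <= l)%N -> (2 : R) ^+ a <= 2 ^+ l.
  by move=> al; apply: ler_weXn2l => //; rewrite ler1n.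
have qk a : (a <= k)%N -> q k <= 2 ^+ k * q a.
  by move=> ak; apply: le_trans (qle _ _ ak) _; apply: ler_wpM2r; rewrite /q // pow2 // leq_subr.
have qP a : (a < k)%N -> q a <= P.
  move=> ak; apply: le_trans (qle 0%N a (leq0n a)) _; rewrite subn0.
  have q0E : q 0%N <= E by exact: hE h z0 N hp NT' Kz0.
  exact: ler_pM (exprn_ge0 _ (ler0n _ 2)) (normr_ge0 _) (pow2 _ _ (ltnW ak)) q0E.
have := hpiv h z0 N hp hh1 NT' Kz0; rewrite NT -/theta => qth.
pose del := Num.max (q k) kappa.
have weight : (\prod_(a < k) (m * q a / del + 1)) * (c * del) `^ d <= 1 / 2.
  apply: (prod_pivot_weight (theta := theta) (kappa := kappa) (P := P)) => //.
  - by rewrite (ltW b0) ltW.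
  - by rewrite kappa0.
  - by move=> a; exact: normr_ge0.
have del0 : 0 < del by rewrite lt_max kappa0 orbT.
have [||||L [Ls Lc LU]] := @pivot_cover R n' k Y (x T) U z0 r del kappa r0 del0.
- by rewrite le_max lexx.
- by rewrite le_max lexx orbT.
- by move=> z Uz; exact: Ud.
- move=> z Uz; have := herr h z0 z N hp hh2 NT' Kz0 (UK _ Uz).
  rewrite NT => /(_ (le_trans (Ud _ _ Uz Uz0) rr)) H; apply: le_trans H _.
  have e0 : 0 <= e by case/andP: e01 => /ltW.
  exact: ler_pM (mulr_ge0 (mulr_ge0 (ltW T0) e0) (ltW E0)) (normr_ge0 _) eTE (Ud _ _ Uz Uz0).
(* The bound on the number of boxes is at least 1, so the estimate of the total weight also halves
   the weight of a single box, hence shrinks the mesh. *)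
have w1 : 1 <= \prod_(a < k) (m * q a / del + 1).
  elim/big_ind: _ => // [u v u1 v1|a _]; first exact: mulr_ege1.
  by rewrite lerDr divr_ge0 ?mulr_ge0 ?(ltW del0) //; exact: normr_ge0.
exists [seq x T @` W | W <- L], (c * del * r).
have r'E : (c * del * r) `^ d = (c * del) `^ d * r `^ d.
  by rewrite powRM ?mulr_ge0 ?(ltW c0) ?(ltW del0) ?(ltW r0).
have rd0 : 0 <= r `^ d by exact: powR_ge0.
split.
- by rewrite !mulr_gt0.
- rewrite r'E [leRHS]mulrC ler_wpM2r // -[2^-1]mul1r; apply: le_trans weight.
  by rewrite ler_peMl ?powR_ge0.
- rewrite size_map r'E mulrA [leRHS]mulrC ler_wpM2r // -[2^-1]mul1r; apply: le_trans weight.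
  by rewrite ler_wpM2r ?powR_ge0.
- move=> z Uz; have [W WL Wz] := Lc z Uz.
  by exists (x T @` W); [exact: map_f|exists z].
- move=> W' /mapP[W WL ->]; have [WU Wd] := LU W WL; split.
    by move=> _ [z Wz <-]; apply: hK; [apply: UK; exact: WU|exact: ltW].
  by move=> _ _ [z Wz <-] [z' Wz' <-]; exact: Wd.
Qed.

End Step.

(** * Hausdorff dimension *)

Section Cover.
Variables (R : realType) (n : nat).
Local Notation V := 'rV[R]_n.

(** Each piece carries its own positive radius, available even for a single point; a bounds the
    weight of each piece, hence the mesh. *)
Definition weighted_cover (K : set V) (d a w : R) (L : seq (set V * R)) :=
  [/\ forall z, K z -> exists2 u, u \in L & u.1 z,
      forall u, u \in L -> [/\ u.1 `<=` K, 0 < u.2, u.2 `^ d <= a &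
        forall z z', u.1 z -> u.1 z' -> `|z - z'| <= u.2] &
      \sum_(u <- L) u.2 `^ d <= w].

Lemma weighted_cover_exists (K : set V) (d rho : R) : compact K -> 0 < rho ->
  exists w L, weighted_cover K d (rho `^ d) w L.
Proof.
move=> Kc rho0; have rho2 : 0 < rho / 2 by rewrite divr_gt0.
move: (Kc); rewrite compact_cover => /(_ _ K (fun z => ball z (rho / 2))).
case=> [z _|z Kz|D' D'K cov]; first exact: ball_open.
  by exists z => //; exact: ballxx.
pose L := [seq (K `&` ball z (rho / 2), rho) | z <- finmap.enum_fset D'].
exists (\sum_(u <- L) u.2 `^ d), L; split => //.
  move=> z Kz; have [y /= yD' yz] := cov z Kz.
  by exists (K `&` ball y (rho / 2), rho) => //; apply: map_f.
move=> u /mapP[y yD' ->] /=; split => //.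
move=> z z' [_ zy] [_ z'y].
rewrite -[z](subrK y) -addrA; apply: le_trans (ler_normD _ _) _.
move: zy z'y; rewrite -!ball_normE /= => zy z'y.
by rewrite distrC [leRHS](splitr rho); apply: lerD; exact: ltW.
Qed.

Lemma weighted_cover_halve (K : set V) (phi : V -> V) (d rho a w : R) L :
  0 < d -> 0 < rho -> K `<=` phi @` K ->
  (forall (U : set V) (r : R), U `<=` K -> 0 < r <= rho ->
    (forall z z', U z -> U z' -> `|z - z'| <= r) ->
    exists (L : seq (set V)) (r' : R),
      [/\ 0 < r', r' `^ d <= r `^ d / 2, (size L)%:R * r' `^ d <= r `^ d / 2,
          forall z, U z -> exists2 W, W \in L & W (phi z) &
          forall W, W \in L -> W `<=` K /\ forall z z', W z -> W z' -> `|z - z'| <= r']) ->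
  a <= rho `^ d -> weighted_cover K d a w L ->
  exists L', weighted_cover K d (a / 2) (w / 2) L'.
Proof.
move=> d0 rho0 Kphi step arho [cov Lp Lw].
have /choice[F FP] : forall u : set V * R, exists v : seq (set V) * R, u \in L ->
  [/\ 0 < v.2, v.2 `^ d <= u.2 `^ d / 2, (size v.1)%:R * v.2 `^ d <= u.2 `^ d / 2,
    forall z, u.1 z -> exists2 W, W \in v.1 & W (phi z) &
    forall W, W \in v.1 -> W `<=` K /\ forall z z', W z -> W z' -> `|z - z'| <= v.2].
  move=> u; have [uL|uL] := boolP (u \in L); last by exists ([::], 0).
  have [uK u0 ua ud] := Lp u uL.
  have [|L' [r' H]] := step u.1 u.2 uK _ ud; last by exists (L', r').
  rewrite u0 leNgt; apply/negP => rhou.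
  have := le_trans ua arho; rewrite leNgt => /negP; apply.
  by apply: gt0_ltr_powR; rewrite ?nnegrE ?ltW.
exists (flatten [seq [seq (W, (F u).2) | W <- (F u).1] | u <- L]); split.
- move=> z /Kphi[y Ky <-]; have [u uL uy] := cov y Ky.
  have [_ _ _ FW _] := FP u uL; have [W WF Wy] := FW y uy.
  exists (W, (F u).2) => //; apply/flattenP.
  by exists [seq (W, (F u).2) | W <- (F u).1]; [exact: map_f|exact: map_f].
- move=> v /flattenP[_ /mapP[u uL ->] /mapP[W WF ->]] /=.
  have [F0 Fa _ _ /(_ W WF)[WK Wd]] := FP u uL; split => //.
  have [_ _ ua _] := Lp u uL; apply: le_trans Fa _; by rewrite ler_pM2r // invr_gt0.
rewrite big_flatten big_map; apply: (@le_trans _ _ (\sum_(u <- L) u.2 `^ d / 2)).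
  rewrite big_seq [leRHS]big_seq; apply: ler_sum => u uL.
  rewrite big_map /= big_const_seq count_predT iter_addr_0 -[leLHS]mulr_natl.
  by have [_ _ ? _ _] := FP u uL.
by rewrite -mulr_suml ler_pM2r // invr_gt0.
Qed.

Lemma weighted_cover_small (K : set V) (phi : V -> V) (d rho e : R) :
  0 < d -> 0 < rho -> compact K -> K `<=` phi @` K ->
  (forall (U : set V) (r : R), U `<=` K -> 0 < r <= rho ->
    (forall z z', U z -> U z' -> `|z - z'| <= r) ->
    exists (L : seq (set V)) (r' : R),
      [/\ 0 < r', r' `^ d <= r `^ d / 2, (size L)%:R * r' `^ d <= r `^ d / 2,
          forall z, U z -> exists2 W, W \in L & W (phi z) &
          forall W, W \in L -> W `<=` K /\ forall z z', W z -> W z' -> `|z - z'| <= r']) ->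
  0 < e -> exists L, weighted_cover K d e e L.
Proof.
move=> d0 rho0 Kc Kphi step e0.
have [w [L0 HL0]] := weighted_cover_exists d Kc rho0.
have it m : exists L, weighted_cover K d (rho `^ d / 2 ^+ m) (w / 2 ^+ m) L.
  elim: m => [|m [L IHm]]; first by exists L0; rewrite expr0 !divr1.
  have [|L' HL'] := weighted_cover_halve d0 rho0 Kphi step _ IHm.
    by rewrite ler_pdivrMr ?exprn_gt0 // ler_peMr ?powR_ge0 // exprn_ege1 // ler1n.
  by exists L'; rewrite exprSr invfM !mulrA.
pose M := Num.max (rho `^ d) w; pose m := (Num.truncn (M / e)).+1.
have M0 : 0 <= M by rewrite le_max powR_ge0.
have Mm : M / 2 ^+ m <= e.
  rewrite ler_pdivrMr ?exprn_gt0 // mulrC -ler_pdivrMr //; apply: (@le_trans _ _ m%:R).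
    by apply: ltW; have /andP[] := truncn_itv (divr_ge0 M0 (ltW e0)).
  by rewrite -natrX ler_nat ltnW // ltn_expl.
have [L [c1 c2 c3]] := it m; exists L; split => //.
  move=> u uL; have [? ? ua ?] := c2 u uL; split => //; apply: le_trans ua (le_trans _ Mm).
  by rewrite ler_pM2r ?invr_gt0 ?exprn_gt0 // le_max lexx.
apply: le_trans c3 (le_trans _ Mm).
by rewrite ler_pM2r ?invr_gt0 ?exprn_gt0 // le_max lexx orbT.
Qed.

Lemma euclidean_dist_le (z z' : V) r : 0 <= r -> `|z - z'| <= r -> euclidean_dist z z' <= n%:R * r.
Proof.
move=> r0 zr; rewrite /euclidean_dist /=.
have e : r = (r ^+ 2) `^ 2^-1.
  by rewrite -powR_mulrn // -powRrM mulfV // powRr1.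
have [n0|n0] := posnP n.
  rewrite big1 ?powR0 ?mulr_ge0 // => i _.
  by have := ltn_ord i; rewrite {2}n0.
apply: (@le_trans _ _ ((n%:R ^+ 2 * r ^+ 2) `^ 2^-1)).
  apply: ge0_ler_powR; rewrite ?nnegrE ?invr_ge0 ?mulr_ge0 ?sqr_ge0 //.
    by apply: sumr_ge0 => i _; exact: powR_ge0.
  apply: (@le_trans _ _ (\sum_(i < n) r ^+ 2)).
    apply: ler_sum => i _; rewrite powR_mulrn // lerXn2r ?nnegrE //.
    exact: le_trans (mxnorm_entry (z - z') 0 i) zr.
  rewrite sumr_const card_ord -[leLHS]mulr_natl ler_wpM2r ?sqr_ge0 //.
  by rewrite expr2 -natrM ler_nat leq_pmulr.
by rewrite -exprMn -powR_mulrn ?mulr_ge0 // -powRrM mulfV // powRr1 // mulr_ge0.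
Qed.

Lemma diameter_le (U : set V) r : 0 <= r ->
  (forall z z', U z -> U z' -> `|z - z'| <= r) -> (diameter U <= (n%:R * r)%:E)%E.
Proof.
move=> r0 Ud; apply: ge_ereal_sup => _ [->|[[z z'] [/= Uz Uz'] <-]].
  by rewrite lee_fin mulr_ge0.
by rewrite lee_fin euclidean_dist_le // Ud.
Qed.

Lemma diameter_ge0 (U : set V) : (0 <= diameter U)%E.
Proof. by apply: ereal_sup_ubound; left. Qed.

Lemma hausdorff_dim_le (K : set V) (d : R) : 0 < d ->
  (forall e, 0 < e -> exists L, weighted_cover K d e e L) -> (hausdorff_dim K <= d%:E)%E.
Proof.
move=> d0 small; apply: ereal_inf_lbound; exists d => //; split => //.
apply/le_anti/andP; split; last first.
  apply: le_trans (ereal_sup_ubound _); last by exists 1; [exact: ltr01|reflexivity].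
  by apply: le_ereal_inf_tmp => _ [U _ <-]; apply: nneseries_ge0 => i _ _; exact: poweR_ge0.
apply: ge_ereal_sup => _ [delta /= delta0 <-].
apply/lee_addgt0Pr => e e0; rewrite add0e.
pose nd := n%:R `^ d + 1; have nd0 : 0 < nd by rewrite ltr_wpDl ?powR_ge0.
(* The first bound forces the mesh below delta, the second the total weight below e; n + 1 instead
   of n also covers n = 0. *)
pose e' := Num.min ((delta / (n%:R + 1)) `^ d) (e / nd).
have n10 : 0 < n%:R + 1 :> R by rewrite ltr_wpDl.
have e'0 : 0 < e' by rewrite lt_min powR_gt0 ?divr_gt0.
have [L [cov Lp Lw]] := small e' e'0.
(* The finite cover is continued by empty sets of radius 0, which weigh nothing because d > 0. *)
pose u i := nth (set0, 0) L i.
have uP i : 0 <= (u i).2 /\ forall z z', (u i).1 z -> (u i).1 z' -> `|z - z'| <= (u i).2.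
  have [iL|iL] := ltnP i (size L); last by rewrite /u nth_default.
  by have [_ /ltW ? _ ?] := Lp _ (mem_nth (set0, 0) iL).
apply: (@le_trans _ _ (\sum_(0 <= i <oo) diameter (u i).1 `^ d)%E).
  apply: ereal_inf_lbound; exists (fun i => (u i).1) => //; split => [i|z Kz].
    have [u0 ud] := uP i; apply: le_trans (diameter_le u0 ud) _; rewrite lee_fin.
    have [iL|iL] := ltnP i (size L); last by rewrite /u nth_default //= mulr0 ltW.
    have [_ _ ua _] := Lp _ (mem_nth (set0, 0) iL).
    have : (u i).2 <= delta / (n%:R + 1).
      rewrite leNgt; apply/negP => lt.
      have : e' <= (delta / (n%:R + 1)) `^ d by rewrite ge_min lexx.
      rewrite leNgt => /negP; apply; apply: lt_le_trans ua.
      by apply: gt0_ltr_powR; rewrite ?nnegrE // ltW // divr_gt0.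
    rewrite ler_pdivlMr // => H; apply: le_trans H.
    by rewrite mulrC ler_wpM2l // lerDl.
  have [v vL vz] := cov z Kz; exists (index v L) => //.
  by rewrite /u nth_index.
apply: lime_le; first by apply: is_cvg_nneseries => i _ _; exact: poweR_ge0.
apply: nearW => N.
(* Lengthening the partial sum to N + [size L] includes the whole list whatever N is. *)
apply: (@le_trans _ _ (\sum_(0 <= i < N + size L) (n%:R `^ d * (u i).2 `^ d)%:E)%E).
  apply: (@le_trans _ _ (\sum_(0 <= i < N + size L) diameter (u i).1 `^ d)%E).
    by apply: lee_sum_nneg_natr => [i _ _|]; [exact: poweR_ge0|exact: leq_addr].
  apply: lee_sum => i _; have [u0 ud] := uP i.
  rewrite -powRM // -poweR_EFin; apply: gt0_ler_poweR; rewrite ?(ltW d0) //.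
  - by rewrite in_itv /= diameter_ge0 leey.
  - by rewrite in_itv /= leey lee_fin mulr_ge0.
  - exact: diameter_le.
rewrite sumEFin lee_fin -mulr_sumr (@big_cat_nat _ _ _ (size L)) ?leq_addl //=.
rewrite [X in _ * (_ + X)]big_nat_cond [X in _ * (_ + X)]big1 ?addr0; last first.
  by move=> i /andP[/andP[iL _] _]; rewrite /u nth_default //= powR0 // gt_eqF.
have -> : \sum_(0 <= i < size L) (u i).2 `^ d = \sum_(v <- L) v.2 `^ d.
  by rewrite (big_nth (set0, 0)).
apply: (@le_trans _ _ (nd * (e / nd))); last by rewrite mulrCA mulfV ?mulr1 // gt_eqF.
apply: ler_pM; rewrite ?powR_ge0 //.
- by apply: sumr_ge0 => v _; exact: powR_ge0.
- by rewrite lerDl.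
- by apply: le_trans Lw _; rewrite ge_min lexx orbT.
Qed.

End Cover.

Theorem corollary4 (R : realType) (n : nat) (p : \bar R) (alpha : R)
    (f : R -> 'rV[R]_n -> 'rV[R]_n) (x : R -> 'rV[R]_n -> 'rV[R]_n)
    (D : set 'rV[R]_n)
    (hp : (1 <= p)%E)
    (halpha : 1 <= alpha < n%:R)
    (hf : C1_system f)
    (hx : forall x0, D x0 -> is_solution f x0 (fun t => x t x0))
    (hD : forward_invariant x D)
    (hcontr : alpha_contracting p alpha f D) :
  forall K : set 'rV[R]_n,
    K `<=` D -> compact K -> strongly_invariant x K ->
    (hausdorff_dim K < alpha%:E)%E.
Proof.
move=> K KD Kc Kinv; have [g gC1 fg] := hf.
have [k [s [eta [kn /andP[s0 s1] alphaE eta0 contr]]]] :=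
  alpha_contracting_growth hp halpha gC1 fg hcontr.
(* Pivoting takes a largest entry, which exists only in positive dimension; k < n guarantees it. *)
case: n => [|n'] in f x D halpha hf hx hD hcontr K KD Kc Kinv g gC1 fg kn contr *.
  by rewrite ltn0 in kn.
have KxK z t : K z -> 0 <= t -> K (x t z).
  by move=> Kz t0; rewrite (Kinv t t0); exists z.
have [T [d [rho [T0 d0 da rho0 step]]]] :=
  covering_step hp s0 s1 eta0 gC1 Kc fg (fun z Kz => hx z (KD z Kz)) KxK
    (fun t z e t0 Kz => contr t z e t0 (KD z Kz)).
apply: (@le_lt_trans _ _ d%:E); last by rewrite lte_fin alphaE.
apply: hausdorff_dim_le => // e; apply: weighted_cover_small d0 rho0 Kc _ step.
by rewrite -(Kinv T T0).
Qed.
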